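(* Let $\alpha\in[0,\infty)$ and let $X$ be a ball Banach function space on $\mathbb{R}^n$ such that the Hardy--Littlewood maximal operator $M$ is bounded on the associate space $X'$. Then $$\mathrm{V}\mathcal{L}_{\alpha}=\mathrm{V}\mathcal{L}_{\alpha,X},\qquad \mathrm{X}\mathcal{L}_{\alpha}=\mathrm{X}\mathcal{L}_{\alpha,X},\qquad \mathrm{C}\mathcal{L}_{\alpha}=\mathrm{C}\mathcal{L}_{\alpha,X}.$$
   Context: Everything is on $\mathbb{R}^n$; $\mathscr M$ is the set of all measurable functions on $\mathbb{R}^n$; $\ell(Q)$ is the edge length of a cube $Q$; $Q+z$ is the translate of $Q$ by $z$; $\lfloor\alpha\rfloor$ is the largest integer not exceeding $\alpha$; $z\to\infty$ means $|z|\to\infty$. For $s\in\{0,1,2,\dots\}$, $f\in L^1_{\rm loc}$ and a cube $Q$, $P_Q^s(f)$ is the unique polynomial of degree at most $s$ with $\int_Q[f(x)-P_Q^s(f)(x)]x^\gamma\,dx=0$ for all multi-indices $\gamma$ with $|\gamma|\le s$. Campanato spaces. Put $\mathcal{O}_\alpha(f;Q):=|Q|^{-1-\frac{\alpha}{n}}\int_Q|f(x)-P_Q^{\lfloor\alpha\rfloor}(f)(x)|\,dx$. Then $\mathcal{L}_\alpha$ is the set of $f\in L^1_{\rm loc}$ with $\sup_Q\mathcal{O}_\alpha(f;Q)<\infty$ (supremum over all cubes); $\mathrm{V}\mathcal{L}_\alpha$ is the set of $f\in\mathcal{L}_\alpha$ with $\lim_{a\to0^+}\sup_{\ell(Q)\le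 a}\mathcal{O}_\alpha(f;Q)=0$; $\mathrm{X}\mathcal{L}_\alpha$ is the set of $f\in\mathrm{V}\mathcal{L}_\alpha$ such that $\lim_{z\to\infty}\mathcal{O}_\alpha(f;Q+z)=0$ for every fixed cube $Q$; $\mathrm{C}\mathcal{L}_\alpha$ is the set of $f\in\mathrm{X}\mathcal{L}_\alpha$ with $\lim_{a\to\infty}\sup_{\ell(Q)\ge a}\mathcal{O}_\alpha(f;Q)=0$. $X$-based versions. Put $\mathcal{O}_{\alpha,X}(f;Q):=\frac{|Q|^{-\alpha/n}}{\|\mathbf{1}_Q\|_X}\left\|[f-P_Q^{\lfloor\alpha\rfloor}(f)]\mathbf{1}_Q\right\|_X$ for $f\in L^1_{\rm loc}$. Then $\mathcal{L}_{\alpha,X}$ is the set of $f\in L^1_{\rm loc}$ with $\sup_Q\mathcal{O}_{\alpha,X}(f;Q)<\infty$ (supremum over all cubes); $\mathrm{V}\mathcal{L}_{\alpha,X}$ is the set of $f\in\mathcal{L}_{\alpha,X}$ with $\lim_{a\to0^+}\sup_{\ell(Q)\le a}\mathcal{O}_{\alpha,X}(f;Q)=0$; $\mathrm{X}\mathcal{L}_{\alpha,X}$ is the set of $f\in\mathrm{V}\mathcal{L}_{\alpha,X}$ such that $\lim_{z\to\infty}\mathcal{O}_{\alpha,X}(f;Q+z)=0$ for every fixed cube $Q$; $\mathrm{C}\mathcal{L}_{\alpha,X}$ is the set of $f\in\mathrm{X}\mathcal{L}_{\alpha,X}$ with $\lim_{a\to\infty}\sup_{\ell(Q)\ge a}\mathcal{O}_{\alpha,X}(f;Q)=0$.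 Ball Banach function space. A quasi-Banach space $X\subset\mathscr M$ is a ball quasi-Banach function space if: (i) $\|f\|_X=0$ implies $f=0$ a.e.; (ii) $|g|\le|f|$ a.e. implies $\|g\|_X\le\|f\|_X$; (iii) $0\le f_m\uparrow f$ a.e. implies $\|f_m\|_X\uparrow\|f\|_X$; (iv) $\mathbf{1}_B\in X$ for every ball $B$. It is a ball Banach function space if moreover $\|f+g\|_X\le\|f\|_X+\|g\|_X$ for all $f,g\in X$ and, for every ball $B$, there is $C_{(B)}>0$ with $\int_B|f|\,dx\le C_{(B)}\|f\|_X$ for all $f\in X$. The associate space is $X':=\{f\in\mathscr M:\ \|f\|_{X'}:=\sup_{g\in X,\|g\|_X=1}\|fg\|_{L^1}<\infty\}$. The Hardy--Littlewood maximal operator is $M(f)(x):=\sup_{r>0}\frac1{|B(x,r)|}\int_{B(x,r)}|f(y)|\,dy$. *)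

(* Defs.v *)
From HB Require Import structures.
From mathcomp Require Import all_boot all_order all_algebra.
(* The notations of mpoly clash with those of mathcomp-analysis. *)
From mathcomp Require Import -(notations) mpoly.
From mathcomp Require Import all_classical all_reals all_analysis.

Set Implicit Arguments.
Unset Strict Implicit.
Unset Printing Implicit Defensive.
Import Order.TTheory GRing.Theory Num.Theory.
Import numFieldNormedType.Exports.
Local Open Scope classical_set_scope.
Local Open Scope ring_scope.

(* The space R^d, d >= 1, is 'rV[R]_n.+1 with d = n.+1.  It is given the
   sigma-algebra of Lebesgue measurable sets, i.e. the Caratheodory
   sigma-algebra of the d-dimensional Lebesgue outer measure. *)

Section lebesgue_outer.
Context {R : realType} {n : nat}.
Local Notation E := 'rV[R]_n.+1.
Implicit Types (a b : E) (A B : set E).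

Definition box a b : set E :=
  [set x | forall i, a ord0 i < x ord0 i <= b ord0 i].

Definition box_volume a b : R :=
  \prod_(i < n.+1) Num.max (b ord0 i - a ord0 i) 0.

Local Open Scope ereal_scope.

Definition lebesgue_outer A : \bar R :=
  ereal_inf [set \sum_(k <oo) (box_volume (ab k).1 (ab k).2)%:E |
    ab in [set ab : nat -> E * E | A `<=` \bigcup_k box (ab k).1 (ab k).2]].

Lemma box_volume_ge0 a b : (0 <= box_volume a b)%R.
Proof. by apply: prodr_ge0 => i _; rewrite le_max lexx orbT. Qed.

Lemma lebesgue_outer_ge0 A : 0 <= lebesgue_outer A.
Proof.
apply: le_ereal_inf_tmp => _ [ab _ <-]; apply: nneseries_ge0 => k _ _.
by rewrite lee_fin box_volume_ge0.
Qed.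

Lemma lebesgue_outer0 : lebesgue_outer set0 = 0.
Proof.
apply/eqP; rewrite eq_le lebesgue_outer_ge0 andbT.
apply: ereal_inf_lbound; exists (fun=> (0%R, 0%R)) => //=.
rewrite eseries0// => k _ _.
by rewrite /box_volume big_ord_recl !mxE subrr maxxx mul0r.
Qed.

Lemma le_lebesgue_outer :
  {homo lebesgue_outer : A B / A `<=` B >-> A <= B}.
Proof.
move=> A B AB; apply: ereal_inf_le_tmp => _ [ab Bab <-].
by exists ab => //; exact: subset_trans Bab.
Qed.

Lemma lebesgue_outer_sigma_subadditive : sigma_subadditive lebesgue_outer.
Proof.
move=> A; have [[i ioo]|] := pselect (exists i, lebesgue_outer (A i) = +oo).
  rewrite (eseries_pinfty _ _ ioo) ?leey// => k _.
  by rewrite -ltNye (lt_le_trans _ (lebesgue_outer_ge0 _)).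
rewrite -forallNE => Afin.
have fine_A k : lebesgue_outer (A k) \is a fin_num.
  rewrite ge0_fin_numE ?lebesgue_outer_ge0//.
  by rewrite ltey; apply/eqP; exact: Afin.
apply/lee_addgt0Pr => e e0.
rewrite (le_trans _ (epsilon_trick _ _ (ltW e0)))//; last first.
  by move=> k; exact: lebesgue_outer_ge0.
have /choice[G PG] k : exists ab : nat -> E * E,
    A k `<=` \bigcup_j box (ab j).1 (ab j).2 /\
    \sum_(j <oo) (box_volume (ab j).1 (ab j).2)%:E <=
      lebesgue_outer (A k) + (e / (2 ^ k.+1)%:R)%:E.
  have ek : (0 < e / (2 ^ k.+1)%:R)%R by rewrite divr_gt0// ltr0n expn_gt0.
  have [_ [ab Aab <-] /ltW abe] := lb_ereal_inf_adherent ek (fine_A k).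
  by exists ab.
pose v (p : nat * nat) := (box_volume (G p.1 p.2).1 (G p.1 p.2).2)%:E.
have v0 p : 0 <= v p by rewrite lee_fin box_volume_ge0.
apply: (@le_trans _ _ (\esum_(i in setT) v i)).
  apply: ereal_inf_lbound => /=.
  have /card_esym/ppcard_eqP[f] := card_nat2.
  exists (fun k => uncurry G (f k)).
    move=> t [i _ /(PG i).1[j _ Gij]]; exists (f^-1%FUN (i, j)) => //=.
    by rewrite invK ?inE.
  transitivity (\sum_(k <oo) (v \o f) k).
    by apply: eq_eseriesr => k _; rewrite /v /=; case: (f k).
  rewrite -(esum_pred_image v f xpredT) ?[fun=> _]set_true//.
  by rewrite image_eq.
have -> : \esum_(i in setT) v i = \sum_(i <oo) \sum_(j <oo) v (i, j).
  pose J : nat -> set (nat * nat) := fun i => [set (i, j) | j in setT].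
  rewrite (_ : setT = \bigcup_k J k); last first.
    by rewrite predeqE => -[a b]; split => // _; exists a => //; exists b.
  rewrite esum_bigcupT //=; last first.
    apply/trivIsetP => i j _ _ ij.
    rewrite predeqE => -[k m] /=; split => //= -[] [_] _ [<-{k} _].
    by move=> [m' _] [] /esym/eqP; rewrite (negbTE ij).
  rewrite -(image_id [set: nat]) -fun_true esum_pred_image//; last first.
    by move=> k _; exact: esum_ge0.
  apply: eq_eseriesr => /= j _.
  rewrite -(esum_pred_image v (pair j) predT)//=; last first.
    by move=> ? ? _ _; exact: (@can_inj _ _ _ snd).
  by congr esum; rewrite predeqE => -[a b]; split; move=> [i _ <-]; exists i.
apply: lee_nneseries => [k _ _|k _]; first exact: nneseries_ge0.
exact: (PG k).2.
Qed.

HB.instance Definition _ := isOuterMeasure.Build R E lebesgue_outer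
  lebesgue_outer0 lebesgue_outer_ge0 le_lebesgue_outer
  lebesgue_outer_sigma_subadditive.

End lebesgue_outer.

Definition lebesgue_display (R : realType) (n : nat) : measure_display :=
  caratheodory_display (@lebesgue_outer R n).

HB.instance Definition _ (R : realType) (n : nat) :=
  @isMeasurable.Build (lebesgue_display R n) 'rV[R]_n.+1
    (@lebesgue_outer R n).-caratheodory
    (caratheodory_measurable_set0 (@lebesgue_outer R n))
    (@caratheodory_measurable_setC _ _ (@lebesgue_outer R n))
    (@caratheodory_measurable_bigcup _ _ (@lebesgue_outer R n)).

Definition lebesgue {R : realType} {n : nat} : set 'rV[R]_n.+1 -> \bar R :=
  lebesgue_outer.

Section lebesgue_measure.
Context {R : realType} {n : nat}.

Let lebesgue0 : @lebesgue R n set0 = 0%E.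
Proof. exact: lebesgue_outer0. Qed.

Let lebesgue_ge0 A : (0 <= @lebesgue R n A)%E.
Proof. exact: lebesgue_outer_ge0. Qed.

Let lebesgue_sigma_additive : semi_sigma_additive (@lebesgue R n).
Proof. exact: (@caratheodory_measure_sigma_additive R _ (@lebesgue_outer R n)). Qed.

HB.instance Definition _ := isMeasure.Build _ _ _ (@lebesgue R n)
  lebesgue0 lebesgue_ge0 lebesgue_sigma_additive.

End lebesgue_measure.

Section geometry.
Context {R : realType} {n : nat}.
Local Notation E := 'rV[R]_n.+1.
Implicit Types (x z c : E) (f : E -> R) (Q : set E).

(* The library's norm on 'rV[R]_n.+1 is the max norm. *)
Definition euclid x : R := Num.sqrt (\sum_(i < n.+1) x ord0 i ^+ 2).

Definition eball x (r : R) : set E := [set y | euclid (y - x) < r].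

(* Axis-parallel cube with lower corner c and edge length l > 0. *)
Definition cube c (l : R) : set E :=
  [set x | forall i, c ord0 i <= x ord0 i <= c ord0 i + l].

Definition translate Q z : set E := [set x + z | x in Q].

(* The filter of "z -> oo" on R^d. *)
Definition infty_nbhs : set_system E :=
  [set P | exists A : R, forall z, A < euclid z -> P z].

Definition vol Q : R := fine (lebesgue Q).

Definition L1loc : set (E -> R) :=
  [set f : E -> R | measurable_fun setT f /\
    forall K : set E, compact K -> (\int[lebesgue]_(x in K) `|f x|%:E < +oo)%E].

Definition monomial (g : multinom n.+1) x : R :=
  \prod_(i < n.+1) x ord0 i ^+ g i.

Definition peval (p : mpoly.mpoly n.+1 R) x : R :=
  meval (fun i => x ord0 i) p.

(* mpoly.msize p <= s.+1 means that p has degree at most s. *)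
Definition poly_proj (s : nat) Q f : mpoly.mpoly n.+1 R :=
  xget 0 [set p | (mpoly.msize p <= s.+1)%N /\
    forall g : multinom n.+1, (mdeg g <= s)%N ->
      \int[lebesgue]_(x in Q) ((f x - peval p x) * monomial g x) = 0].

End geometry.

(* The spaces attached to an arbitrary mean oscillation O. *)
Section oscillation_spaces.
Context {R : realType} {n : nat}.
Local Notation E := 'rV[R]_n.+1.
Variable O : (E -> R) -> set E -> \bar R.
Local Open Scope ereal_scope.

(* Supremum of O f over the cubes whose edge length satisfies P. *)
Definition cube_sup (P : set R) (f : E -> R) : \bar R :=
  ereal_sup [set O f (cube p.1 p.2) | p in [set p : E * R |
    (0 < p.2)%R /\ P p.2]].

Definition Lspace : set (E -> R) :=
  [set f | L1loc f /\ cube_sup setT f < +oo].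

Definition VLspace : set (E -> R) :=
  [set f | Lspace f /\
    cube_sup [set l | (l <= a)%R] f @[a --> 0%R^'+] --> 0].

Definition XLspace : set (E -> R) :=
  [set f | VLspace f /\ forall (c : E) (l : R), (0 < l)%R ->
    O f (translate (cube c l) z) @[z --> infty_nbhs] --> 0].

Definition CLspace : set (E -> R) :=
  [set f | XLspace f /\
    cube_sup [set l | (a <= l)%R] f @[a --> +oo%R] --> 0].

End oscillation_spaces.

(* A normed function space X is given by its norm N, which is meaningful on
   all measurable functions: X is the set of those with N f < +oo. *)
Section function_spaces.
Context {R : realType} {n : nat}.
Local Notation E := 'rV[R]_n.+1.
Variable N : (E -> R) -> \bar R.
Local Open Scope ereal_scope.

Definition fspace : set (E -> R) :=
  [set f : E -> R | measurable_fun setT f /\ N f < +oo].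

(* Linearity of X is part of the homogeneity and quasi-triangle axioms, and
   definiteness of the quasi-norm is bqb_definite. *)
Record ball_quasi_banach_function_space : Prop := {
  bqb_ge0 : forall f : E -> R, measurable_fun setT f -> 0 <= N f;
  bqb_homogeneous : forall (c : R) f, fspace f ->
    N (fun x => c * f x)%R = `|c|%:E * N f;
  bqb_quasi_triangle : exists K : R, (1 <= K)%R /\
    forall f g, fspace f -> fspace g ->
      N (fun x => f x + g x)%R <= K%:E * (N f + N g);
  bqb_complete : forall u : nat -> E -> R, (forall k, fspace (u k)) ->
    (forall e : R, (0 < e)%R -> exists K : nat, forall p q,
      (K <= p)%N -> (K <= q)%N -> N (fun x => u p x - u q x)%R < e%:E) ->
    exists2 f, fspace f & N (fun x => u k x - f x)%R @[k --> \oo] --> 0;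
  bqb_definite : forall f : E -> R, measurable_fun setT f ->
    N f = 0 -> {ae lebesgue, forall x, f x = 0%R};
  bqb_monotone : forall f g : E -> R,
    measurable_fun setT f -> measurable_fun setT g ->
    {ae lebesgue, forall x, (`|g x| <= `|f x|)%R} -> N g <= N f;
  bqb_fatou : forall (u : nat -> E -> R) (f : E -> R),
    (forall k, measurable_fun setT (u k)) -> measurable_fun setT f ->
    {ae lebesgue, forall x, [/\ forall k, (0 <= u k x)%R,
      nondecreasing_seq (u ^~ x) & u k x @[k --> \oo] --> f x]} ->
    nondecreasing_seq (N \o u) /\ N (u k) @[k --> \oo] --> N f;
  bqb_ball : forall x (r : R), (0 < r)%R -> fspace \1_(eball x r) }.

Record ball_banach_function_space : Prop := {
  bb_quasi : ball_quasi_banach_function_space;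
  bb_triangle : forall f g, fspace f -> fspace g ->
    N (fun x => f x + g x)%R <= N f + N g;
  bb_ball_integral : forall x (r : R), (0 < r)%R -> exists C : R, (0 < C)%R /\
    forall f, fspace f ->
      \int[lebesgue]_(y in eball x r) `|f y|%:E <= C%:E * N f }.

(* The norm of X' takes extended-real-valued functions because the maximal
   function of an element of X' may a priori be infinite at some points. *)
Definition assoc_norm (h : E -> \bar R) : \bar R :=
  ereal_sup [set \int[lebesgue]_x `|h x * (g x)%:E| |
    g in [set g | fspace g /\ N g = 1]].

Definition assoc_space : set (E -> R) :=
  [set f : E -> R | measurable_fun setT f /\ assoc_norm (EFin \o f) < +oo].

Definition maximal (f : E -> R) (x : E) : \bar R :=
  ereal_sup [set (vol (eball x r))^-1%:E *
    \int[lebesgue]_(y in eball x r) `|f y|%:E | r in [set r : R | (0 < r)%R]].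

Definition maximal_bounded_on_assoc : Prop :=
  exists C : R, forall f, assoc_space f ->
    assoc_norm (maximal f) <= C%:E * assoc_norm (EFin \o f).

End function_spaces.

Section campanato.
Context {R : realType} {n : nat}.
Local Notation E := 'rV[R]_n.+1.
(* For alpha >= 0, Num.truncn alpha is the integer part of alpha. *)
Variable alpha : R.
Local Open Scope ereal_scope.

Definition osc (f : E -> R) (Q : set E) : \bar R :=
  (vol Q `^ (- 1 - alpha / n.+1%:R))%:E *
  \int[lebesgue]_(x in Q)
    `|f x - peval (poly_proj (Num.truncn alpha) Q f) x|%:E.

Definition oscX (N : (E -> R) -> \bar R) (f : E -> R) (Q : set E) : \bar R :=
  (vol Q `^ (- (alpha / n.+1%:R)) / fine (N \1_Q))%:E *
  N (fun x => (f x - peval (poly_proj (Num.truncn alpha) Q f) x) * \1_Q x)%R.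

End campanato.

(* Main.v *)
(* One inclusion follows from osc <= C oscX: by Hoelder's inequality it reduces
   to |1_Q|_X |1_Q|_X' <= C |Q|, which is the boundedness of the maximal operator
   on X' together with the Lorentz-Luxemburg theorem X'' = X.

   For the other one, let omega(Q) be the mean of |f - P_Q f| over Q.  A stopping
   time on the dyadic subcubes of Q (stop where the mean of |f - P_Q f| exceeds
   2 omega(Q)) gives, for h >= 0,
     int_Q |f - P_Q f| h <= C int_Q w G,
   where w dominates omega(Q') on every subcube Q' and G is a dyadic maximal
   function of h; the error left at depth k tends to 0 because f has vanishing
   oscillation at small scales.  By duality the X-norm of (f - P_Q f) 1_Q is at
   most C times that of w 1_Q, and w can be taken constant for the V and X
   spaces.  For the C spaces w also has a part supported in a fixed cube, which
   is negligible since the norm of 1_Q tends to infinity as a cube Q meeting a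
   fixed cube grows. *)
Require Import Defs.
From mathcomp Require Import all_boot all_order all_algebra.
From mathcomp Require Import -(notations) mpoly.
From mathcomp Require Import all_classical all_reals all_analysis.
From mathcomp Require Import measurable_realfun zify ring lra.

Set Implicit Arguments.
Unset Strict Implicit.
Unset Printing Implicit Defensive.
Import Order.TTheory GRing.Theory Num.Theory.
Import numFieldNormedType.Exports.
Local Open Scope classical_set_scope.
Local Open Scope ring_scope.

(** * Lebesgue measure of boxes and cubes *)

(** The stopping time is run to a finite depth k, and what is left at depth k is kept as an explicit
    error in place of an almost everywhere limit. The depth may depend on the test function h, since
    no constant depends on k. The finite depth also makes G a maximum of finitely many means, hence
    measurable and bounded. Rather than summing over generations of stopping cubes, a single
    induction on k carries a quantity, additive over subcubes, that records how much of the integral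
    of w G is still available to pay for later stopping cubes.

    In the duality theorem, a separating functional given abstractly would still have to be
    represented by a function. The L2 projection p of f produces it directly as f - p, which is
    bounded and supported in the given set of finite measure. Hence duality only has to be tested on
    bounded functions supported in one cube and of finite associate norm, and these are functions to
    which the hypothesis on the maximal operator applies. *)

Section box_volumes.
Context {R : realType}.
Implicit Types (a b : nat -> R) (u v : nat -> nat -> R).

(* Slicing along the last coordinate and integrating over it; P records which
   boxes meet the slice. *)
Lemma box_cover_volume (d : nat) a b u v (P : pred nat) :
  (forall x : nat -> R, (forall i, (i < d)%N -> a i < x i <= b i) ->
    exists2 k, P k & forall i, (i < d)%N -> u k i < x i <= v k i) ->
  ((\prod_(i < d) Num.max (b i - a i) 0)%:E <=
   \sum_(k <oo | P k) (\prod_(i < d) Num.max (v k i - u k i) 0)%:E)%E.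
Proof.
have pr0 (m : nat) (e f : nat -> R) : 0 <= \prod_(i < m) Num.max (e i - f i) 0.
  by apply: prodr_ge0 => i _; rewrite le_max lexx orbT.
elim: d P => [|d IH] P cov.
  (* In dimension 0 all products are 1, so one index satisfying [P] is enough. *)
  have [k Pk _] := cov (fun=> 0) (fun i => ltac:(by [])).
  rewrite (nneseriesD1 (n := k))//; last by move=> *; rewrite lee_fin.
  rewrite !big_ord0 leeDl// nneseries_ge0// => *.
  by rewrite lee_fin pr0.
rewrite big_ord_recr/=.
pose w k := if P k then \prod_(i < d) Num.max (v k i - u k i) 0 else 0.
have w0 k : 0 <= w k by rewrite /w; case: ifP.
pose I k := [set` `]u k d, v k d]] : set R.
pose J := [set` `]a d, b d]] : set R.
have lenI (s t : R) : lebesgue_measure ([set` `]s, t]] : set R) = (Num.max (t - s) 0)%:E.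
  rewrite lebesgue_measure_itv /= lte_fin; case: ltP => [st|ts].
    by rewrite -EFinB max_l// subr_ge0 ltW.
  by rewrite max_r// subr_le0.
have slice t : J t -> ((\prod_(i < d) Num.max (b i - a i) 0)%:E <=
    \sum_(k <oo) (w k * \1_(I k) t)%:E)%E.
  move=> Jt.
  have H := IH (fun k => P k && (t \in I k)).
  apply: (le_trans (H _)).
    move=> x xab.
    have [i id|k Pk kx] := cov (fun i => if i == d then t else x i).
      case: eqVneq => [->|ne]; first by move: Jt; rewrite /J /= in_itv.
      by apply: xab; rewrite ltn_neqAle ne -ltnS.
    exists k; first last.
      move=> i id; have := kx i (ltnW id).
      by rewrite ltn_eqF.
    rewrite Pk /= inE /I /= in_itv /=.
    by have := kx d (ltnSn d); rewrite eqxx.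
  rewrite eseries_mkcond.
  apply: lee_nneseries => k; first by case: ifP; rewrite // lee_fin pr0.
  move=> _; rewrite /w indicE; case: (P k) => /=; last by rewrite ?mul0r.
  by case: (t \in I k) => /=; rewrite ?mulr1 ?mulr0.
have mI k : measurable (I k) by exact: measurable_itv.
have /(@le_trans _ _ _) : ((\prod_(i < d) Num.max (b i - a i) 0 *
    Num.max (b d - a d) 0)%:E <=
    \int[lebesgue_measure]_(t in J) \sum_(k <oo) (w k * \1_(I k) t)%:E)%E.
  rewrite EFinM -lenI -(integral_cst lebesgue_measure (measurable_itv _)).
  apply: ge0_le_integral => //.
  - by move=> x _; rewrite lee_fin pr0.
  - apply: ge0_emeasurable_sum => [k t Jt _|k _].
      by rewrite lee_fin mulr_ge0.
    apply/measurable_EFinP; apply: measurable_funM => //.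
    by apply: measurable_indic; exact: measurable_itv.
apply.
rewrite integral_nneseries//; first last.
- by move=> k t _; rewrite lee_fin mulr_ge0.
- move=> k; apply/measurable_EFinP; apply: measurable_funM => //.
  by apply: measurable_indic; exact: measurable_itv.
- exact: measurable_itv.
rewrite [leRHS]eseries_mkcond; apply: lee_nneseries => k.
  by move=> _ _; apply: integral_ge0 => t _; rewrite lee_fin mulr_ge0.
move=> _; under eq_integral do rewrite EFinM.
rewrite ge0_integralZl//; first last.
- by rewrite lee_fin.
- by apply/measurable_EFinP; apply: measurable_indic; exact: measurable_itv.
- exact: measurable_itv.
rewrite integral_indic//; [|exact: measurable_itv..].
rewrite /w; case: ifP => Pk; last by rewrite mul0e.
rewrite big_ord_recr/= EFinM -lenI.
rewrite lee_wpmul2l ?lee_fin ?pr0//.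
apply: le_measure; rewrite ?inE//; first apply: measurableI;
  exact: measurable_itv.
Qed.

End box_volumes.
Lemma split_length (R : realType) (e c t : R) :
  Num.max (e - c) 0 = Num.max (Num.min e t - c) 0 + Num.max (e - Num.max c t) 0.
Proof.
by case: (leP e t) => ?; case: (leP c t) => ?; do 3? (case: leP => ?); lra.
Qed.

Section lebesgue_boxes.
Context {R : realType} {n : nat}.
Local Notation E := 'rV[R]_n.+1.
Implicit Types (a b x : E).

Lemma lebesgue_box a b : lebesgue (box a b) = (box_volume a b)%:E.
Proof.
apply/eqP; rewrite eq_le; apply/andP; split.
  (* The box is covered by itself, followed by degenerate boxes of volume 0. *)
  apply: (@le_trans _ _ (\sum_(k <oo) (box_volume
      (if k == 0%N then (a, b) else (0, 0)).1
      (if k == 0%N then (a, b) else (0, 0)).2)%:E)%E).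
    apply: ereal_inf_lbound => /=.
    exists (fun k => if k == 0%N then (a, b) else (0, 0)) => //.
    by move=> x abx; exists 0%N.
  rewrite (nneseriesD1 (n := 0%N))//=; last first.
    by move=> k _; rewrite lee_fin box_volume_ge0.
  rewrite eseries0 ?adde0// => k _ /negbTE -> /=.
  by rewrite /box_volume big_ord_recl !mxE subrr maxxx mul0r.
apply: le_ereal_inf_tmp => _ [ab abE <-].
pose nth x i := x ord0 (inord i : 'I_n.+1).
have pr c e : box_volume c e = \prod_(i < n.+1) Num.max (nth e i - nth c i) 0.
  by apply: eq_bigr => i _; rewrite /nth inord_val.
rewrite pr; under eq_eseriesr do rewrite pr.
apply: (box_cover_volume (u := fun k => nth (ab k).1) (v := fun k => nth (ab k).2)).
move=> x xab.
have [|k _ kx] := abE (\row_i x i).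
  move=> i; rewrite mxE; have := xab i (ltn_ord i).
  by rewrite /nth inord_val.
exists k => // i ni; have := kx (inord i).
by rewrite mxE /nth inordK.
Qed.

(** The reverse inequality is the subadditivity of the outer measure. *)
Lemma measurable_le_outer (A : set E) :
  (forall X, lebesgue_outer (X `&` A) + lebesgue_outer (X `&` ~` A) <=
    lebesgue_outer X)%E -> measurable A.
Proof.
move=> AX; have H : (@lebesgue_outer R n).-caratheodory A.
  exact: (@le_caratheodory_measurable R _ (@lebesgue_outer R n)).
exact: H.
Qed.

(** Cutting every box of a cover of X along the hyperplane x_i = t yields covers of the two pieces
    of X with the same total volume. *)
Lemma measurable_halfspace (i : 'I_n.+1) (t : R) :
  measurable [set x : E | x ord0 i <= t].
Proof.
apply: measurable_le_outer => X.
apply: le_ereal_inf_tmp => _ [ab abX <-].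
pose lo (c : E) := \row_j (if j == i then Num.min (c ord0 i) t else c ord0 j).
pose hi (c : E) := \row_j (if j == i then Num.max (c ord0 i) t else c ord0 j).
have split_volume c e : box_volume c e = box_volume c (lo e) + box_volume (hi c) e.
  rewrite /box_volume (bigD1 i)//= [X in _ = X + _](bigD1 i)//=.
  rewrite [X in _ = _ + X](bigD1 i)//= !mxE eqxx.
  rewrite [X in _ = _ * X + _](eq_bigr (fun j => Num.max (e ord0 j - c ord0 j) 0)); last first.
    by move=> j /negbTE ji; rewrite !mxE ji.
  rewrite [X in _ = _ + _ * X](eq_bigr (fun j => Num.max (e ord0 j - c ord0 j) 0)); last first.
    by move=> j /negbTE ji; rewrite !mxE ji.
  rewrite -mulrDl; congr (_ * _).
  exact: split_length.
under eq_eseriesr do rewrite split_volume EFinD.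
rewrite nneseriesD => [|k _ _|k _ _]; rewrite ?lee_fin ?box_volume_ge0//.
apply: leeD; apply: ereal_inf_lbound => /=.
- exists (fun k => ((ab k).1, lo (ab k).2)) => // x [/abX[k _ kx] xt].
  exists k => // j; rewrite !mxE; have := kx j.
  by case: eqP => // ->; rewrite le_min xt => /andP[-> ->].
- exists (fun k => (hi (ab k).1, (ab k).2)) => // x [/abX[k _ kx] /negP].
  rewrite -ltNge => xt.
  exists k => // j; rewrite !mxE; have := kx j.
  by case: eqP => // ->; rewrite gt_max xt => /andP[-> ->].
Qed.

Lemma measurable_coord (i : 'I_n.+1) : measurable_fun setT (fun x : E => x ord0 i).
Proof.
apply: (measurability (RGenOInfty.G (R:=R))).
  exact: RGenOInfty.measurableE.
move=> _ [_ [t ->] <-]; rewrite setTI.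
rewrite (_ : _ @^-1` _ = ~` [set x : E | x ord0 i <= t]).
  by apply: measurableC; exact: measurable_halfspace.
by apply/seteqP; split => x /=; rewrite in_itv/= andbT ltNge => /negP.
Qed.

End lebesgue_boxes.
Section cubes.
Context {R : realType} {n : nat}.
Local Notation E := 'rV[R]_n.+1.
Implicit Types (c x y z : E) (l r : R).

Lemma le_lebesgue (A B : set E) : A `<=` B -> (lebesgue A <= lebesgue B)%E.
Proof. exact: le_lebesgue_outer. Qed.

Lemma measurable_cube c l : measurable (cube c l).
Proof.
rewrite (_ : cube c l = \bigcap_(i in [set: 'I_n.+1])
    (fun x : E => x ord0 i) @^-1` `[c ord0 i, c ord0 i + l]); last first.
  apply/seteqP; split => [x cx i _|x cx i] /=; first by rewrite in_itv/=; exact: cx.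
  by have := cx i I; rewrite /= in_itv.
apply: fin_bigcap_measurable => // i _.
by rewrite -[X in measurable X]setTI; apply: measurable_coord => //; exact: measurable_itv.
Qed.

Lemma measurable_box c x : measurable (box c x).
Proof.
rewrite (_ : box c x = \bigcap_(i in [set: 'I_n.+1])
    (fun y : E => y ord0 i) @^-1` `]c ord0 i, x ord0 i]); last first.
  apply/seteqP; split => [y cx i _|y cx i] /=; first by rewrite in_itv/=; exact: cx.
  by have := cx i I; rewrite /= in_itv.
apply: fin_bigcap_measurable => // i _.
by rewrite -[X in measurable X]setTI; apply: measurable_coord => //; exact: measurable_itv.
Qed.

Lemma measurable_euclid x : measurable_fun setT (fun y : E => euclid (y - x)).
Proof.
apply: (measurableT_comp (continuous_measurable_fun _)).
  exact: sqrt_continuous.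
apply: measurable_sum => i; apply: measurable_funX.
rewrite (_ : (fun y : E => _) = (fun y : E => y ord0 i - x ord0 i)).
  exact: (measurable_funB (measurable_coord i) (measurable_cst _)).
by apply/funext => y; rewrite !mxE.
Qed.

Lemma measurable_eball x r : measurable (eball x r).
Proof.
rewrite (_ : eball x r = (fun y => euclid (y - x)) @^-1` `]-oo, r[).
  by rewrite -[X in measurable X]setTI; apply: measurable_euclid => //; exact: measurable_itv.
by apply/seteqP; split => y /=; rewrite in_itv.
Qed.

Lemma coord_le_euclid x (i : 'I_n.+1) : `|x ord0 i| <= euclid x.
Proof.
rewrite /euclid -sqrtr_sqr; apply: ler_wsqrtr.
by rewrite (bigD1 i)//= lerDl sumr_ge0// => j _; rewrite sqr_ge0.
Qed.

(** The sharp constant is the square root of d = n + 1. The cruder d + 1 makes the inequality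
    strict, as the open balls require. *)
Lemma euclid_lt x l : 0 < l -> (forall i, `|x ord0 i| <= l) ->
  euclid x < n.+2%:R * l.
Proof.
move=> l0 xl.
have nl : 0 < n.+2%:R * l by rewrite mulr_gt0// ltr0n.
rewrite -[ltRHS]gtr0_norm// -sqrtr_sqr /euclid ltr_sqrt ?exprn_gt0//.
apply: (@le_lt_trans _ _ (n.+1%:R * l ^+ 2)).
  rewrite mulr_natl -[in leRHS](card_ord n.+1) -sumr_const; apply: ler_sum => i _.
  by rewrite -(real_normK (num_real _)) lerXn2r ?nnegrE ?normr_ge0// ltW.
rewrite exprMn ltr_pM2r ?exprn_gt0// expr2 -natrM ltr_nat.
by rewrite (@leq_trans n.+2)// leq_pmulr.
Qed.

Lemma cube_sub_eball c l x : 0 < l -> cube c l x ->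
  cube c l `<=` eball x (n.+2%:R * l).
Proof.
move=> l0 cx y cy; apply: euclid_lt => // i; rewrite !mxE.
by have := cx i; have := cy i; rewrite ler_norml; lra.
Qed.

Lemma eball_sub_cube x r : eball x r `<=` cube (x - const_mx r) (2 * r).
Proof.
move=> y xy i; have := le_lt_trans (coord_le_euclid (y - x) i) xy.
by rewrite !mxE ltr_norml; lra.
Qed.

Lemma compact_cube c l : compact (cube c l).
Proof.
rewrite (_ : cube c l = [set v : E | forall i, `[c ord0 i, c ord0 i + l]%classic (v ord0 i)]).
  apply: (@rV_compact R n.+1 (fun i => `[c ord0 i, c ord0 i + l]%classic)) => i.
  exact: segment_compact.
by apply/seteqP; split => x cx i; have := cx i; rewrite /= in_itv.
Qed.

Let box_volumeE c l : 0 <= l -> box_volume c (c + const_mx l) = l ^+ n.+1.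
Proof.
move=> l0; rewrite /box_volume (eq_bigr (fun=> l)) ?prodr_const ?card_ord//.
by move=> i _; rewrite !mxE addrAC subrr add0r max_l.
Qed.

Lemma box_sub_cube c l : box c (c + const_mx l) `<=` cube c l.
Proof. by move=> x cx i; have /andP[/ltW -> /=] := cx i; rewrite !mxE. Qed.

Lemma lebesgue_cube c l : 0 <= l -> lebesgue (cube c l) = (l ^+ n.+1)%:E.
Proof.
move=> l0; apply/eqP; rewrite eq_le; apply/andP; split; last first.
  rewrite -(box_volumeE c)// -lebesgue_box.
  refine (le_lebesgue _).
  exact: box_sub_cube.
(* The closed cube lies in a half-open box of side l + e, whose lower corner is shifted by e; then e
   tends to 0. *)
have up e : 0 < e -> (lebesgue (cube c l) <= ((l + e) ^+ n.+1)%:E)%E.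
  move=> e0; rewrite -(box_volumeE (c - const_mx e)); last by rewrite addr_ge0// ltW.
  rewrite -lebesgue_box.
  refine (le_lebesgue _).
  by move=> x cx i; have := cx i; rewrite !mxE; lra.
have /fineK <- : lebesgue (cube c l) \is a fin_num.
  by rewrite ge0_fin_numE// (le_lt_trans (up _ ltr01))// ltry.
rewrite lee_fin.
refine (cvgr_to_ge (F := (0 : R)^'+) (f := fun e => (l + e) ^+ n.+1) _ _).
  have -> : l ^+ n.+1 = (l + 0) ^+ n.+1 by rewrite addr0.
  apply: cvg_at_right_filter.
  apply: (cvg_comp (fun e => l + e) (fun e => e ^+ n.+1)); last exact: exprn_continuous.
  by apply: cvgD; [exact: cvg_cst|exact: cvg_id].
near=> e; rewrite -lee_fin fineK; first by apply: up.
by rewrite ge0_fin_numE// (le_lt_trans (up _ ltr01))// ltry.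
Unshelve. all: by end_near. Qed.

Lemma vol_cube c l : 0 <= l -> vol (cube c l) = l ^+ n.+1.
Proof. by move=> l0; rewrite /vol lebesgue_cube. Qed.

(** Half-open boxes tile exactly whereas closed cubes share faces. A cube and its box have the same
    volume, so they differ by a null set. *)
Lemma integral_cube_box c l (f : E -> R) : 0 <= l ->
  lebesgue.-integrable (cube c l) (EFin \o f) ->
  (\int[lebesgue]_(x in cube c l) (f x)%:E =
   \int[lebesgue]_(x in box c (c + const_mx l)) (f x)%:E)%E.
Proof.
move=> l0 fi; have mD := measurableD (measurable_cube c l) (measurable_box c (c + const_mx l)).
rewrite (negligible_integral mD)//.
- rewrite setDD; congr integral.
  by apply/setIidr; exact: box_sub_cube.
- exact: measurable_cube.
- rewrite measureD//; [|exact: measurable_cube|exact: measurable_box|].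
    rewrite (_ : _ `&` _ = box c (c + const_mx l)).
      rewrite [X in (X - _)%E]lebesgue_cube// [X in (_ - X)%E]lebesgue_box box_volumeE//.
      by rewrite -EFinB subrr.
    by apply/setIidr; exact: box_sub_cube.
  by rewrite [X in (X < _)%E]lebesgue_cube// ltry.
Qed.

(** The 2^d dyadic children are indexed by boolean functions: [e i] tells whether the upper half is
    taken in direction i. *)
Definition subcorner c l (e : {ffun 'I_n.+1 -> bool}) : E :=
  \row_i (c ord0 i + (e i)%:R * (l / 2)).

Lemma subcorner_sub c l e : 0 <= l -> cube (subcorner c l e) (l / 2) `<=` cube c l.
Proof.
by move=> l0 x cx i; have := cx i; rewrite mxE; case: (e i) => /=; lra.
Qed.

Lemma Rintegral_subcubes c l (f : E -> R) : 0 < l ->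
  lebesgue.-integrable (cube c l) (EFin \o f) ->
  \int[lebesgue]_(x in cube c l) f x =
  \sum_e \int[lebesgue]_(x in cube (subcorner c l e) (l / 2)) f x.
Proof.
move=> l0 fi; rewrite /Rintegral integral_cube_box//; last exact: ltW.
pose B e := box (subcorner c l e) (subcorner c l e + const_mx (l / 2)).
have l20 : 0 <= l / 2 by rewrite divr_ge0 ?ltW.
have fie e : lebesgue.-integrable (cube (subcorner c l e) (l / 2)) (EFin \o f).
  apply: integrableS fi; [exact: measurable_cube|exact: measurable_cube|].
  by apply: subcorner_sub; exact: ltW.
have boxE : box c (c + const_mx l) = \big[setU/set0]_(e <- index_enum {ffun 'I_n.+1 -> bool}) B e.
  rewrite -bigcup_seq; apply/seteqP; split => x.
    (* The comparison with the midpoint is strict because the boxes contain their upper faces and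
       not their lower ones. *)
    move=> cx; exists [ffun i => c ord0 i + l / 2 < x ord0 i] => //=.
      by rewrite mem_index_enum.
    move=> i; have := cx i; rewrite !mxE !ffunE.
    by case: (ltP (c ord0 i + l / 2)) => /=; lra.
  move=> [e _ cx] i; have := cx i; rewrite !mxE.
  by case: (e i) => /=; lra.
have trB : trivIset [set` index_enum {ffun 'I_n.+1 -> bool}] B.
  apply/trivIsetP => e1 e2 _ _ /eqP ne; apply/seteqP; split => // x [x1 x2].
  apply: ne; apply/ffunP => i; have := x1 i; have := x2 i; rewrite !mxE.
  by case: (e1 i); case: (e2 i) => //=; lra.
have fib : measurable_fun (box c (c + const_mx l)) (EFin \o f).
  apply: measurable_funS (measurable_int _ fi); first exact: measurable_cube.
  exact: box_sub_cube.
rewrite boxE in fib *.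
rewrite integral_bigsetU_EFin//.
- rewrite (eq_bigr (fun e => \int[lebesgue]_(x in cube (subcorner c l e) (l / 2)) (f x)%:E)%E).
    rewrite -sum_fine//= => e _.
    by apply: integral_fune_fin_num => //; exact: measurable_cube.
  by move=> e _; rewrite integral_cube_box.
- by move=> e; exact: measurable_box.
- exact: index_enum_uniq.
Qed.

End cubes.

(** * Lorentz-Luxemburg duality *)

Section integrability.
Context d (T : measurableType d) (R : realType) (mu : {measure set T -> \bar R}).

Lemma integrable_bounded (K : set T) (g : T -> R) (M : R) :
  measurable K -> (mu K < +oo)%E -> measurable_fun K g ->
  (forall x, K x -> `|g x| <= M) -> mu.-integrable K (EFin \o g).
Proof.
move=> mK Kfin mg gM; apply: measurable_bounded_integrable => //.
exists M; split; first exact: num_real.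
by move=> y My x Kx; apply: le_trans (gM _ Kx) (ltW My).
Qed.

Lemma integrable_sqr_bounded (K : set T) (g : T -> R) (M : R) :
  measurable K -> (mu K < +oo)%E -> measurable_fun setT g ->
  (forall x, `|g x| <= M) -> mu.-integrable K (EFin \o (fun x => g x ^+ 2)).
Proof.
move=> mK Kfin mg gM; apply: (@integrable_bounded _ _ (M ^+ 2)) => //.
  by apply: measurable_funTS; exact: measurable_funX.
move=> x _; rewrite normrX lerXn2r ?nnegrE//; exact: le_trans (normr_ge0 _) (gM x).
Qed.

Lemma integral_support (K : set T) (g : T -> \bar R) :
  (forall x, ~ K x -> g x = 0%E) -> (\int[mu]_x g x = \int[mu]_(x in K) g x)%E.
Proof.
move=> g0; rewrite [RHS]integral_mkcond; congr integral; apply/funext => x.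
by rewrite patchE; case: ifPn => // /negP; rewrite inE => /g0.
Qed.

Lemma le_Rintegral_subset (A B : set T) (g : T -> R) :
  measurable A -> measurable B -> A `<=` B -> (forall x, 0 <= g x) ->
  mu.-integrable B (EFin \o g) ->
  \int[mu]_(x in A) g x <= \int[mu]_(x in B) g x.
Proof.
move=> mA mB AB g0 ig; rewrite /Rintegral fine_le//.
- by apply: integrable_fin_num (integrableS mB mA AB ig).
- exact: integrable_fin_num ig.
- apply: ge0_subset_integral => //; first exact: measurable_int ig.
  by move=> x _; rewrite lee_fin.
Qed.

Lemma integrableD_real (K : set T) (g h : T -> R) : measurable K ->
  mu.-integrable K (EFin \o g) -> mu.-integrable K (EFin \o h) ->
  mu.-integrable K (EFin \o (fun x => g x + h x)).
Proof. by move=> mK ig ih; exact: (integrableD mK ig ih). Qed.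

Lemma integrableB_real (K : set T) (g h : T -> R) : measurable K ->
  mu.-integrable K (EFin \o g) -> mu.-integrable K (EFin \o h) ->
  mu.-integrable K (EFin \o (fun x => g x - h x)).
Proof. by move=> mK ig ih; exact: (integrableB mK ig ih). Qed.

Lemma integrableZ_real (K : set T) (k : R) (g : T -> R) : measurable K ->
  mu.-integrable K (EFin \o g) -> mu.-integrable K (EFin \o (fun x => k * g x)).
Proof. by move=> mK ig; exact: (integrableZl mK k ig). Qed.

Lemma integrable_norm_real (K : set T) (g : T -> R) :
  mu.-integrable K (EFin \o g) -> mu.-integrable K (EFin \o (fun x => `|g x|)).
Proof. by move=> ig; exact: (integrable_norm ig). Qed.

Lemma integrableM_bounded (K : set T) (g h : T -> R) (M : R) : measurable K ->
  mu.-integrable K (EFin \o g) -> measurable_fun K h ->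
  (forall x, K x -> `|h x| <= M) ->
  mu.-integrable K (EFin \o (fun x => g x * h x)).
Proof.
move=> mK ig mh hM; apply: (@le_integrable _ _ _ _ _ mK _ (EFin \o (fun x => M * g x))).
- apply/measurable_EFinP; apply: measurable_funM => //.
  by apply/measurable_EFinP; exact: measurable_int ig.
- move=> x Kx /=; rewrite lee_fin mulrC !normrM ler_wpM2r//.
  exact: le_trans (hM _ Kx) (ler_norm _).
- exact: integrableZ_real.
Qed.

End integrability.

(* The minimizer is the lower limit of a minimizing sequence u whose consecutive
   differences are summable in L1: the unit ball of a space with the Fatou
   property is closed under lower limits but not under arbitrary limits. *)
Section L2_projection.
Context d (T : measurableType d) (R : realType) (mu : {measure set T -> \bar R}).
Variables (K : set T) (f : T -> R) (F : R) (C : set (T -> R)).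
Hypotheses (mK : measurable K) (Kfin : (mu K < +oo)%E).
Hypotheses (mf : measurable_fun setT f) (f_le : forall x, f x <= F) (F_ge0 : 0 <= F).
Hypotheses (Cm : forall g, C g -> measurable_fun setT g).
Hypotheses (C_bounds : forall g x, C g -> 0 <= g x <= f x).
Hypotheses (C_mid : forall g h, C g -> C h -> C (fun x => (g x + h x) / 2)).
Hypotheses (C_liminf : forall u : nat -> T -> R, (forall k, C (u k)) ->
  C (fun x => sup (range (infs (u ^~ x))))).
Hypothesis C_neq0 : C !=set0.

Let J g := \int[mu]_(x in K) ((f x - g x) ^+ 2).

Let C_int (g h : T -> R) : C g -> C h ->
  mu.-integrable K (EFin \o (fun x => (g x - h x) ^+ 2)).
Proof.
move=> Cg Ch; apply: (@integrable_bounded _ _ _ _ _ _ (F ^+ 2)) => //.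
  apply: measurable_funTS; apply: measurable_funX; apply: measurable_funB; exact: Cm.
move=> x _; have := C_bounds x Cg; have := C_bounds x Ch; have := f_le x => ? ? ?.
by rewrite ger0_norm ?sqr_ge0//; nra.
Qed.

Let J_int (g : T -> R) : C g ->
  mu.-integrable K (EFin \o (fun x => (f x - g x) ^+ 2)).
Proof.
move=> Cg; apply: (@integrable_bounded _ _ _ _ _ _ (F ^+ 2)) => //.
  by apply: measurable_funTS; apply: measurable_funX; apply: measurable_funB => //; exact: Cm.
move=> x _; have := C_bounds x Cg; have := f_le x => ? ?.
by rewrite ger0_norm ?sqr_ge0//; nra.
Qed.

Let J_ge0 g : 0 <= J g.
Proof. by apply: Rintegral_ge0 => x _; rewrite sqr_ge0. Qed.

Let I := inf (J @` C).

Let I_le g : C g -> I <= J g.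
Proof.
by move=> Cg; apply: ge_inf; [exists 0 => _ [h _ <-]; exact: J_ge0|exists g].
Qed.

Let parallelogram g h : C g -> C h ->
  \int[mu]_(x in K) ((g x - h x) ^+ 2) <= 2 * J g + 2 * J h - 4 * I.
Proof.
move=> Cg Ch; have := I_le (C_mid Cg Ch); rewrite -(ler_pM2l (ltr0n R 4)) => mid.
apply: (@le_trans _ _ (2 * J g + 2 * J h - 4 * J (fun x => (g x + h x) / 2))); last by lra.
rewrite /J -!RintegralZl//; [|exact/J_int/C_mid|exact: J_int|exact: J_int].
have iZ k (w : T -> R) : C w -> mu.-integrable K (EFin \o (fun x => k * (f x - w x) ^+ 2)).
  by move=> Cw; apply: integrableZ_real => //; exact: J_int.
rewrite -RintegralD//; [|exact: iZ|exact: iZ].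
rewrite -RintegralB//; [|apply: integrableD_real => //; exact: iZ|exact/iZ/C_mid].
rewrite le_eqVlt; apply/orP; left; apply/eqP; apply: eq_Rintegral => x _.
by field.
Qed.

Lemma L2_projection : exists2 p, C p & forall g, C g ->
  \int[mu]_(x in K) ((f x - p x) ^+ 2) <= \int[mu]_(x in K) ((f x - g x) ^+ 2).
Proof.
(* The excess 4^-k is the square of the rate 2^-k wanted for the L1 distance of consecutive
   terms. *)
have /choice[u uP] k : exists g, C g /\ J g < I + 4^-1 ^+ k.
  have hI : has_inf (J @` C).
    split; last by exists 0 => _ [h _ <-]; exact: J_ge0.
    by have [g Cg] := C_neq0; exists (J g); exists g.
  have e0 : 0 < (4^-1 : R) ^+ k by rewrite exprn_gt0// invr_gt0.
  have [_ [g Cg <-] lt] := inf_adherent e0 hI.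
  by exists g.
have Cu k : C (u k) by case: (uP k).
pose p x := sup (range (infs (u ^~ x))).
have Cp : C p by exact: C_liminf.
exists p => // g Cg; rewrite -/(J _) -/(J _); apply: le_trans (I_le Cg).
pose D (l : nat) (x : T) : R := `|u l.+1 x - u l x|.
have ub x k : infs (u ^~ x) k <= f x.
  apply: (@le_trans _ _ (u k x)); last by have /andP[] := C_bounds x (Cu k).
  apply: ge_inf; last by exists k => //=.
  by exists 0 => _ [l _ <-]; have /andP[] := C_bounds x (Cu l).
have pge k x s : (forall m, u k x - s <= u (k + m)%N x) -> u k x - s <= p x.
  move=> h; apply: (@le_trans _ _ (infs (u ^~ x) k)); last first.
    by apply: ub_le_sup; [exists (f x) => _ [l _ <-]|exists k].
  apply: lb_le_inf; first by exists (u k x), k => /=.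
  by move=> _ [l /= kl <-]; rewrite -(subnKC kl).
(* From the index k on, the sequence stays above u_k minus the sum of the later increments, hence so
   does its lower limit p. The difference of the two squares is at most that sum times 2 F. Using F
   + 1 keeps the coefficient positive, so that the bound is infinite when the sum is. *)
have key k x : (((f x - p x) ^+ 2)%:E <= ((f x - u k x) ^+ 2)%:E +
    (2 * (F + 1))%:E * \sum_(l <oo) (D (k + l)%N x)%:E)%E.
  have S0 : (0 <= \sum_(l <oo) (D (k + l)%N x)%:E)%E.
    by apply: nneseries_ge0 => l _ _; rewrite lee_fin normr_ge0.
  have [Soo|Sfin] := eqVneq (\sum_(l <oo) (D (k + l)%N x)%:E)%E +oo%E.
    by rewrite Soo gt0_muley ?addey ?leey// lte_fin mulr_gt0// ltr_wpDl.
  have Sfn : (\sum_(l <oo) (D (k + l)%N x)%:E)%E \is a fin_num.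
    by rewrite ge0_fin_numE// ltey.
  rewrite -(fineK Sfn) -EFinM -EFinD lee_fin.
  set s := fine _.
  have s0 : 0 <= s by exact: fine_ge0.
  have := pge k x s.
  have tele m : u k x - s <= u (k + m)%N x.
    have : \sum_(0 <= l < m) D (k + l)%N x <= s.
      rewrite -lee_fin fineK// -sumEFin.
      by apply: nneseries_lim_ge => l _ _; rewrite lee_fin normr_ge0.
    have : u k x - \sum_(0 <= l < m) D (k + l)%N x <= u (k + m)%N x.
      elim: m => [|m IH]; first by rewrite big_nil addn0 subr0.
      rewrite big_nat_recr//= addnS.
      have := ler_norm (u (k + m)%N x - u (k + m).+1 x).
      by rewrite distrC -/(D _ _); lra.
    lra.
  move=> /(_ tele) ps.
  have /andP[_ pf] := C_bounds x Cp; have /andP[_ uf] := C_bounds x (Cu k).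
  have /andP[p0 _] := C_bounds x Cp; have /andP[u0 _] := C_bounds x (Cu k).
  have fF := f_le x.
  have [le|lt] := leP (f x - p x) (f x - u k x).
    have : 0 <= 2 * (F + 1) * s by rewrite !mulr_ge0// addr_ge0.
    have : (f x - p x) ^+ 2 <= (f x - u k x) ^+ 2 by rewrite lerXn2r// nnegrE; lra.
    by lra.
  have : (u k x - p x) * ((f x - p x) + (f x - u k x)) <= s * (2 * (F + 1)).
    by apply: ler_pM; lra.
  by lra.
have Dint l : mu.-integrable K (EFin \o D l).
  apply: (@integrable_bounded _ _ _ _ _ _ F) => //.
    apply: measurable_funTS; apply: measurableT_comp => //.
    by apply: measurable_funB; exact: Cm.
  move=> x _; have := C_bounds x (Cu l); have := C_bounds x (Cu l.+1); have := f_le x.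
  by rewrite /D normr_id ler_norml; lra.
(* From t <= delta + t^2 / delta with delta = 2^-l: the constant integrates to 2^-l mu(K), and the
   parallelogram inequality bounds the integral of t^2 by 2 (4^-l + 4^-(l+1)) <= 4 * 4^-l. *)
pose m := fine (mu K) + 4.
have m0 : 0 <= m by rewrite addr_ge0// fine_ge0.
have D_le l : \int[mu]_(x in K) D l x <= 2^-1 ^+ l * m.
  have d0 : 0 < (2^-1 : R) ^+ l by rewrite exprn_gt0// invr_gt0.
  have dK : (2^-1 : R) ^- l * 2^-1 ^+ l = 1 by rewrite mulVf// gt_eqF.
  apply: (@le_trans _ _ (\int[mu]_(x in K) (2^-1 ^+ l + 2^-1 ^- l * (u l.+1 x - u l x) ^+ 2))).
    apply: le_Rintegral => //.
      apply: integrableD_real => //; last by apply: integrableZ_real => //; exact: C_int.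
      by apply: (@integrable_bounded _ _ _ _ _ _ (2^-1 ^+ l)) => // x _; rewrite gtr0_norm.
    move=> x _; rewrite /D -(real_normK (num_real (u l.+1 x - u l x))).
    set t := `| _ |; have t0 : 0 <= t by exact: normr_ge0.
    rewrite -(ler_pM2r d0) mulrDl mulrAC dK mul1r.
    by nra.
  rewrite RintegralD//.
  - rewrite Rintegral_cst// RintegralZl//; last exact: C_int.
    rewrite /m mulrDr lerD2l.
    rewrite -(ler_pM2r d0) mulrAC dK mul1r.
    apply: le_trans (parallelogram (Cu _) (Cu _)) _.
    have [_ /ltW J1] := uP l; have [_ /ltW J2] := uP l.+1.
    rewrite mulrAC -exprMn; rewrite exprS in J2.
    have -> : 2^-1 * 2^-1 = 4^-1 :> R by field.
    have : 0 <= (4^-1 : R) ^+ l by rewrite exprn_ge0// invr_ge0.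
    by lra.
  - by apply: (@integrable_bounded _ _ _ _ _ _ (2^-1 ^+ l)) => // x _; rewrite gtr0_norm.
  - by apply: integrableZ_real => //; exact: C_int.
have mD l : measurable_fun K (fun x => (D l x)%:E) by exact: measurable_int (Dint l).
have S_le k : (\sum_(l <oo) \int[mu]_(x in K) (D (k + l)%N x)%:E <=
    (2^-1 ^+ k * m * 2)%:E)%E.
  apply: lime_le.
    by apply: is_cvg_nneseries => l _ _; apply: integral_ge0 => x _; rewrite lee_fin normr_ge0.
  apply: nearW => M.
  apply: (@le_trans _ _ (2^-1 ^+ k * m * (2 - 2 * 2^-1 ^+ M))%:E); last first.
    rewrite lee_fin ler_wpM2l ?mulr_ge0 ?exprn_ge0 ?invr_ge0//.
    by rewrite lerBlDr lerDl mulr_ge0// exprn_ge0// invr_ge0.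
  elim: M => [|M IH]; first by rewrite big_nil expr0 mulr1 subrr mulr0.
  rewrite big_nat_recr//=; apply: le_trans (leeD IH (lexx _)) _.
  rewrite -(fineK (integrable_fin_num _ (Dint _)))// -EFinD lee_fin.
  have := D_le (k + M)%N; rewrite /Rintegral exprD exprS.
  set a := fine _; set b := _ ^+ k; set c := _ ^+ M => ?.
  by lra.
have Jp k : J p <= I + 4^-1 ^+ k + 2 * (F + 1) * (2^-1 ^+ k * m * 2).
  have [_ /ltW Jk] := uP k.
  apply: le_trans (lerD Jk (lexx _)).
  rewrite -lee_fin {1}/J /Rintegral fineK; last exact: integrable_fin_num (J_int Cp).
  have S_ge0 x : (0 <= \sum_(l <oo) (D (k + l)%N x)%:E)%E.
    by apply: nneseries_ge0 => l _ _; rewrite lee_fin normr_ge0.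
  have c0 : 0 <= 2 * (F + 1) by rewrite mulr_ge0 ?addr_ge0.
  have mJu : measurable_fun K (fun x => ((f x - u k x) ^+ 2)%:E).
    exact: measurable_int (J_int (Cu k)).
  have mS : measurable_fun K (fun x => \sum_(l <oo) (D (k + l)%N x)%:E)%E.
    by apply: ge0_emeasurable_sum => [l x Kx _|l _]; rewrite ?lee_fin ?normr_ge0//; exact: mD.
  have mcS : measurable_fun K (fun x => (2 * (F + 1))%:E * \sum_(l <oo) (D (k + l)%N x)%:E)%E.
    exact: measurable_funeM.
  apply: (@le_trans _ _ (\int[mu]_(x in K) (((f x - u k x) ^+ 2)%:E +
    (2 * (F + 1))%:E * \sum_(l <oo) (D (k + l)%N x)%:E))%E).
    apply: ge0_le_integral => //.
    - by move=> x _; rewrite lee_fin sqr_ge0.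
    - exact: measurable_int (J_int Cp).
    - exact: emeasurable_funD.
  rewrite ge0_integralD//; last 2 first.
  - by move=> x _; rewrite lee_fin sqr_ge0.
  - by move=> x _; rewrite mule_ge0// lee_fin.
  rewrite EFinD; apply: leeD.
    by rewrite /J /Rintegral fineK//; exact: integrable_fin_num (J_int (Cu k)).
  rewrite ge0_integralZl//.
  rewrite [leRHS]EFinM lee_wpmul2l ?lee_fin// integral_nneseries//.
  by move=> l x _; rewrite lee_fin normr_ge0.
refine (cvgr_to_ge (F := \oo) (f := fun k : nat => I + (1 + 2 * (F + 1) * m * 2) * 2^-1 ^+ k) _ _).
  rewrite -[X in _ --> X]addr0; apply: cvgD; first exact: cvg_cst.
  rewrite -[X in _ --> X](mulr0 (1 + 2 * (F + 1) * m * 2)); apply: cvgMr.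
  by apply: cvg_expr; rewrite ger0_norm; lra.
apply: nearW => k; apply: le_trans (Jp k) _.
have : (4^-1 : R) ^+ k <= 2^-1 ^+ k by rewrite lerXn2r ?nnegrE; lra.
lra.
Qed.

End L2_projection.

(** * The norm of X, its associate norm and duality *)

Section function_space.
Context {R : realType} {n : nat}.
Local Notation E := 'rV[R]_n.+1.
Variable N : (E -> R) -> \bar R.
Hypothesis X_bbfs : ball_banach_function_space N.
Let Q := bb_quasi X_bbfs.

Lemma space_norm_ge0 (f : E -> R) : measurable_fun setT f -> (0 <= N f)%E.
Proof. exact: bqb_ge0 Q f. Qed.

Lemma space_norm_le (f g : E -> R) : measurable_fun setT f ->
  measurable_fun setT g -> (forall x, `|g x| <= `|f x|) -> (N g <= N f)%E.
Proof. by move=> mf mg gf; apply: (bqb_monotone Q) => //; exact: aeW. Qed.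

Lemma space_norm_fin (f : E -> R) : fspace N f -> N f \is a fin_num.
Proof. by move=> [mf fin]; rewrite ge0_fin_numE//; exact: space_norm_ge0. Qed.

Lemma fspaceZ (c : R) (f : E -> R) : fspace N f -> fspace N (fun x => c * f x).
Proof.
move=> Xf; split; first by apply: measurable_funM => //; exact: (proj1 Xf).
by rewrite (bqb_homogeneous Q)// -(fineK (space_norm_fin Xf)) -EFinM ltry.
Qed.

Lemma fspace_le (f g : E -> R) : fspace N f -> measurable_fun setT g ->
  (forall x, `|g x| <= `|f x|) -> fspace N g.
Proof.
by move=> [mf fin] mg gf; split=> //; apply: le_lt_trans fin; exact: space_norm_le.
Qed.

Lemma space_norm0 : N (fun=> 0) = 0%E.
Proof.
have X1 := bqb_ball Q 0 ltr01.
have := bqb_homogeneous Q 0 X1; rewrite normr0 mul0e => <-.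
by congr N; apply/funext => x; rewrite mul0r.
Qed.

Lemma indic_cube_in_space (c : E) (l : R) : 0 < l -> fspace N \1_(cube c l).
Proof.
move=> l0; have X1 := bqb_ball Q c (mulr_gt0 (ltr0n R n.+2) l0).
apply: (fspace_le X1); first by apply: measurable_indic; exact: measurable_cube.
move=> x; rewrite !indicE; case: (boolP (x \in cube c l)) => [|_].
  rewrite inE => cx; rewrite (_ : _ \in _ = true)//.
  apply/mem_set/(cube_sub_eball l0) => // i.
  by rewrite lexx lerDl ltW.
by rewrite normr0 normr_ge0.
Qed.

Lemma norm_cube_gt0 (c : E) (l : R) : 0 < l -> 0 < fine (N \1_(cube c l)).
Proof.
move=> l0; have X1 := indic_cube_in_space c l0.
rewrite fine_gt0// lt0e space_norm_ge0//; last exact: (proj1 X1).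
rewrite (proj2 X1) !andbT; apply/eqP => N0.
have := bqb_definite Q (proj1 X1) N0.
move=> [Z [mZ Z0 sub]].
have : (lebesgue (cube c l) <= lebesgue Z)%E.
  refine (le_lebesgue _) => x cx; apply: sub => /=.
  by rewrite indicE mem_set//; apply/eqP; rewrite oner_eq0.
rewrite [X in (_ <= X)%E]Z0 lebesgue_cube; last exact: ltW.
by rewrite lee_fin leNgt exprn_gt0.
Qed.

(** The truncations min(|f|, m) increase to |f|, so the Fatou property applies. This reduces duality
    to bounded functions, where L2 arguments are available. *)
Lemma space_norm_truncation (f : E -> R) (A : \bar R) : measurable_fun setT f ->
  (forall m : nat, N (fun x => Num.min `|f x| m%:R)%R <= A)%E -> (N f <= A)%E.
Proof.
move=> mf fA; have mn : measurable_fun setT (fun x => `|f x|) by exact: measurableT_comp.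
apply: (@le_trans _ _ (N (fun x => `|f x|))).
  by apply: space_norm_le => // x; rewrite normr_id.
have [|_ cv] := bqb_fatou Q (u := fun m x => Num.min `|f x| m%:R)
  (fun m => measurable_minr mn (measurable_cst _)) mn.
  apply: aeW => x; split.
  - by move=> k; rewrite le_min normr_ge0 ler0n.
  - by move=> k l kl; rewrite le_min ge_min lexx /= ge_min ler_nat kl orbT.
  - apply/cvgrPdist_le => e e0; near=> k.
    rewrite min_l ?subrr ?normr0; first exact: ltW; apply: ltW.
    near: k; exact: nbhs_infty_gtr.
by apply: cvge_to_le cv _; apply: nearW.
Unshelve. all: by end_near. Qed.

Lemma assoc_norm_ge (h : E -> \bar R) (g : E -> R) : fspace N g -> N g = 1%E ->
  (\int[lebesgue]_x `|h x * (g x)%:E| <= assoc_norm N h)%E.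
Proof. by move=> Xg g1; apply: ereal_sup_ubound; exists g. Qed.

Lemma integral_mul_le_norms (h g : E -> R) : measurable_fun setT h -> fspace N g ->
  (\int[lebesgue]_x `|h x * g x|%:E <= assoc_norm N (EFin \o h) * N g)%E.
Proof.
move=> mh Xg; have [mg _] := Xg.
have mhg : measurable_fun setT (fun x => `|h x * g x|).
  exact: (measurableT_comp (@normr_measurable R setT) (measurable_funM mh mg)).
(* A function of norm 0 cannot be normalized, but it vanishes a.e.; the right-hand side is then 0
   even if the associate norm of h is infinite. *)
have [N0|N0] := eqVneq (N g) 0%E.
  rewrite N0 mule0 (_ : (\int[lebesgue]_x _)%E = 0%E)//.
  have := bqb_definite Q mg N0 => g0.
  transitivity (\int[lebesgue]_(x in [set: E]) cst 0 x)%E; last exact: integral0.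
  apply: ae_eq_integral => //.
    exact/measurable_EFinP.
  by apply: filterS g0 => x /= -> _; rewrite mulr0 normr0.
have fin := space_norm_fin Xg.
pose r := fine (N g).
have r0 : 0 < r by rewrite fine_gt0// lt0e N0 space_norm_ge0//= (proj2 Xg).
have Xg' : fspace N (fun x => r^-1 * g x) by exact: fspaceZ.
have := @assoc_norm_ge (EFin \o h) _ Xg'.
rewrite (bqb_homogeneous Q)// gtr0_norm ?invr_gt0// -(fineK fin) -EFinM.
rewrite mulVf ?gt_eqF// => /(_ erefl) le1.
rewrite muleC -lee_pdivrMl//; apply: le_trans le1.
rewrite -ge0_integralZl//.
- rewrite le_eqVlt; apply/orP; left; apply/eqP; apply: eq_integral => x _ /=.
  rewrite -EFinM; congr EFin; rewrite !normrM [`|r^-1|]gtr0_norm ?invr_gt0//.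
  by rewrite mulrCA.
- exact/measurable_EFinP.
- by rewrite lee_fin invr_ge0 ltW.
Qed.

(* If N f > 1, let p be the L2 projection of f onto the functions between 0 and f
   of norm at most 1; then h = f - p separates f from the unit ball, as
   int h g <= int h p < int h f for every g of norm at most 1. *)
Section lorentz_luxemburg.
Variables (K : set E) (f : E -> R) (F : R).
Hypotheses (mK : measurable K) (Kfin : (lebesgue K < +oo)%E) (F_ge0 : 0 <= F).
Hypotheses (mf : measurable_fun setT f) (f_bounds : forall x, 0 <= f x <= F * \1_K x).

Let f_le x : f x <= F.
Proof.
have /andP[_ /le_trans] := f_bounds x; apply.
by rewrite indicE; case: (x \in K); rewrite ?mulr1 ?mulr0.
Qed.

Let f_ge0 x : 0 <= f x. Proof. by have /andP[] := f_bounds x. Qed.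

Let C : set (E -> R) := [set g : E -> R | [/\ measurable_fun setT g,
  (forall x, 0 <= g x <= f x) & (N g <= 1)%E]].

Let C_fspace g : C g -> fspace N g.
Proof. by move=> [mg _ g1]; split => //; apply: le_lt_trans g1 _; rewrite ltry. Qed.

Let convex_comb (t : R) g h : 0 <= t <= 1 -> fspace N g -> fspace N h ->
  (N g <= 1)%E -> (N h <= 1)%E -> (N (fun x => t * g x + (1 - t) * h x)%R <= 1)%E.
Proof.
move=> /andP[t0 t1] Xg Xh g1 h1.
apply: le_trans (bb_triangle X_bbfs (fspaceZ _ Xg) (fspaceZ _ Xh)) _.
rewrite !(bqb_homogeneous Q)// !ger0_norm ?subr_ge0//.
apply: (@le_trans _ _ (t%:E * 1 + (1 - t)%:E * 1)%E).
  by apply: leeD; rewrite lee_wpmul2l// lee_fin ?subr_ge0.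
by rewrite !mule1 -EFinD lee_fin subrKC.
Qed.

Let C_mid g h : C g -> C h -> C (fun x => (g x + h x) / 2).
Proof.
move=> Cg Ch; have [mg gf g1] := Cg; have [mh hf h1] := Ch.
have E2 : (fun x => (g x + h x) / 2) = (fun x => 2^-1 * g x + (1 - 2^-1) * h x).
  by apply/funext => x; field.
split.
- exact: (measurable_funM (measurable_funD mg mh) (measurable_cst _)).
- by move=> x; have := gf x; have := hf x; lra.
- by rewrite E2; apply: convex_comb => //; [lra|exact: C_fspace|exact: C_fspace].
Qed.

Let C_liminf (u : nat -> E -> R) : (forall k, C (u k)) ->
  C (fun x => sup (range (infs (u ^~ x)))).
Proof.
move=> Cu.
have mu k : measurable_fun setT (u k) by have [] := Cu k.
have uf k x : 0 <= u k x <= f x by have [_ ->] := Cu k.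
have lb x : has_lbound (range (u ^~ x)).
  by exists 0 => _ [k _ <-]; have /andP[] := uf k x.
have ub x : has_ubound (range (u ^~ x)).
  by exists (f x) => _ [k _ <-]; have /andP[] := uf k x.
have cv x := cvg_infs_sup (ub x) (lb x).
have lbs x k : has_lbound (sdrop (u ^~ x) k).
  by exists 0 => _ [l _ <-]; have /andP[] := uf l x.
have infs_ge0 x k : 0 <= infs (u ^~ x) k.
  apply: lb_le_inf; first by exists (u k x), k => /=.
  by move=> _ [l _ <-]; have /andP[] := uf l x.
have infs_le x k : infs (u ^~ x) k <= u k x.
  by apply: ge_inf => //; exists k => /=.
have mi k : measurable_fun setT (fun x => infs (u ^~ x) k).
  by apply: measurable_fun_infs.
have mp : measurable_fun setT (fun x => sup (range (infs (u ^~ x)))).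
  by apply: (measurable_fun_cvg mi) => x _; exact: cv.
have infs_f x k : infs (u ^~ x) k <= f x.
  by apply: le_trans (infs_le x k) _; have /andP[] := uf k x.
have hu x : has_ubound (range (infs (u ^~ x))) by exists (f x) => _ [k _ <-].
split => //.
- move=> x; apply/andP; split.
    by apply: le_trans (infs_ge0 x 0%N) _; apply: ub_le_sup => //; exists 0%N.
  by apply: ge_sup => [|_ [k _ <-]//]; exists (infs (u ^~ x) 0%N), 0%N.
- have [|_ cN] := bqb_fatou Q (u := fun k x => infs (u ^~ x) k) mi mp.
    apply: aeW => x; split => //; first exact: nondecreasing_infs.
  apply: cvge_to_le cN _; apply: nearW => k.
  have [_ _] := Cu k; apply: le_trans; apply: space_norm_le => // x.
  by rewrite !ger0_norm//; have /andP[] := uf k x.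
Qed.

Hypothesis dual_bound : forall h : E -> R, measurable_fun setT h ->
  (forall x, 0 <= h x <= F * \1_K x) -> (assoc_norm N (EFin \o h) < +oo)%E ->
  ((\int[lebesgue]_(x in K) (f x * h x))%:E <= assoc_norm N (EFin \o h))%E.

Lemma lorentz_luxemburg1 : (N f <= 1)%E.
Proof.
have C0 : C (fun=> 0).
  by split => //; [move=> x; rewrite lexx f_ge0|rewrite space_norm0 lee01].
have [||p Cp pmin] := L2_projection mK Kfin mf f_le F_ge0 _ _ C_mid C_liminf (ex_intro _ _ C0).
- by move=> g [].
- by move=> g x [_ ->].
have [mp pf p1] := Cp.
pose h x := f x - p x.
have mh : measurable_fun setT h by exact: measurable_funB.
have h_bounds x : 0 <= h x <= F * \1_K x.
  by rewrite /h; have := pf x; have := f_bounds x; lra.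
have h_le x : h x <= F by rewrite /h; have := pf x; have := f_le x; lra.
have hn x : `|h x| <= F by rewrite ger0_norm//; have /andP[] := h_bounds x.
have ih : lebesgue.-integrable K (EFin \o h).
  by apply: (integrable_bounded (M := F)) => //; exact: measurable_funTS.
have ihM (g : E -> R) G : measurable_fun setT g -> (forall x, `|g x| <= G) ->
    lebesgue.-integrable K (EFin \o (fun x => h x * g x)).
  by move=> mg gG; apply: (@integrableM_bounded _ _ _ _ _ _ _ G) => //; exact: measurable_funTS.
have var (g : E -> R) G : measurable_fun setT g -> (forall x, 0 <= g x <= G) ->
    (N g <= 1)%E ->
    \int[lebesgue]_(x in K) (h x * g x) <= \int[lebesgue]_(x in K) (h x * p x).
  move=> mg gG g1.
  have gn x : `|g x| <= G by rewrite ger0_norm; have /andP[] := gG x.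
  have pn x : `|p x| <= F.
    by rewrite ger0_norm; have := pf x; have := f_le x; lra.
  have Xg : fspace N g by split => //; apply: le_lt_trans g1 _; rewrite ltry.
  have gpG x : `|g x - p x| <= G + F.
    by apply: le_trans (ler_normB _ _) _; apply: lerD.
  have mgp : measurable_fun setT (fun x => g x - p x) by exact: measurable_funB.
  pose a := \int[lebesgue]_(x in K) (h x * (g x - p x)).
  pose b := \int[lebesgue]_(x in K) ((g x - p x) ^+ 2).
  have b0 : 0 <= b by apply: Rintegral_ge0 => x _; rewrite sqr_ge0.
  have igp : lebesgue.-integrable K (EFin \o (fun x => h x * (g x - p x))).
    exact: ihM gpG.
  have igp2 : lebesgue.-integrable K (EFin \o (fun x => (g x - p x) ^+ 2)).
    exact: (integrable_sqr_bounded mK Kfin mgp gpG).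
  have ih2 : lebesgue.-integrable K (EFin \o (fun x => h x ^+ 2)).
    exact: (integrable_sqr_bounded mK Kfin mh hn).
  (* First variation of the distance in the direction of g. The convex combination w of p and g may
     exceed f, so it is cut off at f: this keeps it in [C] and cannot increase its distance to f. *)
  have step t : 0 < t -> t <= 1 -> 2 * a <= t * b.
    move=> t0 t1.
    pose w x := t * g x + (1 - t) * p x.
    have mw : measurable_fun setT w.
      by apply: measurable_funD; apply: measurable_funM.
    pose q x := Num.min (f x) (w x).
    have w0 x : 0 <= w x.
      have := gG x; have := pf x => /andP[? _] /andP[? _].
      by rewrite addr_ge0// mulr_ge0 ?subr_ge0// ltW.
    have mq : measurable_fun setT q by exact: measurable_minr.
    have Cq : C q.
      split => //.
        by move=> x; rewrite le_min f_ge0 w0 ge_min lexx.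
      apply: (@le_trans _ _ (N w)).
        apply: space_norm_le => // x.
        by rewrite !ger0_norm// ?ge_min ?lexx ?orbT// le_min f_ge0 w0.
      by apply: convex_comb => //; [rewrite ltW|exact: C_fspace].
    have := pmin _ Cq.
    have qw x : (f x - q x) ^+ 2 <= h x ^+ 2 - (2 * t) * (h x * (g x - p x)) +
        t ^+ 2 * (g x - p x) ^+ 2.
      rewrite (_ : _ - _ + _ = (f x - w x) ^+ 2); last by rewrite /h /w; ring.
      rewrite /q; case: (leP (f x) (w x)) => [fw|wf]; last exact: lexx.
      by rewrite subrr expr0n sqr_ge0.
    have i1 : lebesgue.-integrable K (EFin \o (fun x => h x ^+ 2 - (2 * t) * (h x * (g x - p x)))).
      by apply: integrableB_real => //; exact: integrableZ_real.
    have i2 : lebesgue.-integrable K (EFin \o (fun x => t ^+ 2 * (g x - p x) ^+ 2)).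
      exact: integrableZ_real.
    have iq : lebesgue.-integrable K (EFin \o (fun x => (f x - q x) ^+ 2)).
      apply: (integrable_sqr_bounded (M := F) mK Kfin (measurable_funB mf mq)) => x.
      by have [_ /(_ x)/andP[q0 qf] _] := Cq; have := f_le x; rewrite /= ger0_norm; lra.
    move/le_trans => /(_ _ (le_Rintegral mK iq (integrableD_real mK i1 i2) (fun x _ => qw x))).
    rewrite RintegralD// RintegralB//; last exact: integrableZ_real.
    rewrite !RintegralZl// -/a -/b => le.
    rewrite -(ler_pM2l t0); move: le; rewrite -/(h _); lra.
  suff : a <= 0.
    rewrite /a.
    have -> : \int[lebesgue]_(x in K) (h x * (g x - p x)) =
       \int[lebesgue]_(x in K) (h x * g x) - \int[lebesgue]_(x in K) (h x * p x).
      rewrite -RintegralB//; [|exact: ihM gn|exact: ihM pn].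
      by apply: eq_Rintegral => x _; rewrite mulrBr.
    by rewrite subr_le0.
  rewrite leNgt; apply/negP => a0.
  have ab : 0 < a + b by lra.
  (* With this t the inequality becomes 2 (a + b) <= b, which is absurd; it also covers b = 0. *)
  have := step (a / (a + b)); rewrite divr_gt0// ler_pdivrMr// mul1r lerDl => /(_ erefl b0).
  by rewrite mulrAC ler_pdivlMr//; nra.
have assoc_le : (assoc_norm N (EFin \o h) <= (\int[lebesgue]_(x in K) (h x * p x))%:E)%E.
  apply: ge_ereal_sup => _ [g [Xg g1] <-].
  have [mg _] := Xg.
  (* The variational inequality is available for bounded competitors only; monotone convergence
     extends it to every g of norm 1. *)
  pose gm (m : nat) x := Num.min `|g x| m%:R.
  have mng : measurable_fun setT (fun x => `|g x|) by exact: measurableT_comp.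
  have mgm m : measurable_fun setT (gm m) by exact: (measurable_minr mng (measurable_cst _)).
  have gm0 m x : 0 <= gm m x <= m%:R.
    by rewrite le_min normr_ge0 ler0n ge_min lexx orbT.
  have mhg m : measurable_fun setT (fun x => (h x * gm m x)%:E).
    exact/measurable_EFinP/measurable_funM.
  have h0 x : 0 <= h x by have /andP[] := h_bounds x.
  have hgm0 m x : (0 <= (h x * gm m x)%:E)%E.
    by rewrite lee_fin mulr_ge0//; have /andP[] := gm0 m x.
  have nd x : nondecreasing_seq (fun m => (h x * gm m x)%:E).
    move=> k l kl; rewrite lee_fin ler_wpM2l// /gm.
    by rewrite le_min ge_min lexx /= ge_min ler_nat kl orbT.
  have := @cvg_monotone_convergence _ _ _ lebesgue setT measurableT _ mhg
    (fun m x _ => hgm0 m x) (fun x _ => nd x).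
  rewrite (_ : (fun x : E => _) = (fun x => `|(EFin \o h) x * (g x)%:E|%E)); last first.
    apply/funext => x; apply/cvg_lim => //.
    apply: cvg_near_cst; near=> k; congr EFin; rewrite normrM (ger0_norm (h0 x)).
    by rewrite /gm min_l// ltW//; near: k; exact: nbhs_infty_gtr.
  move=> cv; apply: cvge_to_le cv _; apply: nearW => m.
  have Ngm : (N (gm m) <= 1)%E.
    rewrite -g1; apply: space_norm_le => // x.
    by rewrite ger0_norm; [rewrite ge_min lexx|have /andP[] := gm0 m x].
  have gmn x : `|gm m x| <= m%:R by rewrite ger0_norm; have /andP[] := gm0 m x.
  rewrite (@integral_support _ _ _ _ K); last first.
    move=> x Kx; have := h_bounds x; rewrite indicE memNset// mulr0 => h00.
    by rewrite (_ : h x = 0) ?mul0r//; lra.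
  rewrite -(fineK (integrable_fin_num mK (ihM _ _ (mgm m) gmn))) lee_fin.
  exact: (var _ _ (mgm m) (gm0 m) Ngm).
(* Together with [assoc_le] this gives int f h <= int p h, that is, int h^2 <= 0. Hence f = p a.e.
   and f inherits the norm bound of p. *)
have := dual_bound mh h_bounds (le_lt_trans assoc_le (ltry _)).
move=> /le_trans/(_ assoc_le); rewrite lee_fin => fh.
have ip2 : lebesgue.-integrable K (EFin \o (fun x => h x ^+ 2)).
  exact: (integrable_sqr_bounded mK Kfin mh hn).
have pn x : `|p x| <= F.
  by rewrite ger0_norm; have := pf x; have := f_le x; lra.
have h2 : (\int[lebesgue]_(x in K) `|(h x ^+ 2)%:E| = 0)%E.
  under eq_integral do rewrite gee0_abs ?lee_fin ?sqr_ge0//.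
  rewrite -(fineK (integrable_fin_num mK ip2)); congr EFin.
  apply/eqP; rewrite eq_le; apply/andP; split; last first.
    by apply: (@Rintegral_ge0 _ _ _ lebesgue K (fun x => h x ^+ 2)) => x _; rewrite sqr_ge0.
  move: fh; rewrite -subr_le0 -RintegralB//; first last.
  - exact: ihM pn.
  - rewrite (_ : (fun x => _) = (fun x => h x * f x)); last first.
      by apply/funext => x; rewrite mulrC.
    apply: (ihM _ F) => // x; rewrite ger0_norm//.
  apply: le_trans; rewrite le_eqVlt; apply/orP; left; apply/eqP.
  by congr fine; apply: eq_integral => x _; congr EFin; rewrite /h; ring.
have := (ae_eq_integral_abs lebesgue mK (measurable_int _ ip2)).1 h2 => h_ae.
apply: le_trans p1; apply: (bqb_monotone Q) => //.
apply: filterS h_ae => x /= h_ae.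
have [Kx|Kx] := pselect (K x).
  have [/eqP] := h_ae Kx; rewrite sqrf_eq0 subr_eq0 => /eqP ->.
  exact: lexx.
have := f_bounds x; rewrite indicE memNset// mulr0 => f00.
by rewrite (_ : f x = 0) ?normr0 ?normr_ge0//; lra.
Unshelve. all: by end_near. Qed.

End lorentz_luxemburg.
(** Reduction to the previous case by truncating |f| and dividing by A. The tests h are restricted
    to those that the projection argument can produce: nonnegative, bounded, supported in K and of
    finite associate norm. *)
Lemma lorentz_luxemburg (K : set E) (f : E -> R) (A : R) :
  measurable K -> (lebesgue K < +oo)%E -> measurable_fun setT f ->
  (forall x, ~ K x -> f x = 0) -> 0 < A ->
  (forall (h : E -> R) M, measurable_fun setT h -> (forall x, 0 <= h x <= M * \1_K x) ->
    (assoc_norm N (EFin \o h) < +oo)%E ->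
    (\int[lebesgue]_(x in K) (`|f x| * h x)%:E <= A%:E * assoc_norm N (EFin \o h))%E) ->
  (N f <= A%:E)%E.
Proof.
move=> mK Kfin mf f0 A0 dual; apply: space_norm_truncation => // m.
have mna : measurable_fun setT (fun x => `|f x|) by exact: measurableT_comp.
have mn : measurable_fun setT (fun x => Num.min `|f x| m%:R).
  exact: (measurable_minr mna (measurable_cst _)).
have iA0 : 0 <= A^-1 by rewrite invr_ge0 ltW.
have n_ge0 x : 0 <= Num.min `|f x| m%:R by rewrite le_min normr_ge0 ler0n.
pose f' x := A^-1 * Num.min `|f x| m%:R.
have mf' : measurable_fun setT f' by apply: measurable_funM.
have f'0 x : 0 <= f' x by rewrite mulr_ge0.
have f'b x : 0 <= f' x <= (A^-1 * m%:R) * \1_K x.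
  rewrite f'0 /= /f' -mulrA ler_wpM2l//.
  rewrite indicE; case: (boolP (x \in K)) => [_|/negP]; first by rewrite mulr1 ge_min lexx orbT.
  by rewrite inE => /f0 ->; rewrite normr0 mulr0 ge_min lexx.
have F0 : 0 <= A^-1 * m%:R by rewrite mulr_ge0.
have : (N f' <= 1)%E.
  apply: (@lorentz_luxemburg1 K f' (A^-1 * m%:R)) => // h mh hb hfin.
  have hn x : `|h x| <= A^-1 * m%:R.
    have /andP[h0 hF] := hb x; rewrite ger0_norm//; apply: le_trans hF _.
    by rewrite indicE; case: (_ \in _); rewrite ?mulr1 ?mulr0.
  have ifh : lebesgue.-integrable K (EFin \o (fun x => f' x * h x)).
    apply: (@integrableM_bounded _ _ _ _ _ _ _ (A^-1 * m%:R)) => //; last exact: measurable_funTS.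
    apply: (@integrable_bounded _ _ _ _ _ _ (A^-1 * m%:R)) => //; first exact: measurable_funTS.
    move=> x _; rewrite ger0_norm//; have /andP[_] := f'b x; move/le_trans; apply.
    by rewrite indicE; case: (_ \in _); rewrite ?mulr1 ?mulr0.
  rewrite /Rintegral fineK; last exact: integrable_fin_num ifh.
  rewrite -(@lee_pmul2l _ A%:E) ?lte_fin//; apply: le_trans (dual _ _ mh hb hfin).
  rewrite -ge0_integralZl//; first last.
  - by rewrite lee_fin ltW.
  - by move=> x _; rewrite lee_fin mulr_ge0//; have /andP[] := hb x.
  - exact: measurable_int ifh.
  apply: ge0_le_integral.
  - exact: mK.
  - move=> x _; rewrite mule_ge0 ?lee_fin//; first exact: ltW.
    by rewrite mulr_ge0//; have /andP[] := hb x.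
  - by apply: measurable_funeM; exact: measurable_int ifh.
  - exact/measurable_EFinP/measurable_funTS/(measurable_funM mna mh).
  - move=> x _; rewrite -EFinM lee_fin mulrA ler_wpM2r//; first by have /andP[] := hb x.
    by rewrite /f' mulrA mulfV ?gt_eqF// mul1r ge_min lexx.
move=> f'1; have Xf' : fspace N f' by split => //; apply: le_lt_trans f'1 _; rewrite ltry.
rewrite (_ : (fun x => _) = (fun x => A * f' x)); last first.
  by apply/funext => x; rewrite /f' mulrA mulfV ?gt_eqF// mul1r.
rewrite (bqb_homogeneous Q)// gtr0_norm//.
by rewrite -[leRHS]mule1 lee_pmul2l// lte_fin.
Qed.

Lemma unit_in_space : exists2 g, fspace N g & N g = 1%E.
Proof.
have X1 := indic_cube_in_space (0 : E) ltr01; have r0 := norm_cube_gt0 (0 : E) ltr01.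
exists (fun x => (fine (N \1_(cube (0 : E) 1)))^-1 * \1_(cube (0 : E) 1) x); first exact: fspaceZ.
rewrite (bqb_homogeneous Q)// gtr0_norm ?invr_gt0// -[X in (_ * X)%E]fineK ?space_norm_fin//.
by rewrite -EFinM mulVf// gt_eqF.
Qed.

Lemma assoc_norm_ge0 (h : E -> \bar R) : (0 <= assoc_norm N h)%E.
Proof.
have [g Xg g1] := unit_in_space; apply: le_trans (assoc_norm_ge _ Xg g1).
by apply: integral_ge0.
Qed.

(** Applied to maximal functions with no measurability at hand, so the integrals are compared as
    suprema over the simple functions below the integrands. *)
Lemma le_assoc_norm (h1 h2 : E -> \bar R) :
  (forall x, `|h1 x| <= `|h2 x|)%E -> (assoc_norm N h1 <= assoc_norm N h2)%E.
Proof.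
move=> h12; apply: ge_ereal_sup => _ [g [Xg g1] <-].
apply: le_trans (assoc_norm_ge _ Xg g1); rewrite !ge0_integralTE//.
apply: ereal_sup_le => _ [s /= sle <-]; exists s => // x.
by apply: le_trans (sle x) _; rewrite !abseM lee_wpmul2r.
Qed.

(** The axiom that bounds integrals over balls by the norm says exactly that bounded functions
    supported in a ball belong to X'. *)
Lemma assoc_space_bounded (h : E -> R) (c : E) (l M : R) : 0 < l ->
  measurable_fun setT h -> (forall x, 0 <= h x <= M * \1_(cube c l) x) ->
  assoc_space N h.
Proof.
move=> l0 mh hb; split => //.
have [C [C0 HC]] := bb_ball_integral X_bbfs c (mulr_gt0 (ltr0n R n.+2) l0).
have cc : cube c l c by move=> i; rewrite lexx lerDl ltW.
have M0 : 0 <= M.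
  by have := hb c; rewrite indicE mem_set// mulr1 => /andP[]; exact: le_trans.
apply: (@le_lt_trans _ _ (M%:E * C%:E)%E); last by rewrite -EFinM ltry.
apply: ge_ereal_sup => _ [g [Xg g1] <-].
have [mg _] := Xg.
have mng : measurable_fun setT (fun x => `|g x|%:E).
  by apply/measurable_EFinP; exact: measurableT_comp.
have := HC _ Xg; rewrite g1 mule1 => H.
apply: le_trans (lee_wpmul2l _ H); last by rewrite lee_fin.
rewrite -ge0_integralZl//; [|exact: measurable_eball|exact: measurable_funTS].
rewrite (@integral_support _ _ _ _ (eball c (n.+2%:R * l))); last first.
  move=> x Kx; have := hb x; rewrite indicE memNset ?mulr0.
    move=> h00; have hx0 : h x = 0 by lra.
    by rewrite /= hx0 mul0r normr0.
  by move=> cx; apply: Kx; apply: cube_sub_eball cx.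
apply: ge0_le_integral.
- exact: measurable_eball.
- by move=> x _; exact: abse_ge0.
- apply/measurable_funTS/measurable_EFinP.
  exact: (measurableT_comp (@normr_measurable R setT) (measurable_funM mh mg)).
- by apply: measurable_funeM; exact: measurable_funTS.
- move=> x _; rewrite -EFinM /= lee_fin normrM ler_wpM2r//.
  have /andP[h0 h1] := hb x; rewrite ger0_norm//; apply: le_trans h1 _.
  by rewrite indicE; case: (_ \in _); rewrite ?mulr1 ?mulr0.
Qed.

(** The ball about x of radius (n + 2) l contains the cube and lies in a cube of side 2 (n + 2) l,
    whence the constant. *)
Lemma le_maximal (h : E -> R) (c x : E) (l : R) : 0 < l -> measurable_fun setT h ->
  cube c l x ->
  (((2 * n.+2%:R * l) ^+ n.+1)^-1%:E * \int[lebesgue]_(y in cube c l) `|h y|%:E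
    <= maximal h x)%E.
Proof.
move=> l0 mh cx; set r := n.+2%:R * l.
have r0 : 0 < r by rewrite mulr_gt0// ltr0n.
have mnh : measurable_fun setT (fun x => `|h x|%:E).
  by apply/measurable_EFinP; exact: measurableT_comp.
apply: (@le_trans _ _ ((vol (eball x r))^-1%:E *
    \int[lebesgue]_(y in eball x r) `|h y|%:E)%E); last first.
  by apply: ereal_sup_ubound; exists r.
have up : (lebesgue (eball x r) <= ((2 * r) ^+ n.+1)%:E)%E.
  rewrite -(@lebesgue_cube _ _ (x - const_mx r)); last by rewrite mulr_ge0// ltW.
  exact: le_lebesgue (@eball_sub_cube _ _ _ _).
have fin : lebesgue (eball x r) \is a fin_num.
  by rewrite ge0_fin_numE// (le_lt_trans up)// ltry.
have lo : ((l ^+ n.+1)%:E <= lebesgue (eball x r))%E.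
  rewrite -(@lebesgue_cube _ _ c); last exact: ltW.
  exact: le_lebesgue (@cube_sub_eball _ _ _ _ _ l0 cx).
rewrite -(fineK fin) !lee_fin -/(vol _) in up lo.
have v0 : 0 < vol (eball x r) by apply: lt_le_trans lo; rewrite exprn_gt0.
apply: lee_pmul.
- by rewrite lee_fin invr_ge0 exprn_ge0// mulr_ge0// ltW.
- by apply: integral_ge0.
- by rewrite lee_fin lef_pV2 ?posrE//; [rewrite -mulrA|rewrite exprn_gt0// -mulrA mulr_gt0].
- apply: ge0_subset_integral => //; [exact: measurable_cube|exact: measurable_eball| |].
    exact: measurable_funTS.
  exact: (@cube_sub_eball _ _ _ _ _ l0 cx).
Qed.

Hypothesis M_bounded : maximal_bounded_on_assoc N.

(** Real-valued minorants G of the maximal function are all that the estimates in X handle; they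
    stay clear of its possibly infinite values. *)
Lemma maximal_assoc_bound : exists C : R, 0 < C /\
  forall (h G : E -> R), assoc_space N h -> (forall x, 0 <= G x) ->
  (forall x, (G x)%:E <= maximal h x)%E ->
  (assoc_norm N (EFin \o G) <= C%:E * assoc_norm N (EFin \o h))%E.
Proof.
have [C HC] := M_bounded; exists (`|C| + 1); split; first by rewrite ltr_wpDl.
move=> h G Xh G0 GM; apply: (@le_trans _ _ (assoc_norm N (maximal h))).
  apply: le_assoc_norm => x; rewrite gee0_abs ?lee_fin//.
  by apply: le_trans (GM x) _; exact: lee_abs.
apply: le_trans (HC _ Xh) _; apply: lee_wpmul2r; first exact: assoc_norm_ge0.
by rewrite lee_fin (le_trans (ler_norm _))// lerDl.
Qed.

End function_space.

(** * Polynomial projections *)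

Section finite_dimensional_projection.
Context d (T : measurableType d) (R : realType) (mu : {measure set T -> \bar R}).
Variables (K : set T).
Hypotheses (mK : measurable K).

Lemma integrable_sum_real (I : Type) (s : seq I) (F : I -> T -> R) :
  (forall i, mu.-integrable K (EFin \o F i)) ->
  mu.-integrable K (EFin \o (fun x => \sum_(i <- s) F i x)).
Proof.
move=> iF; apply: (@eq_integrable _ _ _ _ _ mK (fun x => \sum_(i <- s) (F i x)%:E)%E).
  by move=> x _; rewrite sumEFin.
exact: (@integrable_sum _ _ _ mu K mK _ s xpredT (fun i => EFin \o F i)).
Qed.

Lemma Rintegral_sum_real (I : Type) (s : seq I) (F : I -> T -> R) :
  (forall i, mu.-integrable K (EFin \o F i)) ->
  \int[mu]_(x in K) (\sum_(i <- s) F i x) = \sum_(i <- s) \int[mu]_(x in K) F i x.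
Proof.
move=> iF; elim: s => [|i s IH].
  by under eq_Rintegral do rewrite big_nil; rewrite big_nil Rintegral_cst// mul0r.
under eq_Rintegral do rewrite big_cons.
by rewrite RintegralD// ?big_cons ?IH//; exact: integrable_sum_real.
Qed.

Variables (k : nat) (e : 'I_k -> T -> R) (M : R).
Hypotheses (Kfin : (mu K < +oo)%E) (me : forall i, measurable_fun setT (e i)).
Hypothesis eM : forall i x, K x -> `|e i x| <= M.

Let ie i (g : T -> R) : mu.-integrable K (EFin \o g) ->
  mu.-integrable K (EFin \o (fun x => g x * e i x)).
Proof.
move=> ig; apply: (@integrableM_bounded _ _ _ _ _ _ _ M) => //; last exact: eM.
exact: measurable_funTS.
Qed.

Let ie1 i : mu.-integrable K (EFin \o e i).
Proof.
by apply: (@integrable_bounded _ _ _ _ _ _ M) => //; [exact: measurable_funTS|exact: eM].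
Qed.

Let ie2 i (w : 'I_k -> R) :
  mu.-integrable K (EFin \o (fun x => (\sum_j w j * e j x) * e i x)).
Proof.
by apply: ie; apply: integrable_sum_real => j; apply: integrableZ_real.
Qed.

(* The Gram matrix G of the e_i may be singular, but b_j = int f e_j still lies
   in its row space: G w = 0 forces sum_j w_j e_j = 0 a.e., hence b w = 0. *)
Lemma gram_solution (f : T -> R) : mu.-integrable K (EFin \o f) ->
  exists v : 'I_k -> R, forall j,
    \int[mu]_(x in K) ((f x - \sum_i v i * e i x) * e j x) = 0.
Proof.
move=> fi.
pose G : 'M[R]_k := \matrix_(i, j) \int[mu]_(x in K) (e i x * e j x).
pose b : 'rV[R]_k := \row_j \int[mu]_(x in K) (f x * e j x).
have /submxP[v bE] : (b <= G)%MS.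
  rewrite submxE; apply/eqP/rowP => c; rewrite !mxE.
  pose w i := cokermx G i c.
  have Gw i : \sum_j w j * \int[mu]_(x in K) (e j x * e i x) = 0.
    transitivity ((G *m cokermx G) i c); last by rewrite mulmx_coker mxE.
    rewrite mxE; apply: eq_bigr => j _; rewrite mxE mulrC; congr (_ * _).
    by apply: eq_Rintegral => x _; rewrite mulrC.
  have S0 : \int[mu]_(x in K) ((\sum_j w j * e j x) ^+ 2) = 0.
    transitivity (\int[mu]_(x in K) (\sum_i w i * ((\sum_j w j * e j x) * e i x))).
      apply: eq_Rintegral => x _; rewrite expr2 mulr_sumr.
      by apply: eq_bigr => i _; ring.
    rewrite Rintegral_sum_real; last by move=> i; apply: integrableZ_real.
    rewrite big1// => i _; rewrite RintegralZl//.
    rewrite (_ : Rintegral _ _ _ = 0) ?mulr0//.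
    transitivity (\int[mu]_(x in K) (\sum_j w j * (e j x * e i x))).
      by apply: eq_Rintegral => x _; rewrite mulr_suml; apply: eq_bigr => j _; ring.
    rewrite Rintegral_sum_real; last by move=> j; apply: integrableZ_real => //; exact: ie.
    rewrite -[RHS](Gw i); apply: eq_bigr => j _.
    by rewrite RintegralZl//; exact: ie.
  have iS : mu.-integrable K (EFin \o (fun x => (\sum_j w j * e j x) ^+ 2)).
    apply: (@eq_integrable _ _ _ _ _ mK
      (EFin \o (fun x => \sum_i w i * ((\sum_j w j * e j x) * e i x)))).
      move=> x _ /=; congr EFin; rewrite expr2 mulr_sumr.
      by apply: eq_bigr => i _; ring.
    by apply: integrable_sum_real => i; apply: integrableZ_real.
  have : (\int[mu]_(x in K) `|((\sum_j w j * e j x) ^+ 2)%:E| = 0)%E.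
    under eq_integral do rewrite gee0_abs ?lee_fin ?sqr_ge0//.
    by rewrite -(fineK (integrable_fin_num mK iS)); congr EFin.
  move/(ae_eq_integral_abs mu mK (measurable_int _ iS)).1 => ae0.
  transitivity (\int[mu]_(x in K) (f x * \sum_j w j * e j x)).
    transitivity (\int[mu]_(x in K) (\sum_j w j * (f x * e j x))).
      rewrite Rintegral_sum_real; last by move=> j; apply: integrableZ_real => //; exact: ie.
      by apply: eq_bigr => j _; rewrite RintegralZl//; [rewrite mxE mulrC|exact: ie].
    by apply: eq_Rintegral => x _; rewrite mulr_sumr; apply: eq_bigr => j _; ring.
  rewrite -[RHS]/(fine 0%E) -(integral0 mu K); congr fine.
  apply: ae_eq_integral => //.
  - apply/measurable_EFinP; apply: measurable_funM.
      by apply/measurable_EFinP; exact: measurable_int fi.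
    apply/measurable_EFinP; apply: measurable_int.
    by apply: integrable_sum_real => j; apply: integrableZ_real.
  - apply: filterS ae0 => x /= /[apply] -[] /eqP; rewrite sqrf_eq0 => /eqP ->.
    by rewrite mulr0.
exists (v 0) => j.
have := congr1 (fun A : 'rV[R]_k => A 0 j) bE; rewrite !mxE => bj.
rewrite (@eq_Rintegral _ _ _ mu K
  (fun x => f x * e j x - (\sum_i v 0 i * e i x) * e j x)); last first.
  by move=> x _; rewrite mulrBl.
rewrite RintegralB//; last exact: ie.
apply/eqP; rewrite subr_eq0; apply/eqP; rewrite bj.
rewrite (@eq_Rintegral _ _ _ mu K (fun x => \sum_i v 0 i * (e i x * e j x))); last first.
  by move=> x _; rewrite mulr_suml; apply: eq_bigr => i _; ring.
rewrite Rintegral_sum_real; last by move=> i; apply: integrableZ_real => //; exact: ie.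
by apply: eq_bigr => i _; rewrite mxE RintegralZl//; exact: ie.
Qed.

End finite_dimensional_projection.
Section univariate.
Context {R : realType}.

(* Coefficients are recovered from the values at s+1 points of [0, 1] through
   the inverse of the Vandermonde matrix. *)
Lemma poly_increment_bound (s : nat) : exists2 L : R, 1 <= L &
  forall (q : {poly R}) (B : R), (size q <= s.+1)%N ->
    (forall t, 0 <= t <= 1 -> `|q.[t]| <= B) ->
    forall t, 0 <= t <= 1 -> `|q.[t] - q.[0]| <= L * B * t.
Proof.
pose a : 'rV[R]_s.+1 := \row_j (j%:R / s.+1%:R).
pose V := Vandermonde s.+1 a.
have Vu : V \in unitmx.
  rewrite unitmxE det_Vandermonde unitfE; apply/prodf_neq0 => i _.
  apply/prodf_neq0 => j ij; rewrite !mxE -mulrBl mulf_neq0 ?invr_eq0 ?pnatr_eq0//.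
  by rewrite subr_eq0 eqr_nat gtn_eqF.
pose S := \sum_i \sum_j `|invmx V j i|.
have S0 : 0 <= S by apply: sumr_ge0 => i _; apply: sumr_ge0.
(* The summand 1 ensures L >= 1, which later keeps the ratio 1 / (4 L) of a homothety at most 1. *)
exists (1 + S); first by rewrite lerDl.
move=> q B sq qB t /andP[t0 t1].
have B0 : 0 <= B by apply: le_trans (normr_ge0 _) (qB 0 _); rewrite lexx ler01.
pose u : 'rV[R]_s.+1 := \row_i q`_i.
have uE : u = (\row_j q.[a 0 j]) *m invmx V.
  rewrite -[LHS](mulmxK Vu); congr (_ *m _); apply/rowP => j.
  rewrite !mxE (horner_coef_wide _ sq); apply: eq_bigr => i _.
  by rewrite !mxE.
have coefB (i : 'I_s.+1) : `|q`_i| <= \sum_j `|invmx V j i| * B.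
  have -> : q`_i = u 0 i by rewrite mxE.
  rewrite uE mxE.
  apply: le_trans (ler_norm_sum _ _ _) _; apply: ler_sum => j _.
  rewrite !mxE normrM mulrC ler_wpM2l//; apply: qB.
  rewrite divr_ge0//= ler_pdivrMr ?ltr0n// mul1r ler_nat.
  by rewrite ltnW.
have -> : q.[t] - q.[0] = \sum_(i < s.+1) q`_i * (t ^+ i - 0 ^+ i).
  rewrite !(horner_coef_wide _ sq) -sumrB; apply: eq_bigr => i _.
  by rewrite mulrBr.
apply: (@le_trans _ _ (\sum_(i < s.+1) (\sum_j `|invmx V j i| * B) * t)); last first.
  rewrite -mulr_suml; apply: ler_wpM2r => //.
  rewrite mulrDl mul1r /S mulr_suml ler_wpDl//; apply: ler_sum => i _.
  by rewrite mulr_suml.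
apply: le_trans (ler_norm_sum _ _ _) _; apply: ler_sum => i _.
rewrite normrM; apply: ler_pM => //.
case: i => -[|i] /= _; first by rewrite !expr0 subrr normr0.
rewrite expr0n subr0 ger0_norm ?exprn_ge0// exprS.
by rewrite ler_piMr// exprn_ile1.
Qed.

End univariate.

Section multivariate.
Context {R : realType} {n : nat}.
Local Notation E := 'rV[R]_n.+1.
Local Notation poly := (mpoly.mpoly n.+1 R).
Implicit Types (p : poly) (x y c : E).

Lemma pevalE p x :
  peval p x = \sum_(m <- mpoly.msupp p) mpoly.mcoeff m p * monomial m x.
Proof. by rewrite /peval mevalE. Qed.

Lemma pevalB p q x : peval (p - q) x = peval p x - peval q x.
Proof. by rewrite /peval mevalB. Qed.

Lemma measurable_monomial (m : mpoly.multinom n.+1) :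
  measurable_fun setT (monomial m : E -> R).
Proof.
apply: measurable_prod => i _; apply: measurable_funX; exact: measurable_coord.
Qed.

Lemma measurable_peval p : measurable_fun setT (peval p : E -> R).
Proof.
rewrite (_ : peval p = fun x => \sum_(m <- mpoly.msupp p) mpoly.mcoeff m p * monomial m x).
  apply: measurable_sum => m; apply: measurable_funM => //.
  exact: measurable_monomial.
by apply/funext => x; exact: pevalE.
Qed.

Lemma monomial_bounded c (l : R) (m : mpoly.multinom n.+1) : exists M,
  forall x, cube c l x -> `|monomial m x| <= M.
Proof.
exists (\prod_(i < n.+1) (`|c ord0 i| + `|l|) ^+ m i) => x cx.
rewrite /monomial normr_prod; apply: ler_prod => i _.
rewrite normr_ge0 normrX/= lerXn2r ?nnegrE ?addr_ge0//.
have /andP[h1 h2] := cx i.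
rewrite -[x ord0 i](subrKC (c ord0 i)); apply: le_trans (ler_normD _ _) _.
rewrite lerD2l ger0_norm ?subr_ge0//.
by apply: le_trans (ler_norm l); rewrite lerBlDl.
Qed.

Lemma peval_bounded c (l : R) p : exists M,
  forall x, cube c l x -> `|peval p x| <= M.
Proof.
have /choice[M MP] := monomial_bounded c l.
exists (\sum_(m <- mpoly.msupp p) `|mpoly.mcoeff m p| * M m) => x cx.
rewrite pevalE; apply: le_trans (ler_norm_sum _ _ _) _; apply: ler_sum => m _.
by rewrite normrM ler_wpM2l//; exact: MP.
Qed.

Lemma peval_line p x y (s : nat) : (mpoly.msize p <= s.+1)%N ->
  exists2 q : {poly R}, (size q <= s.+1)%N &
    forall t, q.[t] = peval p (x + t *: (y - x)).
Proof.
move=> ps.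
pose lin i : {poly R} := (x ord0 i)%:P + (y ord0 i - x ord0 i) *: 'X.
exists (\sum_(m <- mpoly.msupp p) mpoly.mcoeff m p *:
  \prod_(i < n.+1) lin i ^+ m i).
  apply: leq_trans (size_sum _ _ _) _.
  apply/bigmax_leqP_seq => m mp _.
  apply: leq_trans (size_scale_leq _ _) _.
  have le2 i : (size (lin i) <= 2)%N.
    apply: leq_trans (size_polyD _ _) _; rewrite geq_max.
    rewrite (leq_trans (size_polyC_leq1 _))//=.
    by rewrite (leq_trans (size_scale_leq _ _))// size_polyX.
  apply: (@leq_trans (mdeg m).+1); last first.
    by apply: leq_trans ps; exact: msize_mdeg_lt.
  rewrite mdegE; elim/big_rec2: _ => [|i r k _ IH]; first by rewrite size_poly1.
  apply: leq_trans (size_polyMleq _ _) _.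
  have := size_poly_exp_leq (lin i) (m i).
  have : ((size (lin i)).-1 <= 1)%N.
    by have := le2 i; lia.
  move=> /leq_mul /(_ (leqnn (m i))); rewrite mul1n => h1 h2.
  have h3 : (size (lin i ^+ m i) <= (m i).+1)%N by apply: leq_trans h2 _; rewrite ltnS.
  by lia.
move=> t; rewrite pevalE horner_sum; apply: eq_bigr => m _.
rewrite hornerZ horner_prod; congr (_ * _); apply: eq_bigr => i _.
by rewrite horner_exp !hornerE !mxE mulrC.
Qed.

End multivariate.

(** * Supremum bound and existence of the projection on a cube *)

Section projection_bound.
Context {R : realType} {n : nat}.
Local Notation E := 'rV[R]_n.+1.
Local Notation poly := (mpoly.mpoly n.+1 R).
Implicit Types (p : poly) (x y c : E).

(** The smaller cube is the image of [cube c l] under the homothety of center x and ratio r, so this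
    is convexity. *)
Lemma homothetic_cube_sub c (l r : R) x : 0 <= r <= 1 -> cube c l x ->
  cube ((1 - r) *: x + r *: c) (r * l) `<=` cube c l.
Proof.
move=> /andP[r0 r1] cx y cy i; have := cx i; have := cy i; rewrite !mxE.
move=> /andP[y1 y2] /andP[x1 x2].
have : 0 <= (1 - r) * (x ord0 i - c ord0 i) by rewrite mulr_ge0; lra.
have : 0 <= (1 - r) * (c ord0 i + l - x ord0 i) by rewrite mulr_ge0; lra.
by move=> *; apply/andP; split; lra.
Qed.

(* By poly_increment_bound along the segments from x0, a polynomial stays close
   to p(x0) on a homothetic copy of the cube about x0 of fixed ratio. *)
Lemma peval_half_sup (s : nat) : exists2 r : R, 0 < r <= 1 &
  forall p c (l B : R) x0, (mpoly.msize p <= s.+1)%N ->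
    (forall x, cube c l x -> `|peval p x| <= B) ->
    cube c l x0 -> 3 / 4 * B <= `|peval p x0| ->
    forall y, cube ((1 - r) *: x0 + r *: c) (r * l) y -> B / 2 <= `|peval p y|.
Proof.
have [L L1 LP] := @poly_increment_bound R s.
have L0 : 0 < 4 * L by lra.
(* With ratio 1 / (4 L) the polynomial changes by at most B / 4, and 3 B / 4 - B / 4 = B / 2. *)
have r01 : 0 < (4 * L)^-1 <= 1 by rewrite invr_gt0 L0 invf_le1//; lra.
exists (4 * L)^-1 => //; set r := (4 * L)^-1 in r01 *.
have rL : r * L = 1 / 4 by rewrite /r; field; lra.
have /andP[r0 r1] := r01.
move=> p c l B x0 ps pB cx0 pB0 y cy.
(* u is the preimage of y under the homothety: y has parameter r on the segment from x0 to u. *)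
pose u := x0 + r^-1 *: (y - x0).
have yE : y = x0 + r *: (u - x0).
  by rewrite /u addrAC subrr add0r scalerA mulfV ?gt_eqF// scale1r subrKC.
have cu : cube c l u.
  move=> i; have := cy i; rewrite !mxE => /andP[y1 y2].
  have h1 : r^-1 * r = 1 by rewrite mulVf// gt_eqF.
  have ri : 0 < r^-1 by rewrite invr_gt0.
  apply/andP; split.
    have : 0 <= r^-1 * (y ord0 i - ((1 - r) * x0 ord0 i + r * c ord0 i)).
      by rewrite mulr_ge0 ?(ltW ri)// subr_ge0.
    have -> : r^-1 * (y ord0 i - ((1 - r) * x0 ord0 i + r * c ord0 i)) =
      r^-1 * (y ord0 i - x0 ord0 i) + (r^-1 * r) * (x0 ord0 i - c ord0 i) by ring.
    by rewrite h1; lra.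
  have : 0 <= r^-1 * (((1 - r) * x0 ord0 i + r * c ord0 i) + r * l - y ord0 i).
    by rewrite mulr_ge0 ?(ltW ri)// subr_ge0.
  have -> : r^-1 * (((1 - r) * x0 ord0 i + r * c ord0 i) + r * l - y ord0 i) =
      - (r^-1 * (y ord0 i - x0 ord0 i)) + (r^-1 * r) * (c ord0 i + l - x0 ord0 i) by ring.
  by rewrite h1; lra.
have [q sq qE] := peval_line x0 u ps.
have qB t : 0 <= t <= 1 -> `|q.[t]| <= B.
  move=> /andP[t0 t1]; rewrite qE; apply: pB => i; rewrite !mxE.
  have := cx0 i; have := cu i; rewrite /u !mxE; set v := x0 ord0 i + _.
  move=> /andP[v1 v2] /andP[w1 w2].
  have h1 : 0 <= t * (v - c ord0 i) by rewrite mulr_ge0// subr_ge0.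
  have h2 : 0 <= (1 - t) * (x0 ord0 i - c ord0 i) by rewrite mulr_ge0// subr_ge0.
  have h3 : 0 <= t * (c ord0 i + l - v) by rewrite mulr_ge0// subr_ge0.
  have h4 : 0 <= (1 - t) * (c ord0 i + l - x0 ord0 i) by rewrite mulr_ge0// subr_ge0.
  by apply/andP; split; lra.
have := LP q B sq qB r; rewrite r1 ltW// => /(_ erefl).
rewrite !qE scale0r addr0 -yE.
have -> : L * B * r = B / 4 by rewrite mulrAC (mulrC L) rL; lra.
have := ler_normD (peval p y) (peval p x0 - peval p y).
by rewrite subrKC distrC; lra.
Qed.

(** p is itself a combination of the monomials to which g - p is orthogonal. *)
Lemma orthogonal_pairing p c (l : R) (g : E -> R) (s : nat) : 0 < l ->
  (mpoly.msize p <= s.+1)%N ->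
  lebesgue.-integrable (cube c l) (EFin \o g) ->
  (forall m : mpoly.multinom n.+1, (mdeg m <= s)%N ->
     \int[lebesgue]_(x in cube c l) ((g x - peval p x) * monomial m x) = 0) ->
  \int[lebesgue]_(x in cube c l) (peval p x ^+ 2) =
  \int[lebesgue]_(x in cube c l) (g x * peval p x).
Proof.
move=> l0 ps ig orth.
have mQ := measurable_cube c l.
have Qfin : (lebesgue (cube c l) < +oo)%E by rewrite lebesgue_cube ?ltry// ltW.
have [B pB] := peval_bounded c l p.
have ip : lebesgue.-integrable (cube c l) (EFin \o peval p).
  apply: (integrable_bounded (M := B)) => //.
  exact: measurable_funTS (measurable_peval p).
have igp : lebesgue.-integrable (cube c l) (EFin \o (fun x => g x - peval p x)).
  exact: integrableB_real.
have iM (w : E -> R) : lebesgue.-integrable (cube c l) (EFin \o w) ->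
    lebesgue.-integrable (cube c l) (EFin \o (fun x => w x * peval p x)).
  move=> iw; apply: (integrableM_bounded (M := B)) => //.
  exact: measurable_funTS (measurable_peval p).
have iMm (m : mpoly.multinom n.+1) : lebesgue.-integrable (cube c l)
    (EFin \o (fun x => (g x - peval p x) * monomial m x)).
  have [M MP] := monomial_bounded c l m.
  apply: (integrableM_bounded (M := M)) => //.
  exact: measurable_funTS (measurable_monomial m).
apply/eqP; rewrite eq_sym -subr_eq0 -RintegralB//; [|exact: iM|]; last first.
  rewrite (_ : (fun x => peval p x ^+ 2) = (fun x => peval p x * peval p x)).
    exact: iM.
  by apply/funext => x; rewrite expr2.
apply/eqP.
transitivity (\int[lebesgue]_(x in cube c l) (\sum_(m <- mpoly.msupp p)
   (if (mdeg m <= s)%N then mpoly.mcoeff m p * ((g x - peval p x) * monomial m x) else 0))).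
  apply: eq_Rintegral => x _; rewrite expr2 -mulrBl [X in _ * X]pevalE mulr_sumr.
  rewrite !big_seq; apply: eq_bigr => m mp.
  have := leq_trans (msize_mdeg_lt mp) ps; rewrite ltnS => ->.
  by rewrite mulrCA.
rewrite Rintegral_sum_real//.
  apply: big1 => m _; case: (boolP (mdeg m <= s)%N) => ms; last by rewrite Rintegral_cst// mul0r.
  by rewrite RintegralZl// orth// mulr0.
move=> m; case: (boolP (mdeg m <= s)%N) => ms; first exact: integrableZ_real.
by apply: (integrable_bounded (M := 0)) => // x _; rewrite normr0.
Qed.

(** Let B be the supremum of |p| on the cube. Since |p| >= B / 2 on a homothetic cube of side r l,
    the integral of p^2 is at least (B / 2)^2 (r l)^d; by orthogonality it equals int g p <= B int
    |g|. Dividing by B gives the constant 4 / r^d. A point where |p| >= 3 B / 4 replaces one where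
    the supremum is attained. *)
Lemma projection_sup_bound (s : nat) : exists2 k : R, 0 < k &
  forall p c (l : R) (g : E -> R), 0 < l -> (mpoly.msize p <= s.+1)%N ->
  lebesgue.-integrable (cube c l) (EFin \o g) ->
  (forall m : mpoly.multinom n.+1, (mdeg m <= s)%N ->
     \int[lebesgue]_(x in cube c l) ((g x - peval p x) * monomial m x) = 0) ->
  forall x, cube c l x ->
  `|peval p x| <= k * (l ^- n.+1 * \int[lebesgue]_(x in cube c l) `|g x|).
Proof.
have [r /andP[r0 r1] half] := peval_half_sup s.
exists (4 / r ^+ n.+1); first by rewrite divr_gt0// exprn_gt0.
move=> p c l g l0 ps ig orth.
have mQ := measurable_cube c l.
have Qfin : (lebesgue (cube c l) < +oo)%E by rewrite lebesgue_cube ?ltry// ltW.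
have [B0 pB0] := peval_bounded c l p.
pose S := (fun x => `|peval p x|) @` cube c l.
have cc : cube c l c by move=> i; rewrite lexx lerDl ltW.
have hS : has_sup S.
  by split; [exists `|peval p c|, c|exists B0 => _ [x cx <-]; exact: pB0].
pose B := sup S.
have pB x : cube c l x -> `|peval p x| <= B.
  by move=> cx; apply: ub_le_sup; [exact: (proj2 hS)|exists x].
have A0 : 0 <= \int[lebesgue]_(x in cube c l) `|g x| by exact: Rintegral_ge0.
have ld : 0 < l ^+ n.+1 by rewrite exprn_gt0.
have rd : 0 < r ^+ n.+1 by rewrite exprn_gt0.
suff BA : B <= 4 / r ^+ n.+1 * (l ^- n.+1 * \int[lebesgue]_(x in cube c l) `|g x|).
  by move=> x cx; apply: le_trans (pB _ cx) BA.
have [Bn|Bp] := leP B 0.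
  by apply: le_trans Bn _; rewrite !mulr_ge0 ?invr_ge0// ?exprn_ge0// ?ltW.
have B4 : 0 < B / 4 by rewrite divr_gt0.
have [_ [x0 cx0 <-] x0B] := sup_adherent B4 hS.
have x0B' : 3 / 4 * B <= `|peval p x0| by rewrite -/B in x0B; lra.
have big := half p c l B x0 ps pB cx0 x0B'.
set Q' := cube _ _ in big.
have Q'Q : Q' `<=` cube c l by apply: homothetic_cube_sub => //; rewrite ltW.
have mp := measurable_peval p.
have ip : lebesgue.-integrable (cube c l) (EFin \o peval p).
  by apply: (integrable_bounded (M := B)) => //; exact: measurable_funTS.
have ip2 : lebesgue.-integrable (cube c l) (EFin \o (fun x => peval p x ^+ 2)).
  rewrite (_ : (fun x => peval p x ^+ 2) = (fun x => peval p x * peval p x)).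
    by apply: (integrableM_bounded (M := B)) => //; exact: measurable_funTS.
  by apply/funext => x; rewrite expr2.
have lo : (B / 2) ^+ 2 * (r * l) ^+ n.+1 <= \int[lebesgue]_(x in cube c l) (peval p x ^+ 2).
  apply: (@le_trans _ _ (\int[lebesgue]_(x in Q') (peval p x ^+ 2))); last first.
    apply: le_Rintegral_subset => //; first exact: measurable_cube.
    by move=> x; exact: sqr_ge0.
  rewrite -[(r * l) ^+ _]/(fine (((r * l) ^+ n.+1)%:E)).
  rewrite -(@lebesgue_cube _ _ ((1 - r) *: x0 + r *: c)); last first.
    by rewrite mulr_ge0// ltW.
  rewrite -Rintegral_cst; last exact: measurable_cube.
  apply: le_Rintegral; first exact: measurable_cube.
  - apply: (integrable_bounded (M := (B / 2) ^+ 2)) => //.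
    + exact: measurable_cube.
    + by rewrite [X in (X < _)%E]lebesgue_cube ?ltry// mulr_ge0// ltW.
    + by move=> x _; rewrite ger0_norm ?sqr_ge0.
  - by apply: integrableS ip2 => //; exact: measurable_cube.
  - move=> x /big Bx; rewrite -(real_normK (num_real (peval p x))).
    by rewrite lerXn2r ?nnegrE//; lra.
have hi : \int[lebesgue]_(x in cube c l) (peval p x ^+ 2) <=
    B * \int[lebesgue]_(x in cube c l) `|g x|.
  rewrite (orthogonal_pairing l0 ps ig orth) -RintegralZl//; last exact: integrable_norm_real.
  apply: le_Rintegral => //.
  - by apply: (integrableM_bounded (M := B)) => //; exact: measurable_funTS.
  - by apply: integrableZ_real => //; exact: integrable_norm_real.
  - move=> x cx; apply: le_trans (ler_norm _) _.
    by rewrite normrM mulrC ler_wpM2r//; exact: pB.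
have := le_trans lo hi; rewrite [(r * l) ^+ _]exprMn.
set A := \int[lebesgue]_(x in _) _ in A0 *.
move=> H.
have H2 : B / 4 * (r ^+ n.+1 * l ^+ n.+1) <= A.
  by rewrite -(ler_pM2l Bp); apply: le_trans H; rewrite le_eqVlt; apply/orP; left; apply/eqP; field.
rewrite (_ : 4 / _ * _ = 4 * A / (r ^+ n.+1 * l ^+ n.+1)).
  by rewrite ler_pdivlMr ?mulr_gt0//; lra.
by field; rewrite !gt_eqF.
Qed.

(** The choice made by [xget] has the required property once some polynomial has it; one is obtained
    by solving the Gram system of the monomials of degree at most s. *)
Lemma poly_projP (s : nat) c (l : R) (f : E -> R) : 0 < l ->
  lebesgue.-integrable (cube c l) (EFin \o f) ->
  (mpoly.msize (poly_proj s (cube c l) f) <= s.+1)%N /\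
  forall m : mpoly.multinom n.+1, (mdeg m <= s)%N ->
    \int[lebesgue]_(x in cube c l)
      ((f x - peval (poly_proj s (cube c l) f) x) * monomial m x) = 0.
Proof.
move=> l0 fi.
have mQ := measurable_cube c l.
have Qfin : (lebesgue (cube c l) < +oo)%E by rewrite lebesgue_cube ?ltry// ltW.
(* The degree bound of [bmultinom] is strict, hence [s.+1]. *)
pose I : finType := bmultinom n.+1 s.+1.
pose e (i : 'I_#|I|) : E -> R := monomial (enum_val i : I).
have me i : measurable_fun setT (e i) by exact: measurable_monomial.
have /choice[M MP] : forall i, exists M, forall x, cube c l x -> `|e i x| <= M.
  by move=> i; exact: monomial_bounded.
have eM i x : cube c l x -> `|e i x| <= \sum_j `|M j|.
  move=> cx; apply: le_trans (MP i x cx) _; apply: le_trans (ler_norm _) _.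
  by rewrite (bigD1 i)//= lerDl sumr_ge0.
have [v vP] := gram_solution mQ Qfin me eM fi.
suff ex : exists p : poly, (mpoly.msize p <= s.+1)%N /\
    forall m : mpoly.multinom n.+1, (mdeg m <= s)%N ->
    \int[lebesgue]_(x in cube c l) ((f x - peval p x) * monomial m x) = 0.
  exact: (xgetPex 0 ex).
exists (\sum_i v i *: mpolyX R (enum_val i : I)); split.
  apply: leq_trans (msize_sum _ _ _) _.
  apply/bigmax_leqP => i _; apply: leq_trans (msizeZ_le _ _) _.
  by rewrite msizeX; exact: bmdeg.
move=> m ms; have ms' : (mdeg m < s.+1)%N by [].
have := vP (enum_rank (BMultinom ms' : I)).
rewrite /e enum_rankK /= => <-.
apply: eq_Rintegral => x _; congr ((_ - _) * _).
rewrite /peval raddf_sum; apply: eq_bigr => i _.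
by rewrite /= mevalZ mevalX.
Qed.

End projection_bound.

(** * The stopping-time estimate *)

Section stopping_time.
Context {R : realType} {n : nat}.
Local Notation E := 'rV[R]_n.+1.
Implicit Types (c x : E) (l : R) (f g : E -> R).

Lemma L1loc_integrable f c l : L1loc f ->
  lebesgue.-integrable (cube c l) (EFin \o f).
Proof.
move=> [mf fK]; apply/integrableP; split.
  by apply/measurable_EFinP; exact: measurable_funTS.
by have := fK _ (@compact_cube R n c l).
Qed.

Definition mean c l g : R := l ^- n.+1 * \int[lebesgue]_(x in cube c l) g x.

Variables (s : nat) (f : E -> R).
Hypothesis fL : L1loc f.

Local Notation proj c l := (peval (poly_proj s (cube c l) f)).

Definition mean_osc c l : R := mean c l (fun x => `|f x - proj c l x|).

Fixpoint subcube_tree (k : nat) c l : seq (E * R) :=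
  (c, l) :: if k is k'.+1 then
    flatten [seq subcube_tree k' (subcorner c l e) (l / 2) |
      e <- index_enum {ffun 'I_n.+1 -> bool}] else [::].

Fixpoint leaf_error (k : nat) c l : R :=
  if k is k'.+1 then \sum_e leaf_error k' (subcorner c l e) (l / 2)
  else \int[lebesgue]_(x in cube c l) `|f x - proj c l x|.

Lemma subcube_tree_root k c l : (c, l) \in subcube_tree k c l.
Proof. by case: k => [|k]; rewrite /= inE eqxx. Qed.

Lemma subcube_tree_child k c l e (q : E * R) :
  q \in subcube_tree k (subcorner c l e) (l / 2) -> q \in subcube_tree k.+1 c l.
Proof.
move=> qt; rewrite /= inE; apply/orP; right; apply/flatten_mapP.
by exists e; rewrite // mem_index_enum.
Qed.

Lemma subcube_tree_sub k c l (q : E * R) : 0 < l -> q \in subcube_tree k c l ->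
  0 < q.2 /\ cube q.1 q.2 `<=` cube c l.
Proof.
elim: k c l => [|k IH] c l l0 /=.
  by rewrite inE => /eqP ->; split.
rewrite inE => /orP[/eqP ->|/flatten_mapP[e _ qt]]; first by split.
have l20 : 0 < l / 2 by rewrite divr_gt0.
have [q0 qs] := IH _ _ l20 qt; split => //.
by apply: subset_trans qs _; apply: subcorner_sub; exact: ltW.
Qed.

Lemma lebesgue_cube_fin c l : (lebesgue (cube c l) < +oo)%E.
Proof.
have [l0|l0] := leP 0 l; first by rewrite lebesgue_cube// ltry.
rewrite (_ : cube c l = set0); first by rewrite measure0.
by apply/seteqP; split => // x /(_ ord0) /=; lra.
Qed.

Lemma integrable_peval c l (p : mpoly.mpoly n.+1 R) :
  lebesgue.-integrable (cube c l) (EFin \o peval p).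
Proof.
have [B pB] := peval_bounded c l p; have mQ := measurable_cube c l.
have Qfin := lebesgue_cube_fin c l.
by apply: (integrable_bounded (M := B)) => //; exact: measurable_funTS (measurable_peval p).
Qed.

Lemma integrable_dev c l (p : mpoly.mpoly n.+1 R) :
  lebesgue.-integrable (cube c l) (EFin \o (fun x => `|f x - peval p x|)).
Proof.
apply: integrable_norm_real; apply: integrableB_real; first exact: measurable_cube.
  exact: L1loc_integrable.
exact: integrable_peval.
Qed.

Lemma mean_osc_int c l : 0 < l ->
  \int[lebesgue]_(x in cube c l) `|f x - proj c l x| = mean_osc c l * l ^+ n.+1.
Proof. by move=> l0; rewrite /mean_osc /mean mulrAC mulVf ?mul1r// expf_neq0// gt_eqF. Qed.

Lemma mean_osc_ge0 c l : 0 < l -> 0 <= mean_osc c l.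
Proof.
by move=> l0; rewrite mulr_ge0 ?invr_ge0 ?exprn_ge0 ?(ltW l0)//; exact: Rintegral_ge0.
Qed.

(* P_Q f - p is the projection of f - p. *)
Lemma proj_dev_bound : exists2 k : R, 0 < k &
  forall c l (p : mpoly.mpoly n.+1 R), 0 < l -> (mpoly.msize p <= s.+1)%N ->
  forall x, cube c l x ->
  `|proj c l x - peval p x| <= k * mean c l (fun x => `|f x - peval p x|).
Proof.
have [k k0 kP] := @projection_sup_bound R n s.
exists k => // c l p l0 ps x cx.
have [Ps orth] := poly_projP s l0 (L1loc_integrable c l fL).
rewrite -pevalB; apply: (kP _ _ _ (fun x => f x - peval p x)) => //.
- apply: leq_trans (msizeD_le _ _) _; rewrite geq_max Ps.
  by rewrite (leq_trans _ ps)// msizeN.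
- apply: integrableB_real; first exact: measurable_cube.
  + exact: L1loc_integrable.
  + exact: integrable_peval.
- move=> m ms; rewrite -[RHS](orth m ms); apply: eq_Rintegral => y _.
  by rewrite pevalB; congr (_ * _); ring.
Qed.

Section stopping_step.
Variables (k0 : R).
Hypotheses (k0_gt0 : 0 < k0)
  (k0_bound : forall c l (p : mpoly.mpoly n.+1 R), 0 < l ->
    (mpoly.msize p <= s.+1)%N -> forall x, cube c l x ->
    `|proj c l x - peval p x| <= k0 * mean c l (fun x => `|f x - peval p x|)).
Variables (h w G : E -> R) (H W : R).
Hypotheses (mh : measurable_fun setT h) (hH : forall x, 0 <= h x <= H).
Hypotheses (mw : measurable_fun setT w) (wW : forall x, 0 <= w x <= W).
Hypotheses (mG : measurable_fun setT G) (GW : forall x, 0 <= G x <= W).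

(** If the mean of |f - p| over a cube is at most 2 w0, its mean over a child is at most 2^d * 2 w0,
    so on the child P f differs from p by at most a w0. *)
Let a : R := k0 * (2 ^+ n.+1 * 2).

Let ih c l : lebesgue.-integrable (cube c l) (EFin \o h).
Proof.
have mQ := measurable_cube c l; have Qfin := lebesgue_cube_fin c l.
apply: (integrable_bounded (M := H) mQ Qfin) => [|x _]; first exact: measurable_funTS.
by rewrite ger0_norm; have /andP[] := hH x.
Qed.

Let iwG c l : lebesgue.-integrable (cube c l) (EFin \o (fun x => w x * G x)).
Proof.
have mQ := measurable_cube c l; have Qfin := lebesgue_cube_fin c l.
apply: (integrableM_bounded (M := W) mQ).
- apply: (integrable_bounded (M := W) mQ Qfin) => [|x _]; first exact: measurable_funTS.
  by rewrite ger0_norm; have /andP[] := wW x.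
- exact: measurable_funTS.
- by move=> x _; rewrite ger0_norm; have /andP[] := GW x.
Qed.

Let iph c l (p : mpoly.mpoly n.+1 R) :
  lebesgue.-integrable (cube c l) (EFin \o (fun x => `|f x - peval p x| * h x)).
Proof.
have mQ := measurable_cube c l.
apply: (integrableM_bounded (M := H) mQ); first exact: integrable_dev.
- exact: measurable_funTS.
- by move=> x _; rewrite ger0_norm; have /andP[] := hH x.
Qed.

Let D c l p := \int[lebesgue]_(x in cube c l) `|f x - peval p x|.
Let Dh c l p := \int[lebesgue]_(x in cube c l) (`|f x - peval p x| * h x).
Let Ih c l := \int[lebesgue]_(x in cube c l) h x.
Let IwG c l := \int[lebesgue]_(x in cube c l) (w x * G x).

Let Dh_change c l p (b : R) : 0 < l -> (mpoly.msize p <= s.+1)%N ->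
  D c l p <= b * l ^+ n.+1 ->
  Dh c l p <= Dh c l (poly_proj s (cube c l) f) + k0 * b * Ih c l.
Proof.
move=> l0 ps Db; have mQ := measurable_cube c l.
rewrite /Dh /Ih -RintegralZl// -RintegralD//; last exact: integrableZ_real.
apply: le_Rintegral => //; first exact: integrableD_real (integrableZ_real _ _ _).
move=> x cx; rewrite -mulrDl; apply: ler_wpM2r; first by have /andP[] := hH x.
have := k0_bound l0 ps cx.
have : mean c l (fun x => `|f x - peval p x|) <= b.
  by rewrite /mean mulrC ler_pdivrMr ?exprn_gt0.
move=> /(ler_wpM2l (ltW k0_gt0)) h1 h2.
have := ler_normD (f x - proj c l x) (proj c l x - peval p x).
rewrite addrA subrK; lra.
Qed.

Let Dh_leaf c l : Dh c l (poly_proj s (cube c l) f) <= H * leaf_error 0 c l.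
Proof.
have mQ := measurable_cube c l.
rewrite /Dh /= -RintegralZl//; last exact: integrable_dev.
apply: le_Rintegral => //; first by apply: integrableZ_real => //; exact: integrable_dev.
by move=> x _; rewrite mulrC ler_wpM2r//; have /andP[] := hH x.
Qed.

Let bound (k : nat) c l p (w0 h0 : R) : Prop :=
  Dh c l p <= a * w0 * Ih c l + 2 * a * IwG c l
    - 2 * a * h0 * (w0 * l ^+ n.+1 - D c l p / 2) + H * leaf_error k c l.

Let dominated (k : nat) c l :=
  (forall q, q \in subcube_tree k c l -> forall x, cube q.1 q.2 x ->
     mean_osc q.1 q.2 <= w x) /\
  (forall q, q \in subcube_tree k c l -> forall x, cube q.1 q.2 x ->
     mean q.1 q.2 h <= G x).

Let IwG_ge c l (w0 h0 : R) : 0 < l -> 0 <= w0 -> 0 <= h0 ->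
  (forall x, cube c l x -> w0 <= w x) -> (forall x, cube c l x -> h0 <= G x) ->
  w0 * h0 * l ^+ n.+1 <= IwG c l.
Proof.
move=> l0 w00 h00 w0w h0G; have mQ := measurable_cube c l.
have Qfin := lebesgue_cube_fin c l.
have -> : w0 * h0 * l ^+ n.+1 = \int[lebesgue]_(x in cube c l) (w0 * h0).
  by rewrite Rintegral_cst// -[X in _ = _ * X]/(vol (cube c l)) vol_cube// ltW.
apply: le_Rintegral => //.
  by apply: (integrable_bounded (M := `|w0 * h0|) mQ Qfin).
by move=> x cx; apply: ler_pM => //; [exact: w0w|exact: h0G].
Qed.

Let D_ge0 c l p : 0 <= D c l p.
Proof. exact: Rintegral_ge0. Qed.

Let a_ge0 : 0 <= a.
Proof. by rewrite !mulr_ge0 ?exprn_ge0// ltW. Qed.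

(* Either the mean of |f - p| over the cube is at most 2 w0, and the estimate is
   propagated to the subcubes, or the cube is a stopping cube: it is then used
   as its own reference, with P_Q f, its mean oscillation and its mean of h. *)
Let stopping_estimate (k : nat) c l p (w0 h0 : R) : 0 < l ->
  (mpoly.msize p <= s.+1)%N -> 0 <= w0 -> 0 <= h0 -> dominated k c l ->
  (forall x, cube c l x -> w0 <= w x) -> (forall x, cube c l x -> h0 <= G x) ->
  D c l p <= 2 * w0 * l ^+ n.+1 -> bound k c l p w0 h0.
Proof.
elim: k c l p w0 h0 => [|k IH] c l p w0 h0 l0 ps w00 h00 [domw domh] w0w h0G Dp.
  (* At depth 0, w0 h0 l^d <= [IwG] covers the negative part of the reserve term; the remaining a h0
     D is nonnegative. *)
  rewrite /bound.
  have := Dh_change l0 ps Dp; have := Dh_leaf c l.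
  have Ih0 : 0 <= Ih c l by apply: Rintegral_ge0 => x _; have /andP[] := hH x.
  have k2a : k0 * (2 * w0) * Ih c l <= a * w0 * Ih c l.
    apply: ler_wpM2r => //; rewrite mulrA; apply: ler_wpM2r => //.
    apply: ler_wpM2l; first exact: ltW.
    by rewrite ler_peMl// exprn_ege1// ler1n.
  have := IwG_ge l0 w00 h00 w0w h0G => /(ler_wpM2l a_ge0) IwGle.
  have := mulr_ge0 (mulr_ge0 a_ge0 h00) (D_ge0 c l p).
  by lra.
have l20 : 0 < l / 2 by rewrite divr_gt0.
have child e : Dh (subcorner c l e) (l / 2) p <=
    a * w0 * Ih (subcorner c l e) (l / 2) + 2 * a * IwG (subcorner c l e) (l / 2)
    - 2 * a * h0 * (w0 * (l / 2) ^+ n.+1 - D (subcorner c l e) (l / 2) p / 2)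
    + H * leaf_error k (subcorner c l e) (l / 2).
  set c' := subcorner c l e; set l' := l / 2.
  have c'c : cube c' l' `<=` cube c l by apply: subcorner_sub; exact: ltW.
  have l'E : l ^+ n.+1 = 2 ^+ n.+1 * l' ^+ n.+1.
    by rewrite -exprMn /l'; congr (_ ^+ _); field.
  have dom' : dominated k c' l'.
    by split=> q qt; [apply: domw|apply: domh]; exact: subcube_tree_child qt.
  have DD : D c' l' p <= D c l p.
    by apply: le_Rintegral_subset (integrable_dev c l p) => //; exact: measurable_cube.
  have [D2|D2] := leP (D c' l' p) (2 * w0 * l' ^+ n.+1).
    by apply: (IH c' l' p w0 h0) => // x /c'c; [exact: w0w|exact: h0G].
  (* Stopping child: the parent did not stop, so the child exceeds the threshold by a factor of at
     most 2^d. *)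
  have Dle : D c' l' p <= (2 ^+ n.+1 * 2 * w0) * l' ^+ n.+1.
    by move: DD Dp; rewrite l'E; lra.
  have l'0 : 0 < l' ^+ n.+1 by rewrite exprn_gt0.
  have := Dh_change l20 ps Dle.
  pose h' := mean c' l' h.
  have h'E : h' * l' ^+ n.+1 = Ih c' l'.
    by rewrite /h' /mean mulrAC mulVf ?mul1r// gt_eqF.
  have h'0 : 0 <= h'.
    rewrite mulr_ge0 ?invr_ge0 ?(ltW l'0)//; apply: Rintegral_ge0 => x _.
    by have /andP[] := hH x.
  have [Ps _] := poly_projP s l20 (L1loc_integrable c' l' fL).
  have o0 := mean_osc_ge0 c' l20.
  have oE := mean_osc_int c' l20.
  have := IH c' l' (poly_proj s (cube c' l') f) (mean_osc c' l') h' l20 Ps o0 h'0 dom'.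
  rewrite /bound /D oE -h'E.
  move=> /(_ (dom'.1 _ (subcube_tree_root _ _ _)) (dom'.2 _ (subcube_tree_root _ _ _))).
  have o1 : mean_osc c' l' * l' ^+ n.+1 <= 2 * mean_osc c' l' * l' ^+ n.+1.
    by rewrite -mulrA ler_peMl// ?ler1n// mulr_ge0// ltW.
  move=> /(_ o1) B1 B2.
  (* By the stopping condition, the reserve inherited from the parent is negative on this child. *)
  have : 0 <= a * h0 * (D c' l' p - 2 * w0 * l' ^+ n.+1).
    by rewrite mulr_ge0 ?(mulr_ge0 a_ge0)// subr_ge0 ltW.
  rewrite -/(D c' l' p); move: B1 B2; rewrite /a; lra.
have sumQ (g : E -> R) : lebesgue.-integrable (cube c l) (EFin \o g) ->
    \int[lebesgue]_(x in cube c l) g x =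
    \sum_e \int[lebesgue]_(x in cube (subcorner c l e) (l / 2)) g x.
  by move=> ig; exact: Rintegral_subcubes.
have vol_sum : l ^+ n.+1 = \sum_(e : {ffun 'I_n.+1 -> bool}) (l / 2) ^+ n.+1.
  rewrite sumr_const card_ffun card_bool card_ord -[RHS]mulr_natl natrX -exprMn.
  by congr (_ ^+ _); field.
rewrite /bound /D /Dh /Ih /IwG /= (sumQ _ (iph c l p)) (sumQ _ (ih c l)) (sumQ _ (iwG c l)).
rewrite (sumQ _ (integrable_dev c l p)) vol_sum !mulr_sumr !mulr_suml -sumrB.
rewrite !mulr_sumr -!big_split -sumrB -big_split /=.
apply: ler_sum => e _; apply: le_trans (child e) _.
by rewrite le_eqVlt; apply/orP; left; apply/eqP; rewrite /D /Dh /Ih /IwG; ring.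
Qed.

(** The root is taken as its own reference: its reserve cancels the term a w0 int h and leaves 2 a
    int w G. *)
Lemma dev_pairing_bound (k : nat) c l : 0 < l ->
  (forall q, q \in subcube_tree k c l -> forall x, cube q.1 q.2 x ->
     mean_osc q.1 q.2 <= w x) ->
  (forall q, q \in subcube_tree k c l -> forall x, cube q.1 q.2 x ->
     mean q.1 q.2 h <= G x) ->
  \int[lebesgue]_(x in cube c l) (`|f x - proj c l x| * h x) <=
    2 * (k0 * (2 ^+ n.+1 * 2)) * \int[lebesgue]_(x in cube c l) (w x * G x) +
    H * leaf_error k c l.
Proof.
move=> l0 domw domh.
have ld : 0 < l ^+ n.+1 by rewrite exprn_gt0.
have o0 := mean_osc_ge0 c l0; have oE := mean_osc_int c l0.
have hE : mean c l h * l ^+ n.+1 = Ih c l.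
  by rewrite /mean mulrAC mulVf ?mul1r// gt_eqF.
have h0 : 0 <= mean c l h.
  rewrite mulr_ge0 ?invr_ge0 ?(ltW ld)//; apply: Rintegral_ge0 => x _.
  by have /andP[] := hH x.
have [Ps _] := poly_projP s l0 (L1loc_integrable c l fL).
have := stopping_estimate l0 Ps o0 h0 (conj domw domh)
  (domw _ (subcube_tree_root _ _ _)) (domh _ (subcube_tree_root _ _ _)).
rewrite /bound /D oE -hE -/(IwG c l) -/a => B.
apply: le_trans (B _) _; first by rewrite -mulrA ler_peMl// ?ler1n// mulr_ge0// ltW.
by rewrite le_eqVlt; apply/orP; left; apply/eqP; field.
Qed.

End stopping_step.

Lemma leaf_error_ge0 (k : nat) c l : 0 <= leaf_error k c l.
Proof.
by elim: k c l => [|k IH] c l /=; [exact: Rintegral_ge0|apply: sumr_ge0 => e _].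
Qed.

Lemma leaf_error_le (k : nat) c l (b : R) : 0 < l ->
  (forall c', mean_osc c' (l / 2 ^+ k) <= b) -> leaf_error k c l <= b * l ^+ n.+1.
Proof.
elim: k c l => [|k IH] c l l0 ob.
  rewrite /= mean_osc_int//; apply: ler_wpM2r; first by rewrite exprn_ge0// ltW.
  by have := ob c; rewrite expr0 divr1.
have -> : b * l ^+ n.+1 = \sum_(e : {ffun 'I_n.+1 -> bool}) b * (l / 2) ^+ n.+1.
  rewrite sumr_const card_ffun card_bool card_ord -[RHS]mulr_natl natrX mulrCA -exprMn.
  by congr (_ * _ ^+ _); field.
rewrite /=; apply: ler_sum => e _; apply: IH => [|c']; first by rewrite divr_gt0.
have -> : l / 2 / 2 ^+ k = l / 2 ^+ k.+1 by rewrite exprS -mulrA -invfM.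
exact: ob.
Qed.

End stopping_time.

(** * Estimates in X *)

Section norm_estimates.
Context {R : realType} {n : nat}.
Local Notation E := 'rV[R]_n.+1.
Variable N : (E -> R) -> \bar R.
Hypothesis X_bbfs : ball_banach_function_space N.
Hypothesis M_bounded : maximal_bounded_on_assoc N.
Implicit Types (c x : E) (l : R) (f g h : E -> R).

Let kM : R := (2 * n.+2%:R) ^+ n.+1.

Let kM_gt0 : 0 < kM. Proof. by rewrite exprn_gt0// mulr_gt0// ltr0n. Qed.

Lemma mean_le_maximal h c l x : 0 < l -> measurable_fun setT h ->
  (forall y, 0 <= h y) -> lebesgue.-integrable (cube c l) (EFin \o h) ->
  cube c l x -> ((kM^-1 * mean c l h)%:E <= maximal h x)%E.
Proof.
move=> l0 mh h0 ih cx; apply: le_trans (le_maximal l0 mh cx).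
rewrite /mean mulrA -invfM -exprMn -/kM EFinM.
rewrite lee_pmul2l ?lte_fin ?invr_gt0 ?exprn_gt0 ?mulr_gt0 ?ltr0n//.
rewrite /Rintegral fineK; last first.
  by apply: integrable_fin_num ih; exact: measurable_cube.
rewrite le_eqVlt; apply/orP; left; apply/eqP; apply: eq_integral => y _.
by rewrite /= ger0_norm.
Qed.

Lemma maximal_ge0 h x : measurable_fun setT h -> (0 <= maximal h x)%E.
Proof.
move=> mh; have xx : cube x 1 x by move=> i; rewrite lexx lerDl ler01.
apply: le_trans (le_maximal ltr01 mh xx); apply: mule_ge0.
  by rewrite lee_fin invr_ge0 exprn_ge0// mulr1 mulr_ge0.
by apply: integral_ge0.
Qed.

Lemma assoc_normZ_ge (a : R) h : 0 < a -> measurable_fun setT h ->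
  (a%:E * assoc_norm N (EFin \o h) <= assoc_norm N (EFin \o (fun x => a * h x)%R))%E.
Proof.
move=> a0 mh; rewrite -lee_pdivlMl//; apply: ge_ereal_sup => _ [g [Xg g1] <-].
rewrite lee_pdivlMl//; apply: le_trans (assoc_norm_ge _ Xg g1).
have mhg : measurable_fun setT (fun x => `|(h x)%:E * (g x)%:E|%E).
  apply/measurable_EFinP.
  exact: (measurableT_comp (@normr_measurable R setT) (measurable_funM mh (proj1 Xg))).
rewrite -ge0_integralZl//; last by rewrite lee_fin ltW.
rewrite le_eqVlt; apply/orP; left; apply/eqP; apply: eq_integral => x _.
by rewrite /= -mulrA [in RHS]normrM (gtr0_norm a0).
Qed.

Lemma cube_in_assoc c l : 0 < l -> assoc_space N \1_(cube c l).
Proof.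
move=> l0; apply: (assoc_space_bounded X_bbfs (c := c) (l := l) (M := 1) l0).
  by apply: measurable_indic; exact: measurable_cube.
by move=> x; rewrite mul1r indicE ler0n lexx.
Qed.

Lemma cube_pairing_le c l : 0 < l ->
  ((l ^+ n.+1)%:E <= assoc_norm N (EFin \o \1_(cube c l)) * N \1_(cube c l))%E.
Proof.
move=> l0; have m1 : measurable_fun setT (\1_(cube c l) : E -> R).
  by apply: measurable_indic; exact: measurable_cube.
apply: le_trans (integral_mul_le_norms X_bbfs m1 (indic_cube_in_space X_bbfs c l0)).
rewrite -(@lebesgue_cube _ _ c); last exact: ltW.
rewrite -[X in (lebesgue X <= _)%E]setIT.
rewrite -(@integral_indic _ _ _ lebesgue setT)//; last exact: measurable_cube.
rewrite le_eqVlt; apply/orP; left; apply/eqP; apply: eq_integral => x _.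
by rewrite indicE; case: (_ \in _); rewrite ?mulr1 ?mulr0 ?normr1 ?normr0.
Qed.

(** For h >= 0 supported in Q, the mean of h times 1_Q is at most [kM] times the maximal function of
    h. Taking associate norms bounds this mean by a multiple of |h|_X' / |1_Q|_X'; duality turns
    this into a bound on |1_Q|_X. *)
Lemma cube_norm_duality : exists2 C : R, 0 < C & forall c l, 0 < l ->
  (N \1_(cube c l) * assoc_norm N (EFin \o \1_(cube c l)) <= (C * l ^+ n.+1)%:E)%E.
Proof.
have [CM [CM0 HM]] := maximal_assoc_bound X_bbfs M_bounded.
exists (CM * kM); first by rewrite mulr_gt0.
move=> c l l0; have mQ := measurable_cube c l.
have [m1 fin'] := cube_in_assoc c l0.
set N' := assoc_norm N _ in fin' *.
have ld : 0 < l ^+ n.+1 by rewrite exprn_gt0.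
have N'0 : (0 <= N')%E by exact: assoc_norm_ge0.
have N'f : N' \is a fin_num by rewrite ge0_fin_numE.
have r0 : 0 < fine N'.
  rewrite fine_gt0// fin' andbT lt0e N'0 andbT; apply/eqP => N'z.
  by have := cube_pairing_le c l0; rewrite -/N' N'z mul0e lee_fin leNgt ld.
rewrite -(fineK N'f) muleC -lee_pdivlMl// -EFinM.
apply: (lorentz_luxemburg X_bbfs mQ) => //.
- by rewrite lebesgue_cube ?ltry// ltW.
- by move=> x cx; rewrite indicE memNset.
- by rewrite !mulr_gt0// invr_gt0.
move=> h M mh hM hfin.
have Xh : assoc_space N h by [].
have h0 x : 0 <= h x by have /andP[] := hM x.
have ih : lebesgue.-integrable (cube c l) (EFin \o h).
  apply: (integrable_bounded (M := `|M|) mQ (lebesgue_cube_fin c l)).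
  - exact: measurable_funTS.
  - move=> x cx; rewrite ger0_norm//; have /andP[_ /le_trans] := hM x; apply.
    by rewrite indicE mem_set// mulr1 ler_norm.
rewrite (@eq_integral _ _ _ _ _ (EFin \o h)); last first.
  by move=> x; rewrite inE => cx; rewrite /= indicE mem_set// normr1 mul1r.
rewrite -(fineK (integrable_fin_num mQ ih)) -/(Rintegral _ _ h).
have -> : Rintegral lebesgue (cube c l) h = mean c l h * l ^+ n.+1.
  by rewrite /mean mulrAC mulVf ?mul1r// gt_eqF.
have m0 : 0 <= mean c l h.
  by rewrite mulr_ge0 ?invr_ge0 ?(ltW ld)//; exact: Rintegral_ge0.
(* The mean is pulled out of the associate norm as a scalar factor, which has to be positive. *)
have [mz|mz] := eqVneq (mean c l h) 0.
  rewrite mz mul0r mule_ge0 ?assoc_norm_ge0// lee_fin.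
  by rewrite !mulr_ge0 ?invr_ge0 ?(ltW CM0) ?(ltW kM_gt0) ?(ltW ld) ?(ltW r0).
have mp : 0 < kM^-1 * mean c l h by rewrite mulr_gt0 ?invr_gt0// lt0r mz.
have : (assoc_norm N (EFin \o (fun x => (kM^-1 * mean c l h) * \1_(cube c l) x)%R) <=
    CM%:E * assoc_norm N (EFin \o h))%E.
  apply: HM => // x; first by rewrite mulr_ge0// ltW.
  rewrite indicE; have [cx|cx] := boolP (x \in cube c l).
    by rewrite mulr1; apply: mean_le_maximal => //; rewrite inE in cx.
  by rewrite mulr0; exact: maximal_ge0.
move=> /(le_trans (assoc_normZ_ge mp m1)); rewrite -/N' -(fineK N'f).
have hf : assoc_norm N (EFin \o h) \is a fin_num.
  by rewrite ge0_fin_numE// assoc_norm_ge0.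
rewrite -(fineK hf) -!EFinM !lee_fin => le1.
have rk : 0 < fine N' * kM^-1 by rewrite mulr_gt0// invr_gt0.
rewrite -(ler_pM2l rk).
have -> : fine N' * kM^-1 * (mean c l h * l ^+ n.+1) =
  kM^-1 * mean c l h * fine N' * l ^+ n.+1 by ring.
have -> : fine N' * kM^-1 *
    ((fine N')^-1 * (CM * kM * l ^+ n.+1) * fine (assoc_norm N (EFin \o h))) =
   CM * fine (assoc_norm N (EFin \o h)) * l ^+ n.+1.
  by field; rewrite !gt_eqF.
by apply: ler_wpM2r => //; exact: ltW.
Qed.

Lemma osc_le_oscX (alpha : R) : exists2 C : R, 0 < C & forall f c l, L1loc f ->
  0 < l -> (osc alpha f (cube c l) <= C%:E * oscX alpha N f (cube c l))%E.
Proof.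
have [C C0 HC] := cube_norm_duality.
exists C => // f c l fL l0.
have mQ := measurable_cube c l.
have ld : 0 < l ^+ n.+1 by rewrite exprn_gt0.
rewrite /osc /oscX (vol_cube c (ltW l0)).
set p := poly_proj _ _ _; set v := l ^+ n.+1 in ld *.
have m1 : measurable_fun setT (\1_(cube c l) : E -> R) by exact: measurable_indic.
have X1 := indic_cube_in_space X_bbfs c l0.
have N1 := norm_cube_gt0 X_bbfs c l0.
have [_ N'f] := cube_in_assoc c l0.
have N'0 := assoc_norm_ge0 X_bbfs (EFin \o \1_(cube c l)).
pose D x := (f x - peval p x) * \1_(cube c l) x.
have mD : measurable_fun setT D.
  exact: (measurable_funM (measurable_funB (proj1 fL) (measurable_peval p)) m1).
rewrite -/D; have v0 a : 0 < v `^ a by rewrite powR_gt0.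
(* The deviation may lie outside X; the right-hand side is then infinite. *)
have [Nfin|Ninf] := boolP (N D \is a fin_num); last first.
  rewrite (_ : N D = +oo%E); last first.
    by apply/eqP; rewrite -leye_eq leNgt -ge0_fin_numE// (space_norm_ge0 X_bbfs).
  by rewrite gt0_muley ?lte_fin ?divr_gt0// gt0_muley ?lte_fin// leey.
have XD : fspace N D by split => //; rewrite -ge0_fin_numE// (space_norm_ge0 X_bbfs).
have := integral_mul_le_norms X_bbfs m1 XD.
rewrite (@integral_support _ _ _ _ (cube c l)); last first.
  by move=> x cx; rewrite /D indicE memNset// mulr0 mul0r normr0.
rewrite (@eq_integral _ _ _ _ _ (fun x => `|f x - peval p x|%:E)); last first.
  by move=> x; rewrite inE => cx; rewrite /D indicE mem_set// mulr1 mul1r.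
have := HC c l l0; rewrite -/v.
rewrite -(fineK (space_norm_fin X_bbfs X1)) -(fineK Nfin).
rewrite -(fineK (_ : assoc_norm N (EFin \o \1_(cube c l)) \is a fin_num)) ?ge0_fin_numE//.
set a := fine _; set b := fine _; set e := fine _.
rewrite -!EFinM lee_fin => dual le1.
apply: le_trans (lee_wpmul2l _ le1) _; first by rewrite lee_fin ltW.
rewrite -!EFinM lee_fin.
have a0 : 0 < a by [].
have e0 : 0 <= e by rewrite fine_ge0// (space_norm_ge0 X_bbfs).
have b0 : 0 <= b by rewrite fine_ge0.
rewrite powRD ?(gt_eqF ld) ?implybT// powR_inv1 ?(ltW ld)//.
have -> : C * (v `^ (- (alpha / n.+1%:R)) / a * e) =
    v `^ (- (alpha / n.+1%:R)) * ((C * v) / a * e * v^-1).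
  by field; rewrite !gt_eqF.
have -> : v^-1 * v `^ (- (alpha / n.+1%:R)) * (b * e) =
    v `^ (- (alpha / n.+1%:R)) * (b * e * v^-1) by ring.
apply: ler_wpM2l; first exact: ltW.
apply: ler_wpM2r; first by rewrite invr_ge0 ltW.
by apply: ler_wpM2r => //; rewrite ler_pdivlMr// mulrC.
Qed.

(** G is the maximum, over the finitely many cubes of the tree, of the mean of h on those containing
    x. The factor [kM] passes from means over cubes to means over centered balls. *)
Lemma tree_maximal (k : nat) c l h (M : R) : 0 < l -> 0 <= M -> measurable_fun setT h ->
  (forall x, 0 <= h x <= M) -> exists G : E -> R, [/\ measurable_fun setT G,
    (forall x, 0 <= G x <= M), (forall x, (kM^-1 * G x)%:E <= maximal h x)%E &
    forall q, q \in subcube_tree k c l -> forall x, cube q.1 q.2 x ->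
      mean q.1 q.2 h <= G x].
Proof.
move=> l0 M0 mh hM.
have h0 x : 0 <= h x by have /andP[] := hM x.
have ih c' l' : lebesgue.-integrable (cube c' l') (EFin \o h).
  apply: (integrable_bounded (M := M) (measurable_cube c' l') (lebesgue_cube_fin c' l')).
    exact: measurable_funTS.
  by move=> x _; rewrite ger0_norm; have /andP[] := hM x.
have mean0 c' l' : 0 < l' -> 0 <= mean c' l' h <= M.
  move=> l'0; have ld : 0 < l' ^+ n.+1 by rewrite exprn_gt0.
  rewrite mulr_ge0 ?invr_ge0 ?(ltW ld) ?Rintegral_ge0//=.
  rewrite /mean mulrC ler_pdivrMr// -(vol_cube c' (ltW l'0)) /vol.
  rewrite -(Rintegral_cst lebesgue (measurable_cube c' l')).
  apply: le_Rintegral => //; first exact: measurable_cube.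
    apply: (integrable_bounded (M := M) (measurable_cube c' l') (lebesgue_cube_fin c' l')) => //.
    by move=> x _; rewrite ger0_norm.
  by move=> x _; have /andP[] := hM x.
pose t := subcube_tree k c l.
(* The test of membership makes the bounds hold for every q, in particular when [q.2] is not
   positive. *)
pose term (q : E * R) x := if q \in t then mean q.1 q.2 h * \1_(cube q.1 q.2) x else 0.
have term_bounds q x : 0 <= term q x <= M.
  rewrite /term; case: ifPn => [qt|_]; last by rewrite lexx.
  have [q0 _] := subcube_tree_sub l0 qt.
  have /andP[m0 mM] := mean0 q.1 q.2 q0.
  by rewrite indicE; case: (_ \in _); rewrite ?mulr1 ?mulr0 ?lexx// m0.
have term_max q x : ((kM^-1 * term q x)%:E <= maximal h x)%E.
  rewrite /term; case: ifPn => [qt|_]; last by rewrite mulr0 maximal_ge0.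
  have [q0 _] := subcube_tree_sub l0 qt.
  rewrite indicE; have [qx|qx] := boolP (x \in cube q.1 q.2).
    by rewrite mulr1; apply: mean_le_maximal => //; rewrite inE in qx.
  by rewrite !mulr0 maximal_ge0.
exists (fun x => \big[Num.max/0]_(q <- t) term q x); split.
- have mterm q : measurable_fun setT (term q).
    rewrite /term; case: (q \in t); last exact: measurable_cst.
    apply: (measurable_funM (measurable_cst _)); apply: measurable_indic.
    exact: measurable_cube.
  elim: {1}t => [|q r IH].
    rewrite (_ : (fun x => _) = cst 0); first exact: measurable_cst.
    by apply/funext => x; rewrite big_nil.
  rewrite (_ : (fun x => _) =
    (fun x => Num.max (term q x) (\big[Num.max/0]_(q <- r) term q x))).
    exact: measurable_maxr.
  by apply/funext => x; rewrite big_cons.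
- move=> x; elim/big_ind : _ => [|y z /andP[y0 yM] /andP[z0 zM]|q _] //.
  + by rewrite lexx.
  + by rewrite le_max y0 ge_max yM zM.
- move=> x; elim/big_ind : _ => [|y z yM zM|q _] //.
  + by rewrite mulr0 maximal_ge0.
  + by case: (leP y z).
- move=> q qt x qx.
  apply: (@le_trans _ _ (term q x)).
    by rewrite /term qt indicE mem_set// mulr1.
  exact: (le_bigmax_seq 0 q xpredT (fun q => term q x) qt).
Qed.

(** By duality and the stopping-time estimate, it suffices to bound int w G with w = w1 + w2 1_B,
    and this is at most |w 1_Q|_X |G|_X'. The two alternatives for the mean oscillation say that w
    dominates it on every subcube. *)
Lemma dev_norm_bound (s : nat) f : L1loc f -> exists2 C : R, 0 < C &
  forall c l (w1 w2 : R) (B : set E), 0 < l -> 0 < w1 -> 0 <= w2 -> measurable B ->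
  (forall c' l', 0 < l' -> cube c' l' `<=` cube c l ->
    mean_osc s f c' l' <= w1 \/
    cube c' l' `<=` B /\ mean_osc s f c' l' <= w1 + w2) ->
  (forall e : R, 0 < e -> exists k, leaf_error s f k c l <= e) ->
  (N (fun x => (f x - peval (poly_proj s (cube c l) f) x) * \1_(cube c l) x)%R <=
    (C * (w1 * fine (N \1_(cube c l)) + w2 * fine (N \1_(B `&` cube c l))))%:E)%E.
Proof.
move=> fL; have [k0 k00 k0P] := proj_dev_bound s fL.
have [CM [CM0 HM]] := maximal_assoc_bound X_bbfs M_bounded.
pose a := 2 * (k0 * (2 ^+ n.+1 * 2)).
have a0 : 0 < a by rewrite !mulr_gt0// exprn_gt0.
(* The factors come from the stopping time, from the comparison of cubes with balls, and from the
   maximal operator. *)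
exists (a * kM * CM); first by rewrite !mulr_gt0.
move=> c l w1 w2 B l0 w10 w20 mB osc_w leaf.
have mQ := measurable_cube c l; have Qfin := lebesgue_cube_fin c l.
have X1 := indic_cube_in_space X_bbfs c l0.
have N1 := norm_cube_gt0 X_bbfs c l0.
have mBQ : measurable_fun setT (\1_(B `&` cube c l) : E -> R).
  by apply: measurable_indic; exact: measurableI.
have XBQ : fspace N \1_(B `&` cube c l).
  apply: (fspace_le X_bbfs X1 mBQ) => x; rewrite !indicE in_setI.
  by case: (x \in B); rewrite /= ?normr0.
have NBQ0 : 0 <= fine (N \1_(B `&` cube c l)).
  by rewrite fine_ge0// (space_norm_ge0 X_bbfs).
set A := w1 * _ + _.
have A0 : 0 < A by rewrite ltr_pwDl// ?mulr_gt0// mulr_ge0.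
set p := poly_proj _ _ _.
have mf : measurable_fun setT f by exact: (proj1 fL).
have m1 : measurable_fun setT (\1_(cube c l) : E -> R) by exact: measurable_indic.
apply: (lorentz_luxemburg X_bbfs mQ Qfin).
- exact: (measurable_funM (measurable_funB mf (measurable_peval p)) m1).
- by move=> x cx; rewrite indicE memNset// mulr0.
- by rewrite mulr_gt0// !mulr_gt0.
move=> h M0 mh hM0 hfin.
pose M := `|M0|.
have hM x : 0 <= h x <= M.
  have /andP[-> /le_trans] := hM0 x; apply; rewrite indicE /M.
  by case: (_ \in _); rewrite ?mulr1 ?mulr0 ?ler_norm.
have hf : assoc_norm N (EFin \o h) \is a fin_num.
  by rewrite ge0_fin_numE// assoc_norm_ge0.
have ih : lebesgue.-integrable (cube c l) (EFin \o (fun x => `|f x - peval p x| * h x)).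
  apply: (integrableM_bounded (M := M) mQ); first exact: integrable_dev.
  - exact: measurable_funTS.
  - by move=> x _; rewrite ger0_norm; have /andP[] := hM x.
rewrite (@eq_integral _ _ _ _ _ (EFin \o (fun x => `|f x - peval p x| * h x))); last first.
  by move=> x; rewrite inE => cx; rewrite /= indicE mem_set// mulr1.
rewrite -(fineK (integrable_fin_num mQ ih)) -(fineK hf) -EFinM lee_fin.
rewrite -/(Rintegral _ _ (fun x => `|f x - peval p x| * h x)).
(* The depth k is chosen after h, so that the leaf error times the bound of h is at most eta. *)
apply/ler_addgt0Pr => eta eta0.
have M10 : 0 < M + 1 by rewrite ltr_wpDl ?normr_ge0.
have [k leafk] := leaf (eta / (M + 1)) (divr_gt0 eta0 M10).
have [G [mG GM Gmax Gdom]] := tree_maximal k c l0 (normr_ge0 M0) mh hM.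
pose w x := w1 + w2 * \1_B x.
have mw : measurable_fun setT w.
  apply: (measurable_funD (measurable_cst _)).
  by apply: (measurable_funM (measurable_cst _)); exact: measurable_indic.
have w_ge x : w1 <= w x by rewrite /w lerDl mulr_ge0// indicE ler0n.
pose W := w1 + w2 + M.
have wW x : 0 <= w x <= W.
  apply/andP; split; first exact: le_trans (ltW w10) (w_ge x).
  rewrite /W /w -addrA lerD2l; have := normr_ge0 M0; rewrite -/M => M0'.
  by rewrite indicE; case: (_ \in _); rewrite ?mulr1 ?mulr0; lra.
have GW x : 0 <= G x <= W.
  have /andP[-> /= /le_trans] := GM x; apply.
  by rewrite /W lerDr addr_ge0// ltW.
have domw q : q \in subcube_tree k c l -> forall x, cube q.1 q.2 x ->
    mean_osc s f q.1 q.2 <= w x.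
  move=> qt x qx; have [q0 qs] := subcube_tree_sub l0 qt.
  have [le1|[qB le2]] := osc_w _ _ q0 qs; first exact: le_trans le1 (w_ge x).
  by apply: le_trans le2 _; rewrite /w indicE mem_set ?mulr1//; exact: qB.
have est := dev_pairing_bound fL k00 k0P mh hM mw wW mG GW l0 domw Gdom.
apply: le_trans est _; apply: lerD; last first.
  apply: (@le_trans _ _ ((M + 1) * leaf_error s f k c l)).
    by apply: ler_wpM2r; rewrite ?leaf_error_ge0// lerDl.
  by rewrite mulrC -ler_pdivlMr.
rewrite -/a.
pose g x := w1 * \1_(cube c l) x + w2 * \1_(B `&` cube c l) x.
have gE x : cube c l x -> g x = w x.
  move=> cx; rewrite /g /w !indicE in_setI (mem_set cx) andbT mulr1.
  by [].
have Ng : (N g <= A%:E)%E.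
  apply: le_trans (bb_triangle X_bbfs (fspaceZ X_bbfs _ X1) (fspaceZ X_bbfs _ XBQ)) _.
  rewrite !(bqb_homogeneous (bb_quasi X_bbfs))// !ger0_norm ?(ltW w10)//.
  by rewrite -(fineK (space_norm_fin X_bbfs X1)) -(fineK (space_norm_fin X_bbfs XBQ)).
have mg : measurable_fun setT g by apply: measurable_funD; apply: measurable_funM.
have Xg : fspace N g by split => //; apply: le_lt_trans Ng _; rewrite ltry.
have mG' : measurable_fun setT (fun x => kM^-1 * G x) by exact: measurable_funM.
have G'0 x : 0 <= kM^-1 * G x.
  by rewrite mulr_ge0 ?invr_ge0 ?(ltW kM_gt0)//; have /andP[] := GM x.
have g0 x : 0 <= g x.
  by rewrite addr_ge0// mulr_ge0 ?(ltW w10)// indicE ler0n.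
have NG' := HM h (fun x => kM^-1 * G x) (conj mh hfin) G'0 Gmax.
have := integral_mul_le_norms X_bbfs mG' Xg.
rewrite (@integral_support _ _ _ _ (cube c l)); last first.
  move=> x cx; rewrite /g !indicE in_setI memNset//= andbF !mulr0 addr0.
  by rewrite mulr0 normr0.
rewrite (@eq_integral _ _ _ _ _ (EFin \o (fun x => kM^-1 * (w x * G x)))); last first.
  move=> x; rewrite inE => cx; rewrite /= ger0_norm; last exact: mulr_ge0.
  by rewrite gE//; congr EFin; ring.
have iwG : lebesgue.-integrable (cube c l) (EFin \o (fun x => w x * G x)).
  apply: (integrableM_bounded (M := W) mQ).
  - apply: (integrable_bounded (M := W) mQ Qfin) => [|x _]; first exact: measurable_funTS.
    by rewrite ger0_norm; have /andP[] := wW x.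
  - exact: measurable_funTS.
  - by move=> x _; rewrite ger0_norm; have /andP[] := GW x.
have iwG' := integrableZ_real (kM^-1) mQ iwG.
rewrite -(fineK (integrable_fin_num mQ iwG')).
rewrite -[fine _]/(Rintegral _ _ (fun x => kM^-1 * (w x * G x))) RintegralZl//.
move=> /le_trans/(_ (lee_wpmul2l (assoc_norm_ge0 X_bbfs _) Ng)).
move=> /le_trans/(_ (lee_wpmul2r _ NG')); rewrite lee_fin (ltW A0) => /(_ erefl).
rewrite -(fineK hf) -!EFinM lee_fin => le1.
have le2 : \int[lebesgue]_(x in cube c l) (w x * G x) <=
    kM * (CM * fine (assoc_norm N (EFin \o h)) * A).
  by rewrite -ler_pdivrMl//; exact: le1.
have := ler_wpM2l (ltW a0) le2; move/le_trans; apply => /=.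
by rewrite le_eqVlt; apply/orP; left; apply/eqP; ring.
Qed.

Lemma cube_sub_doubled (b y : E) (r u : R) : r <= u -> cube b r y ->
  cube b r `<=` cube (y - const_mx u) (2 * u).
Proof.
move=> ru By z Bz i; have := Bz i; have := By i; rewrite !mxE.
by move=> /andP[? ?] /andP[? ?]; apply/andP; split; lra.
Qed.

Lemma homothetic_cube_sub_doubled c l (y : E) (t : R) : 0 <= t -> cube c l y ->
  cube ((1 - t) *: y + t *: c) (t * l) `<=` cube (y - const_mx (t * l)) (2 * (t * l)).
Proof.
move=> t0 Qy x xj i; have := xj i; have := Qy i; rewrite !mxE.
move=> /andP[q1 q2] /andP[x1 x2].
have e1 : 0 <= t * (y ord0 i - c ord0 i) by rewrite mulr_ge0// subr_ge0.
have e2 : 0 <= t * (c ord0 i + l - y ord0 i) by rewrite mulr_ge0// subr_ge0.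
by apply/andP; split; lra.
Qed.

(* With cubes Q_j of side r 2^j containing y, the function
   G = sum_j g_j / 2 1_(Q_j), g_j comparable to 2^(- j d), is dominated by the
   maximal function of the indicator of cube b r since g_(j+1) <= g_j / 2,
   whereas every term has the same integral. *)
Lemma norm_cube_unbounded (b : E) (r T : R) : 0 < r -> exists2 L : R, 0 < L &
  forall c l y, L <= l -> cube b r y -> cube c l y -> T <= fine (N \1_(cube c l)).
Proof.
move=> r0.
have [CM [CM0 HM]] := maximal_assoc_bound X_bbfs M_bounded.
pose B := cube b r; pose h : E -> R := \1_B.
have Xh : assoc_space N h by exact: cube_in_assoc.
have [mh hfin] := Xh.
have hf : assoc_norm N (EFin \o h) \is a fin_num.
  by rewrite ge0_fin_numE// assoc_norm_ge0.
pose n' := fine (assoc_norm N (EFin \o h)).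
have n'0 : 0 <= n' by rewrite fine_ge0// assoc_norm_ge0.
(* Up to [kM], g_j is the mean of the indicator of [cube b r] over a cube of side 2 r 2^j containing
   it. *)
pose g (j : nat) : R := kM^-1 * ((2 ^+ j.+1) ^+ n.+1)^-1.
have g0 j : 0 < g j by rewrite mulr_gt0 ?invr_gt0 ?exprn_gt0.
have g_half j : g j.+1 <= g j / 2.
  rewrite /g -mulrA ler_pM2l ?invr_gt0// -invfM lef_pV2 ?posrE ?mulr_gt0 ?exprn_gt0//.
  rewrite [2 ^+ j.+2]exprS exprMn mulrC ler_pM2r ?exprn_gt0//.
  by rewrite exprS ler_peMr// exprn_ege1// ler1n.
(* The common integral of the terms g_j / 2 1_(Q_j). *)
pose eta : R := kM^-1 * (r / 2) ^+ n.+1 / 2.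
have eta0 : 0 < eta by rewrite !mulr_gt0 ?invr_gt0 ?exprn_gt0 ?divr_gt0.
have [m m_gt0 mT] : exists2 m : nat, (0 < m)%N & `|T| * (CM * n') <= m%:R * eta.
  exists (Num.truncn (`|T| * (CM * n') / eta)).+1 => //.
  by rewrite -ler_pdivrMr// ltW// truncnS_gt.
exists (r * 2 ^+ m); first by rewrite mulr_gt0// exprn_gt0.
move=> c l y lL By Qy.
have l0 : 0 < l by apply: lt_le_trans lL; rewrite mulr_gt0// exprn_gt0.
pose t (j : nat) := r * 2 ^+ j / l.
(* Image of the large cube under the homothety of center y that gives it side r 2^j; it stays inside
   the large cube when j < m. *)
pose Qj j := cube ((1 - t j) *: y + t j *: c) (t j * l).
have t0 j : 0 < t j by rewrite divr_gt0// mulr_gt0// exprn_gt0.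
have t1 j : (j < m)%N -> t j <= 1.
  move=> jm; rewrite /t ler_pdivrMr// mul1r; apply: le_trans lL.
  by rewrite ler_pM2l// ler_eXn2l ?ltr1n// ltnW.
have tl j : t j * l = r * 2 ^+ j by rewrite /t -mulrA mulVf ?mulr1// gt_eqF.
have QjQ j : (j < m)%N -> Qj j `<=` cube c l.
  by move=> jm; apply: homothetic_cube_sub => //; rewrite (ltW (t0 j)) t1.
have Qj_max j x : Qj j x -> ((g j)%:E <= maximal h x)%E.
  move=> xj; pose D := cube (y - const_mx (r * 2 ^+ j)) (2 * (r * 2 ^+ j)).
  have rj : r <= r * 2 ^+ j by rewrite ler_peMr ?(ltW r0)// exprn_ege1// ler1n.
  have BD : B `<=` D.
    exact: cube_sub_doubled.
  have Dx : D x.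
    by rewrite /D -tl; apply: homothetic_cube_sub_doubled xj => //; exact: ltW.
  have D0 : 0 < 2 * (r * 2 ^+ j) by rewrite !mulr_gt0// exprn_gt0.
  have iD : lebesgue.-integrable D (EFin \o h).
    apply: (integrable_bounded (M := 1) (measurable_cube _ _) (lebesgue_cube_fin _ _)).
      exact: measurable_funTS.
    by move=> z _; rewrite /h indicE ger0_norm ?ler0n// lern1 leq_b1.
  have := mean_le_maximal D0 mh (fun z => ltac:(by rewrite /h indicE ler0n)) iD Dx.
  rewrite (_ : kM^-1 * mean _ _ h = g j)//; rewrite /g /mean; congr (_ * _).
  rewrite /Rintegral integral_indic//; [|exact: measurable_cube|exact: measurable_cube].
  rewrite (_ : B `&` _ = B); last by apply/setIidl.
  rewrite [X in fine X]lebesgue_cube ?(ltW r0)//= -!exprVn -exprMn; congr (_ ^+ _).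
  by rewrite exprVn exprS; field; rewrite expf_neq0// gt_eqF.
pose G x := \sum_(j < m) g j / 2 * \1_(Qj j) x.
have mQj j : measurable_fun setT (\1_(Qj j) : E -> R).
  by apply: measurable_indic; exact: measurable_cube.
have mG : measurable_fun setT G.
  by apply: measurable_sum => j; apply: measurable_funM.
have G0 x : 0 <= G x.
  by apply: sumr_ge0 => j _; rewrite mulr_ge0 ?indicE ?ler0n// divr_ge0// ltW.
have G_max x : ((G x)%:E <= maximal h x)%E.
  (* Telescoping: g_j / 2 <= g_j - g_(j+1), so the terms present at x add up to at most g_i - g_m,
     with i the first index such that x is in Q_i. *)
  have : G x = 0 \/ exists2 i, Qj i x & G x <= g i - g m.
    rewrite /G; elim: (m) => [|k IH]; first by left; rewrite big_ord0.
    rewrite big_ord_recr /= indicE; have [xk|xk] := boolP (x \in Qj k); last first.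
      rewrite mulr0 addr0; case: IH => [->|[i xi le]]; [by left|right; exists i => //].
      by have := g_half k; have := g0 k; lra.
    rewrite mulr1; right; have := g_half k; have := g0 k; case: IH => [->|[i xi le]].
      by exists k; [rewrite inE in xk|lra].
    by exists i => //; lra.
  case=> [->|[i xi le]]; first exact: maximal_ge0.
  apply: le_trans (Qj_max i x xi); rewrite lee_fin.
  by have := g0 m; lra.
have NG := HM h G Xh G0 G_max.
have X1 := indic_cube_in_space X_bbfs c l0.
have := integral_mul_le_norms X_bbfs mG X1.
have -> : (\int[lebesgue]_x `|G x * \1_(cube c l) x|%:E = (m%:R * eta)%:E)%E.
  transitivity (\int[lebesgue]_x (\sum_(j < m) (g j / 2 * \1_(Qj j) x)%:E))%E.
    apply: eq_integral => x _; rewrite ger0_norm ?mulr_ge0 ?indicE ?ler0n//.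
    rewrite sumEFin; congr EFin; have [cx|cx] := boolP (x \in cube c l).
      by rewrite mulr1.
    rewrite mulr0; apply/esym/big1 => j _; rewrite indicE memNset ?mulr0// => xj.
    by move: cx; rewrite (mem_set (QjQ j (ltn_ord j) x xj)).
  rewrite ge0_integral_sum//; first last.
  - by move=> j x _; rewrite lee_fin mulr_ge0 ?indicE ?ler0n// divr_ge0// ltW.
  - by move=> j; apply/measurable_EFinP; apply: measurable_funM.
  rewrite (eq_bigr (fun=> eta%:E)); last first.
    move=> j _; under eq_integral do rewrite EFinM.
    rewrite ge0_integralZl//; first last.
    - by rewrite lee_fin divr_ge0// ltW.
    - exact/measurable_EFinP.
    rewrite integral_indic//; last exact: measurable_cube.
    rewrite setIT [X in (_ * X)%E]lebesgue_cube; last by rewrite mulr_ge0 ?(ltW l0) ?(ltW (t0 j)).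
    rewrite -EFinM tl; congr EFin; rewrite /g /eta.
    have -> : (r / 2) ^+ n.+1 = ((2 ^+ j.+1) ^+ n.+1)^-1 * (r * 2 ^+ j) ^+ n.+1.
      rewrite -exprVn -exprMn; congr (_ ^+ _).
      by rewrite exprS; field; rewrite expf_neq0// gt_eqF.
    by ring.
  by rewrite sumEFin sumr_const card_ord mulr_natl.
move=> /le_trans/(_ (lee_wpmul2r (space_norm_ge0 X_bbfs (proj1 X1)) NG)).
rewrite -(fineK hf) -(fineK (space_norm_fin X_bbfs X1)) -!EFinM lee_fin -/n' => le1.
have N1 := norm_cube_gt0 X_bbfs c l0.
have [T0|T0] := leP T 0; first exact: le_trans T0 (ltW N1).
rewrite (gtr0_norm T0) in mT.
have c0 : 0 < CM * n'.
  rewrite lt0r mulr_ge0 ?(ltW CM0)// andbT; apply/eqP => cz.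
  by move: le1; rewrite cz mul0r leNgt mulr_gt0// ltr0n.
by rewrite -(ler_pM2l c0) mulrC; apply: le_trans mT le1.
Qed.

End norm_estimates.

(** * Campanato spaces *)

Section oscillation_limits.
Context {R : realType} {n : nat}.
Local Notation E := 'rV[R]_n.+1.
Implicit Types (c z : E) (l a e : R) (f : E -> R).

Lemma cvge0P (T : Type) (F : set_system T) (FF : Filter F) (u : T -> \bar R) :
  (\forall x \near F, (0 <= u x)%E) ->
  u @ F --> 0%E <-> (forall e, 0 < e -> \forall x \near F, (u x <= e%:E)%E).
Proof.
move=> u0; split=> [/fine_cvgP[ufin /cvgrPdist_le cv] e e0|ule].
  near=> x; have xfin : u x \is a fin_num by near: x.
  rewrite -(fineK xfin) lee_fin; apply: le_trans (ler_norm _) _.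
  by rewrite -normrN -sub0r; near: x; exact: cv.
apply/fine_cvgP; split.
  near=> x; rewrite ge0_fin_numE; last by near: x.
  apply: (@le_lt_trans _ _ 1%:E); last by rewrite ltry.
  by near: x; exact: ule.
apply/cvgrPdist_le => e e0; near=> x; rewrite sub0r normrN ger0_norm.
  have xe : (u x <= e%:E)%E by near: x; exact: ule.
  have xfin : u x \is a fin_num.
    by rewrite ge0_fin_numE ?(le_lt_trans xe) ?ltry//; near: x.
  by rewrite -lee_fin fineK.
by apply: fine_ge0; near: x.
Unshelve. all: by end_near. Qed.

#[export] Instance infty_nbhs_filter : Filter (@infty_nbhs R n).
Proof.
apply: Build_Filter.
- by exists 0.
- move=> P Q [A PA] [B QB]; exists (Num.max A B) => z; rewrite gt_max => /andP[Az Bz].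
  by split; [exact: PA|exact: QB].
- by move=> P Q PQ [A PA]; exists A => z /PA /PQ.
Qed.

Lemma translate_cube c l z : translate (cube c l) z = cube (c + z) l.
Proof.
apply/seteqP; split => [_ [x cx <-] i|x cx]; first by have := cx i; rewrite !mxE; lra.
exists (x - z); last by rewrite subrK.
by move=> i; have := cx i; rewrite !mxE; lra.
Qed.

Variable O : (E -> R) -> set E -> \bar R.
Variable f : E -> R.
Hypothesis O_ge0 : forall c l, 0 < l -> (0 <= O f (cube c l))%E.

Lemma cube_sup_le (P : set R) e :
  (cube_sup O P f <= e%:E)%E <->
  forall c l, 0 < l -> P l -> (O f (cube c l) <= e%:E)%E.
Proof.
split=> [le_e c l l0 Pl|le_e].
  by apply: le_trans le_e; apply: ereal_sup_ubound; exists (c, l).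
by apply: ge_ereal_sup => _ [[c l] /= [l0 Pl] <-]; exact: le_e.
Qed.

Lemma cube_sup_ge0 (P : set R) l : 0 < l -> P l -> (0 <= cube_sup O P f)%E.
Proof.
move=> l0 Pl; apply: le_trans (O_ge0 0 l0) _.
by apply: ereal_sup_ubound; exists (0, l).
Qed.

Lemma LspaceP : L1loc f -> Defs.Lspace O f <->
  exists K : R, forall c l, 0 < l -> (O f (cube c l) <= K%:E)%E.
Proof.
move=> fL; split=> [[_ fin]|[K OK]].
  exists (fine (cube_sup O setT f)) => c l l0.
  rewrite fineK; first by apply: ereal_sup_ubound; exists (c, l).
  by rewrite ge0_fin_numE// (cube_sup_ge0 ltr01).
split => //; apply: (@le_lt_trans _ _ K%:E); last by rewrite ltry.
by apply/cube_sup_le => c l l0 _; exact: OK.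
Qed.

Lemma cube_sup_small_cvg0 :
  cube_sup O [set l | l <= a] f @[a --> 0^'+] --> 0%E <->
  forall e, 0 < e -> exists2 a, 0 < a & forall c l, 0 < l -> l <= a ->
    (O f (cube c l) <= e%:E)%E.
Proof.
rewrite cvge0P; last first.
  (* For a <= 0 no cube is admissible and the supremum is -oo, so nonnegativity holds for positive
     a. *)
  near=> a; have a0 : 0 < a by near: a; exact: nbhs_right_gt.
  by apply: (cube_sup_ge0 a0) => /=.
split=> H e e0.
  have : \forall a \near 0^'+, 0 < a /\ (cube_sup O [set l | (l <= a)%R] f <= e%:E)%E.
    by near=> a; split; near: a; [exact: nbhs_right_gt|exact: H].
  move=> /filter_ex[a [a0 sup_e]]; have le_e := (cube_sup_le _ _).1 sup_e.
  by exists a.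
have [a a0 le_e] := H e e0; near=> b; apply/cube_sup_le => c l l0 /= lb.
apply: le_e => //; apply: le_trans lb _; near: b; exact: nbhs_right_le.
Unshelve. all: by end_near. Qed.

Lemma cube_sup_large_cvg0 :
  cube_sup O [set l | a <= l] f @[a --> +oo] --> 0%E <->
  forall e, 0 < e -> exists2 a, 0 < a & forall c l, a <= l ->
    (O f (cube c l) <= e%:E)%E.
Proof.
rewrite cvge0P; last first.
  near=> a; have a0 : 0 < a by near: a; exact: nbhs_pinfty_gt.
  by apply: (cube_sup_ge0 a0) => /=.
split=> H e e0.
  have : \forall a \near +oo, 0 < a /\ (cube_sup O [set l | (a <= l)%R] f <= e%:E)%E.
    by near=> a; split; near: a; [exact: nbhs_pinfty_gt|exact: H].
  move=> /filter_ex[a [a0 sup_e]]; have le_e := (cube_sup_le _ _).1 sup_e.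
  exists a => // c l al.
  by apply: le_e => //; exact: lt_le_trans al.
have [a a0 le_e] := H e e0; near=> b; apply/cube_sup_le => c l l0 /= bl.
apply: le_e => //; apply: le_trans bl; near: b.
by apply: nbhs_pinfty_ge; exact: num_real.
Unshelve. all: by end_near. Qed.

Lemma translate_cvg0 c l : 0 < l ->
  O f (translate (cube c l) z) @[z --> infty_nbhs] --> 0%E <->
  forall e, 0 < e -> exists A : R, forall z, A < euclid z ->
    (O f (cube (c + z) l) <= e%:E)%E.
Proof.
move=> l0; rewrite cvge0P; last first.
  by exists 0 => z _; rewrite translate_cube O_ge0.
split=> H e e0; have [A HA] := H e e0; exists A => z /HA; rewrite translate_cube//.
Qed.

End oscillation_limits.

(** * Oscillations of subcubes and the upper bound for [oscX] *)

Section campanato_comparison.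
Context {R : realType} {n : nat}.
Local Notation E := 'rV[R]_n.+1.
Implicit Types (c z : E) (l a e : R).
Variables (alpha : R) (f : E -> R).
Hypotheses (alpha_ge0 : 0 <= alpha) (fL : L1loc f).
Let s := Num.truncn alpha.

Definition real_osc c l : R := l `^ (- alpha) * mean_osc s f c l.

Lemma osc_real c l : 0 < l -> osc alpha f (cube c l) = (real_osc c l)%:E.
Proof.
move=> l0; rewrite /osc (vol_cube c (ltW l0)) -/s.
have iD := integrable_dev fL c l (poly_proj s (cube c l) f).
rewrite -(fineK (integrable_fin_num (measurable_cube c l) iD)).
rewrite -[fine _]/(Rintegral _ _ (fun x => `|f x - peval (poly_proj s (cube c l) f) x|)).
rewrite (mean_osc_int s f c l0) -EFinM; congr EFin; rewrite /real_osc.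
have ld : 0 < l ^+ n.+1 by rewrite exprn_gt0.
rewrite powRD ?(gt_eqF ld) ?implybT// powR_inv1 ?(ltW ld)//.
have -> : (l ^+ n.+1) `^ (- (alpha / n.+1%:R)) = l `^ (- alpha).
  rewrite -(powR_mulrn n.+1 (ltW l0)) -powRrM; congr (_ `^ _).
  by rewrite mulrN mulrC divfK ?pnatr_eq0.
by field; rewrite !gt_eqF.
Qed.

Lemma mean_osc_real c l : 0 < l -> mean_osc s f c l = l `^ alpha * real_osc c l.
Proof.
move=> l0; rewrite /real_osc mulrA -powRD ?(gt_eqF l0) ?implybT// subrr powRr0.
by rewrite mul1r.
Qed.

Lemma real_osc_ge0 c l : 0 < l -> 0 <= real_osc c l.
Proof. by move=> l0; rewrite mulr_ge0 ?powR_ge0// mean_osc_ge0. Qed.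

Lemma cube_sub_le c c' l l' : 0 < l' -> cube c' l' `<=` cube c l -> l' <= l.
Proof.
move=> l'0 sub.
have c1 : cube c' l' c' by move=> i; rewrite lexx lerDl ltW.
have c2 : cube c' l' (c' + const_mx l') by move=> i; rewrite !mxE lexx lerDl (ltW l'0).
by have := sub _ c1 ord0; have := sub _ c2 ord0; rewrite !mxE; lra.
Qed.

(** Using P_Q f as competitor on the subcube costs a factor 1 + k, by the projection bound, and
    enlarging the domain of integration costs a volume ratio. The lower bound a for l' makes the
    constant independent of the subcube. *)
Lemma real_osc_subcube : exists2 C : R, 0 < C & forall a l c c' l', 0 < a -> a <= l' ->
  cube c' l' `<=` cube c l ->
  real_osc c' l' <= C * (l / a) ^+ n.+1 * (l / a) `^ alpha * real_osc c l.
Proof.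
have [k k0 kP] := proj_dev_bound s fL.
exists (1 + k); first by lra.
move=> a l c c' l' a0 al sub.
have l'0 : 0 < l' by exact: lt_le_trans al.
have ll := cube_sub_le l'0 sub; have l0 : 0 < l by exact: lt_le_trans ll.
have [Ps _] := poly_projP s l0 (L1loc_integrable c l fL).
set p := poly_proj s (cube c l) f in Ps.
have l'd : 0 < l' ^+ n.+1 by rewrite exprn_gt0.
have iD := integrable_dev fL c' l' p.
have mQ := measurable_cube c' l'.
have mean_sub : mean c' l' (fun x => `|f x - peval p x|) * l' ^+ n.+1 <=
    mean_osc s f c l * l ^+ n.+1.
  rewrite -mean_osc_int// -/p /mean mulrAC mulVf ?mul1r ?gt_eqF//.
  by apply: le_Rintegral_subset (integrable_dev fL c l p) => //; exact: measurable_cube.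
have m0 : 0 <= mean c' l' (fun x => `|f x - peval p x|).
  by rewrite mulr_ge0 ?invr_ge0 ?(ltW l'd)//; exact: Rintegral_ge0.
have osc_sub : mean_osc s f c' l' <= (1 + k) * mean c' l' (fun x => `|f x - peval p x|).
  rewrite /mean_osc {1}/mean mulrC ler_pdivrMr//.
  rewrite (_ : _ * l' ^+ n.+1 = \int[lebesgue]_(x in cube c' l')
     (`|f x - peval p x| + k * mean c' l' (fun x => `|f x - peval p x|))); last first.
    rewrite RintegralD//; last first.
      apply: (integrable_bounded (M := `|k * mean c' l' (fun x => `|f x - peval p x|)|) mQ) => //.
      exact: lebesgue_cube_fin.
    rewrite Rintegral_cst// -[fine _]/(vol (cube c' l')) (vol_cube c' (ltW l'0)).
    by rewrite /mean; field; rewrite gt_eqF.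
  apply: (le_Rintegral mQ (integrable_dev fL _ _ _)).
    apply: (integrableD_real mQ iD).
    apply: (integrable_bounded (M := `|k * mean c' l' (fun x => `|f x - peval p x|)|) mQ) => //.
    exact: lebesgue_cube_fin.
  move=> x cx; have := kP c' l' p l'0 Ps x cx.
  move: (f x) (peval p x) (peval (poly_proj s (cube c' l') f) x) => u v w le2.
  by apply: le_trans (lerD (lexx _) le2); rewrite (distrC w); exact: ler_distD.
have step : mean_osc s f c' l' <= (1 + k) * (l / a) ^+ n.+1 * mean_osc s f c l.
  apply: le_trans osc_sub _; rewrite -mulrA ler_pM2l; last by lra.
  rewrite -(ler_pM2r l'd); apply: le_trans mean_sub _.
  have -> : (l / a) ^+ n.+1 * mean_osc s f c l * l' ^+ n.+1 =
     mean_osc s f c l * l ^+ n.+1 * (l' / a) ^+ n.+1.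
    by rewrite !exprMn; ring.
  apply: ler_peMr; first by apply: mulr_ge0; [exact: mean_osc_ge0|rewrite exprn_ge0// ltW].
  by rewrite exprn_ege1// ler_pdivlMr// mul1r.
rewrite /real_osc.
have la : l' `^ (- alpha) <= (l / a) `^ alpha * l `^ (- alpha).
  rewrite powRM ?invr_ge0 ?(ltW l0) ?(ltW a0)// mulrAC -powRD ?(gt_eqF l0) ?implybT//.
  rewrite subrr powRr0 mul1r -powR_inv1 ?(ltW a0)// -powRrM mulN1r.
  by rewrite !powRN lef_pV2 ?posrE ?powR_gt0// ge0_ler_powR// ?nnegrE ?(ltW a0) ?(ltW l'0).
have o0 := mean_osc_ge0 s f c' l'0.
apply: le_trans (ler_pM (powR_ge0 _ _) o0 la step) _.
by rewrite le_eqVlt; apply/orP; left; apply/eqP; ring.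
Qed.

Hypothesis small_osc : forall e, 0 < e -> exists2 a, 0 < a &
  forall c l, 0 < l -> l <= a -> real_osc c l <= e.

Lemma leaf_error_small c l e : 0 < l -> 0 < e -> exists k, leaf_error s f k c l <= e.
Proof.
move=> l0 e0; have ld : 0 < l ^+ n.+1 by rewrite exprn_gt0.
have [a a0 small] := small_osc (divr_gt0 e0 ld).
(* Side at most a makes the normalized oscillation small; side at most 1 makes the factor l^alpha
   relating it to the mean oscillation at most 1. *)
have [k ka] : exists k : nat, l / 2 ^+ k <= Num.min a 1.
  exists (Num.truncn (l / Num.min a 1)).+1.
  have m0 : 0 < Num.min a 1 by rewrite lt_min a0 ltr01.
  rewrite ler_pdivrMr ?exprn_gt0// mulrC -ler_pdivrMr//.
  apply: le_trans (ltW (truncnS_gt _)) _.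
  by rewrite -natrX ler_nat ltnW// ltn_expl.
exists k; apply: le_trans (leaf_error_le c (b := e / l ^+ n.+1) l0 _) _.
  have lk : 0 < l / 2 ^+ k by rewrite divr_gt0// exprn_gt0.
  move: ka; rewrite le_min => /andP[ka k1] c'.
  rewrite mean_osc_real//; apply: le_trans (small c' _ lk ka).
  have le1 : (l / 2 ^+ k) `^ alpha <= (l / 2 ^+ k) `^ 0.
    by apply: ger_powR => //; rewrite lk k1.
  by rewrite powRr0 in le1; apply: ler_piMl => //; exact: real_osc_ge0.
by rewrite divfK// gt_eqF.
Qed.

Variable N : (E -> R) -> \bar R.
Hypotheses (X_bbfs : ball_banach_function_space N) (M_bounded : maximal_bounded_on_assoc N).

Lemma oscX_le : exists2 C : R, 0 < C & forall c l e K A (B : set E),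
  0 < l -> 0 < e -> 0 <= K -> 0 < A -> measurable B ->
  (forall c' l', 0 < l' -> cube c' l' `<=` cube c l -> real_osc c' l' <= e \/
     [/\ cube c' l' `<=` B, l' <= A & real_osc c' l' <= K]) ->
  (oscX alpha N f (cube c l) <= (C * (e + K * A `^ alpha * l `^ (- alpha) *
     (fine (N \1_(B `&` cube c l)) / fine (N \1_(cube c l)))))%:E)%E.
Proof.
have [C C0 CP] := dev_norm_bound X_bbfs M_bounded s fL.
exists C => // c l e K A B l0 e0 K0 A0 mB osc_le.
have N1 := norm_cube_gt0 X_bbfs c l0.
have la : 0 < l `^ alpha by rewrite powR_gt0.
have Aa : 0 < A `^ alpha by rewrite powR_gt0.
(* A mean oscillation is l'^alpha times the normalized one, with l' <= l in general and l' <= A on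
   the exceptional subcubes; this dictates the two weights. *)
have := CP c l (e * l `^ alpha) (K * A `^ alpha) B l0 (mulr_gt0 e0 la) (mulr_ge0 K0 (ltW Aa)) mB _
   (fun eta eta0 => leaf_error_small c l0 eta0).
move=> /(_ _) H.
rewrite /oscX (vol_cube c (ltW l0)) -/s.
have vE : (l ^+ n.+1) `^ (- (alpha / n.+1%:R)) = l `^ (- alpha).
  rewrite -(powR_mulrn n.+1 (ltW l0)) -powRrM; congr (_ `^ _).
  by rewrite mulrN mulrC divfK ?pnatr_eq0.
rewrite vE; have lNa : 0 < l `^ (- alpha) by rewrite powR_gt0.
have laN : l `^ alpha * l `^ (- alpha) = 1.
  by rewrite -powRD ?(gt_eqF l0) ?implybT// subrr powRr0.
apply: le_trans (lee_wpmul2l _ (H _)) _.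
- by rewrite lee_fin divr_ge0 ?(ltW N1) ?(ltW lNa).
- move=> c' l' l'0 sub; rewrite mean_osc_real//; have ll := cube_sub_le l'0 sub.
  have [le_e|[cB l'A le_K]] := osc_le c' l' l'0 sub; [left|right; split => //].
    rewrite mulrC; apply: ler_pM => //; rewrite ?powR_ge0 ?real_osc_ge0//.
    by rewrite ge0_ler_powR// nnegrE ltW.
  apply: (@le_trans _ _ (K * A `^ alpha)); last by rewrite lerDr mulr_ge0// ltW.
  rewrite mulrC; apply: ler_pM => //; rewrite ?powR_ge0 ?real_osc_ge0//.
  by rewrite ge0_ler_powR// nnegrE ltW.
rewrite -EFinM lee_fin le_eqVlt; apply/orP; left; apply/eqP.
set NB := fine (N \1_(B `&` _)); set N' := fine (N \1_(cube c l)) in N1 *.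
transitivity (C * (e * (l `^ alpha * l `^ (- alpha)) * (N' / N') +
  K * A `^ alpha * l `^ (- alpha) * (NB / N'))); first by field; rewrite gt_eqF.
by rewrite laN divff ?gt_eqF// !mulr1.
Qed.

End campanato_comparison.

(** * Transfer of the vanishing conditions from a larger oscillation to a smaller one *)

Section domination.
Context {R : realType} {n : nat}.
Local Notation E := 'rV[R]_n.+1.
Variables (O1 O2 : (E -> R) -> set E -> \bar R) (f : E -> R).
Hypothesis fL : L1loc f.
Hypothesis O1_ge0 : forall (c : E) (l : R), 0 < l -> (0 <= O1 f (cube c l))%E.
Hypothesis O2_ge0 : forall (c : E) (l : R), 0 < l -> (0 <= O2 f (cube c l))%E.
Hypothesis O12 : exists2 C : R, 0 < C &
  forall c l, 0 < l -> (O1 f (cube c l) <= C%:E * O2 f (cube c l))%E.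

Let dom : exists2 C : R, 0 < C & forall c l (e : R), 0 < l ->
  (O2 f (cube c l) <= (e / C)%:E)%E -> (O1 f (cube c l) <= e%:E)%E.
Proof.
have [C C0 HC] := O12; exists C => // c l e l0 le_e.
apply: le_trans (HC c l l0) _; apply: le_trans (lee_wpmul2l _ le_e) _.
  by rewrite lee_fin ltW.
by rewrite -EFinM lee_fin mulrC divfK// gt_eqF.
Qed.

Lemma VLspace_dominated : VLspace O2 f -> VLspace O1 f.
Proof.
have [C C0 HC] := dom.
move=> [/(LspaceP O2_ge0 fL)[K OK] /(cube_sup_small_cvg0 O2_ge0) small]; split.
  apply/(LspaceP O1_ge0 fL); exists (C * K) => c l l0; apply: HC => //.
  by rewrite mulrAC divff ?mul1r ?OK// gt_eqF.
apply/(cube_sup_small_cvg0 O1_ge0) => e e0.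
have [a a0 Ha] := small (e / C) (divr_gt0 e0 C0).
by exists a => // c l l0 la; apply: HC => //; exact: Ha.
Qed.

Lemma XLspace_dominated : XLspace O2 f -> XLspace O1 f.
Proof.
have [C C0 HC] := dom.
move=> [/VLspace_dominated Vf far]; split => // c l l0.
apply/(translate_cvg0 O1_ge0 c l0) => e e0.
have [A HA] := (translate_cvg0 O2_ge0 c l0).1 (far c l l0) (e / C) (divr_gt0 e0 C0).
by exists A => z Az; apply: HC => //; exact: HA.
Qed.

Lemma CLspace_dominated : CLspace O2 f -> CLspace O1 f.
Proof.
have [C C0 HC] := dom.
move=> [/XLspace_dominated Xf /(cube_sup_large_cvg0 O2_ge0) large]; split => //.
apply/(cube_sup_large_cvg0 O1_ge0) => e e0.
have [a a0 Ha] := large (e / C) (divr_gt0 e0 C0).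
exists a => // c l al; apply: HC; last exact: Ha.
exact: lt_le_trans al.
Qed.

End domination.

(** * From the classical spaces to the X-based ones *)

Section campanato_spaces.
Context {R : realType} {n : nat}.
Local Notation E := 'rV[R]_n.+1.
Variables (alpha : R) (N : (E -> R) -> \bar R) (f : E -> R).
Hypotheses (alpha_ge0 : 0 <= alpha) (X_bbfs : ball_banach_function_space N).
Hypotheses (M_bounded : maximal_bounded_on_assoc N) (fL : L1loc f).

Lemma osc_ge0 (c : E) (l : R) : 0 < l -> (0 <= osc alpha f (cube c l))%E.
Proof.
by move=> l0; apply: mule_ge0; [rewrite lee_fin powR_ge0|exact: integral_ge0].
Qed.

Lemma oscX_ge0 (c : E) (l : R) : 0 < l -> (0 <= oscX alpha N f (cube c l))%E.
Proof.
move=> l0; apply: mule_ge0.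
  by rewrite lee_fin divr_ge0 ?powR_ge0// ltW// norm_cube_gt0.
apply: (space_norm_ge0 X_bbfs); apply: measurable_funM.
  by apply: measurable_funB; [exact: (proj1 fL)|exact: measurable_peval].
by apply: measurable_indic; exact: measurable_cube.
Qed.

Let O := real_osc alpha f.

Let small_scale (Vf : VLspace (osc alpha) f) (e : R) : 0 < e -> exists2 a : R, 0 < a &
  forall c l, 0 < l -> l <= a -> O c l <= e.
Proof.
move=> e0; have [a a0 Ha] := (cube_sup_small_cvg0 osc_ge0).1 (proj2 Vf) e e0.
by exists a => // c l l0 la; rewrite -lee_fin -osc_real//; exact: Ha.
Qed.

Let bounded (Vf : VLspace (osc alpha) f) : exists2 K : R, 0 < K &
  forall c l, 0 < l -> O c l <= K.
Proof.
have [K OK] := (LspaceP osc_ge0 fL).1 (proj1 Vf).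
exists (`|K| + 1) => [|c l l0]; first by rewrite ltr_wpDl.
apply: (@le_trans _ _ K); first by rewrite -lee_fin -osc_real//; exact: OK.
by rewrite (le_trans (ler_norm _))// lerDl.
Qed.

Let oscX_le_sup (Vf : VLspace (osc alpha) f) : exists2 C : R, 0 < C &
  forall c l e, 0 < l -> 0 < e ->
  (forall c' l', 0 < l' -> cube c' l' `<=` cube c l -> O c' l' <= e) ->
  (oscX alpha N f (cube c l) <= (C * e)%:E)%E.
Proof.
have [C C0 HC] := oscX_le alpha_ge0 fL (small_scale Vf) X_bbfs M_bounded.
exists C => // c l e l0 e0 Oe.
have := HC c l e 0 1 set0 l0 e0 (lexx _) ltr01 measurable0.
by rewrite !mul0r addr0; apply => c' l' l'0 sub; left; exact: Oe.
Qed.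

Lemma VLspace_oscX : VLspace (osc alpha) f -> VLspace (oscX alpha N) f.
Proof.
move=> Vf; have [C C0 HC] := oscX_le_sup Vf.
split.
  have [K K0 OK] := bounded Vf.
  apply/(LspaceP oscX_ge0 fL); exists (C * K) => c l l0.
  by apply: HC => // c' l' l'0 _; exact: OK.
apply/(cube_sup_small_cvg0 oscX_ge0) => e e0.
have [a a0 Ha] := small_scale Vf (divr_gt0 e0 C0).
exists a => // c l l0 la.
have -> : e = C * (e / C) by rewrite mulrC divfK// gt_eqF.
apply: HC => //; first by rewrite divr_gt0.
move=> c' l' l'0 sub; apply: Ha => //; apply: le_trans la.
exact: cube_sub_le sub.
Qed.

(** Subcubes of Q + z of side at most a have small oscillation by the V condition. The others are
    comparable in size to Q + z, whose own oscillation tends to 0 and controls theirs. *)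
Lemma XLspace_oscX : XLspace (osc alpha) f -> XLspace (oscX alpha N) f.
Proof.
move=> [Vf far]; split; first exact: VLspace_oscX.
have [C C0 HC] := oscX_le_sup Vf.
move=> c l l0; apply/(translate_cvg0 oscX_ge0 c l0) => e e0.
have eC := divr_gt0 e0 C0.
have [a a0 Ha] := small_scale Vf eC.
have [D D0 HD] := real_osc_subcube alpha_ge0 fL.
pose M := D * (l / a) ^+ n.+1 * (l / a) `^ alpha.
have M0 : 0 < M by rewrite !mulr_gt0 ?exprn_gt0 ?powR_gt0 ?divr_gt0.
have [A HA] := (translate_cvg0 osc_ge0 c l0).1 (far c l l0) _ (divr_gt0 eC M0).
exists A => z /HA; rewrite osc_real// lee_fin => Oz.
have -> : e = C * (e / C) by rewrite mulrC divfK// gt_eqF.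
apply: HC => // c' l' l'0 sub; have [la|al] := leP l' a; first exact: Ha.
apply: le_trans (HD a l _ c' l' a0 (ltW al) sub) _.
by rewrite -/M -ler_pdivlMl// mulrC.
Qed.

(* Cubes of intermediate size are controlled far from the origin by the translates
   of one fixed cube; the remaining ones lie in a fixed cube, whose contribution
   is absorbed by the growth of the norm of indicators of large cubes. *)
Lemma CLspace_oscX : CLspace (osc alpha) f -> CLspace (oscX alpha N) f.
Proof.
move=> [Xf large]; split; first exact: XLspace_oscX.
have [Vf far] := Xf.
have [C C0 HC] := oscX_le alpha_ge0 fL (small_scale Vf) X_bbfs M_bounded.
have [K K0 OK] := bounded Vf.
apply/(cube_sup_large_cvg0 oscX_ge0) => e e0.
(* One half of e is for the subcubes of small oscillation, the other for the contribution of the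
   fixed cube. *)
pose e1 := e / (2 * C).
have e10 : 0 < e1 by rewrite divr_gt0// mulr_gt0.
have [a a0 Ha] := small_scale Vf e10.
have [A A0 HA] := (cube_sup_large_cvg0 osc_ge0).1 large e1 e10.
have [D D0 HD] := real_osc_subcube alpha_ge0 fL.
pose M := D * (A / a) ^+ n.+1 * (A / a) `^ alpha.
have M0 : 0 < M by rewrite !mulr_gt0 ?exprn_gt0 ?powR_gt0 ?divr_gt0.
have [r0 Hr0] := (translate_cvg0 osc_ge0 0 A0).1 (far 0 A A0) _ (divr_gt0 e10 M0).
pose r := `|r0|.
have r_ge0 : 0 <= r by exact: normr_ge0.
(* This cube contains every cube of side at most A whose corner has Euclidean norm at most r. *)
pose b : E := - const_mx r; pose t := 2 * r + A.
have t0 : 0 < t by rewrite ltr_wpDl// mulr_ge0.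
have mB := measurable_cube b t.
have NB := norm_cube_gt0 X_bbfs b t0.
set NBt := fine (N \1_(cube b t)) in NB.
(* Once the norm of 1_Q exceeds T, the contribution of the fixed cube is at most e1. *)
pose T := K * A `^ alpha * NBt / e1.
have [L L0 HL] := norm_cube_unbounded X_bbfs M_bounded b T t0.
(* The bound l >= 1 gives l^(- alpha) <= 1. *)
exists (Num.max L 1) => [|c l]; first by rewrite lt_max L0.
rewrite ge_max => /andP[Ll l1]; have l0 : 0 < l by exact: lt_le_trans L0 Ll.
have N1 := norm_cube_gt0 X_bbfs c l0.
apply: le_trans (HC c l e1 K A (cube b t) l0 e10 (ltW K0) A0 mB _) _.
  move=> c' l' l'0 sub; have [la|al] := leP l' a; first by left; exact: Ha.
  have [Al|lA] := leP A l'.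
    by left; rewrite -lee_fin -osc_real//; exact: HA.
  have [far_c|near_c] := ltP r (euclid c').
    (* Comparison with the cube of side A with the same corner, which is the translate by c' of the
       fixed cube at the origin. *)
    left; apply: le_trans (HD a A c' c' l' a0 (ltW al) _) _.
      by move=> x cx i; have := cx i; lra.
    rewrite -/M -ler_pdivlMl// mulrC -lee_fin -osc_real//.
    have := Hr0 c'; rewrite add0r; apply.
    exact: le_lt_trans (ler_norm _) far_c.
  right; split; [|exact: ltW|exact: OK].
  move=> x cx i; have := cx i; have := le_trans (coord_le_euclid c' i) near_c.
  by rewrite /b /t !mxE ler_norml; lra.
set NBQ := fine (N \1_(cube b t `&` cube c l)); set N' := fine (N \1_(cube c l)) in N1 *.
have XB := indic_cube_in_space X_bbfs b t0.
have mBQ : measurable_fun setT (\1_(cube b t `&` cube c l) : E -> R).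
  by apply: measurable_indic; apply: measurableI => //; exact: measurable_cube.
have XBQ : fspace N \1_(cube b t `&` cube c l).
  apply: (fspace_le X_bbfs XB mBQ) => x; rewrite !indicE in_setI.
  by case: (x \in cube b t); rewrite //= ?normr0// ; case: (_ \in _); rewrite ?normr1 ?normr0.
have NBQ_ge0 : 0 <= NBQ by rewrite fine_ge0// (space_norm_ge0 X_bbfs).
have NBQ_le : NBQ <= NBt.
  rewrite -lee_fin !fineK ?(space_norm_fin X_bbfs)//.
  apply: (space_norm_le X_bbfs (proj1 XB) mBQ) => x; rewrite !indicE in_setI.
  by case: (x \in cube b t); rewrite //= ?normr0// ; case: (_ \in _); rewrite ?normr1 ?normr0.
have lN : 0 < l `^ (- alpha) <= 1.
  rewrite powR_gt0//= powRN invf_le1 ?powR_gt0//.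
  have : 1 `^ alpha <= l `^ alpha by apply: ge0_ler_powR; rewrite // nnegrE// ltW.
  by rewrite powR1.
have Aa : 0 < A `^ alpha by rewrite powR_gt0.
suff small : K * A `^ alpha * l `^ (- alpha) * (NBQ / N') <= e1.
  rewrite lee_fin (_ : e = C * (e1 + e1)); last by rewrite /e1; field; rewrite gt_eqF.
  by rewrite ler_pM2l// lerD2l.
have [[y [By Qy]]|disj] := pselect (exists y, cube b t y /\ cube c l y); last first.
  rewrite /NBQ (_ : cube b t `&` cube c l = set0); last first.
    by apply/seteqP; split => // y [By Qy]; apply: disj; exists y.
  rewrite indic0 (_ : N _ = 0%E) ?mul0r ?mulr0 ?(ltW e10)//.
  exact: (space_norm0 X_bbfs).
have TN : T <= N' by exact: HL Qy.
rewrite mulrA ler_pdivrMr//.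
apply: (@le_trans _ _ (K * A `^ alpha * NBt)).
  apply: ler_pM => //; first by rewrite !mulr_ge0 ?(ltW K0) ?powR_ge0.
  by rewrite ler_piMr ?mulr_ge0 ?(ltW K0) ?(ltW Aa)//; have /andP[] := lN.
by rewrite [leRHS]mulrC -ler_pdivrMr.
Qed.

End campanato_spaces.

Theorem theorem1p6 (R : realType) (n : nat) (alpha : R)
    (N : ('rV[R]_n.+1 -> R) -> \bar R)
    (alpha_ge0 : 0 <= alpha)
    (X_bbfs : ball_banach_function_space N)
    (M_bounded : maximal_bounded_on_assoc N) :
  [/\ VLspace (osc alpha) = VLspace (oscX alpha N),
      XLspace (osc alpha) = XLspace (oscX alpha N)
    & CLspace (osc alpha) = CLspace (oscX alpha N)].
Proof.
have [C C0 HC] := osc_le_oscX X_bbfs M_bounded alpha.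
have dom (f : 'rV[R]_n.+1 -> R) : L1loc f -> exists2 C : R, 0 < C & forall c l, 0 < l ->
    (osc alpha f (cube c l) <= C%:E * oscX alpha N f (cube c l))%E.
  by move=> fL; exists C => // c l l0; exact: HC.
split; apply/seteqP; split => f Sf.
- by apply: VLspace_oscX => //; have [[]] := Sf.
- have fL : L1loc f by have [[]] := Sf.
  exact: (VLspace_dominated fL (osc_ge0 alpha f) (oscX_ge0 alpha X_bbfs fL) (dom f fL) Sf).
- by apply: XLspace_oscX => //; have [[[]]] := Sf.
- have fL : L1loc f by have [[[]]] := Sf.
  exact: (XLspace_dominated fL (osc_ge0 alpha f) (oscX_ge0 alpha X_bbfs fL) (dom f fL) Sf).
- by apply: CLspace_oscX => //; have [[[[]]]] := Sf.
- have fL : L1loc f by have [[[[]]]] := Sf.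
  exact: (CLspace_dominated fL (osc_ge0 alpha f) (oscX_ge0 alpha X_bbfs fL) (dom f fL) Sf).
Qed.
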